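(* Let $\equiv$ be a simple essential lattice congruence of the weak order on $\mathfrak{S}_n$. Then the $\equiv$-admissible separating trees are in bijection with the maximal cones of the quotient fan $\mathcal{F}_\equiv$ and with the vertices of the quotientope of $\equiv$.
   Context: Notation: $[n]=\{1,\dots,n\}$ and $]i,j[\,=\{i+1,\dots,j-1\}$ for $i<j$. The weak order on the permutations $\mathfrak{S}_n$ of $[n]$ is the lattice defined by $\sigma\le\tau$ iff $\mathrm{inv}(\sigma)\subseteq\mathrm{inv}(\tau)$, where $\mathrm{inv}(\sigma)=\{(\sigma_p,\sigma_q) : p<q,\ \sigma_p>\sigma_q\}$. A lattice congruence is an equivalence relation $\equiv$ on $\mathfrak{S}_n$ compatible with meets and joins; its classes are intervals. Arcs. An arc is a quadruple $(i,j,A,B)$ with $1\le i<j\le n$ and $A\sqcup B={]i,j[}$; $\mathcal{A}_n$ is the set of all arcs. The up arc is $u(i,j)=(i,j,]i,j[,\varnothing)$ and the down arc is $d(i,j)=(i,j,\varnothing,]i,j[)$. The arc $(i,j,A,B)$ is a subarc of $(i',j',A',B')$ if $i'\le i<j\le j'$, $A\subseteq A'$ and $B\subseteq B'$. For an arc $\alpha=(i,j,A,B)$ let $\sigma_\alpha$ be the permutation with a single descent whose one-line notation is $1,\dots,i-1$, then the elements of $A$ in increasing order, then $j$, then $i$, then the elements of $B$ in increasing order, then $j+1,\dots,n$. For a lattice congruence $\equiv$, let $\mathcal{A}_\equiv$ be the set of arcs $\alpha$ such that $\sigma_\alpha$ is the minimum of its $\equiv$-class. (The map $\equiv\ \mapsto\mathcal{A}_\equiv$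 is a bijection from the lattice congruences of the weak order on $\mathfrak{S}_n$ to the subsets of $\mathcal{A}_n$ closed under taking subarcs.) The congruence $\equiv$ is essential if $\mathcal{A}_\equiv$ contains all arcs $(i,i+1,\varnothing,\varnothing)$, $i\in[n-1]$. It is simple if every arc of $\mathcal{A}_n\setminus\mathcal{A}_\equiv$ having no strict subarc in $\mathcal{A}_n\setminus\mathcal{A}_\equiv$ is an up arc or a down arc. Quotient fan and quotientope. For a permutation $\sigma$, let $C(\sigma)=\{x\in\mathbb{R}^n : x_{\sigma_1}\le\dots\le x_{\sigma_n}\}$. The quotient fan $\mathcal{F}_\equiv$ is the complete fan in $\mathbb{R}^n$ whose maximal cones are the unions $\bigcup_{\sigma\in X}C(\sigma)$ over the $\equiv$-classes $X$ (and whose cones are all the faces of these). A quotientope of $\equiv$ is a polytope whose normal fan is $\mathcal{F}_\equiv$ (such a polytope is known to exist). Separating trees. In a directed tree $T$ (an orientation of a tree), the parents (resp. children) of a node $j$ are the targets of its outgoing edges (resp. the sources of its incoming edges), and the ancestor (resp. descendant) subtrees of $j$ are the connected components of $T\setminus j$ containing its parents (resp. children). A separating tree is a directed tree on $[n]$ in which each node has at most two parents and at most two children, and whenever a node $j$ has two parents (resp. two children), all nodes of one of its two ancestor (resp. descendant) subtrees are smaller than $j$ and all nodes of the other one are larger than $j$. For sets of integers, $L<R$ means that every element of $L$ is smaller than every element of $R$. Admissibility. The mandatory arcs of a separating tree $T$ are the arcs $(i,k,A,B)$ where $i<k$ are the endpoints of an edge of $T$ (in either direction) and $A$ (resp. $B$)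 is the set of nodes $j\in{]i,k[}$ such that $T$ has a directed path from $j$ to an endpoint of this edge (resp. from an endpoint of this edge to $j$). The forbidden up (resp. down) arcs of $T$ are the arcs $u(\max L,\min R)$ (resp. $d(\max L,\min R)$) where $L<R$ are two ancestor (resp. descendant) subtrees of a node of $T$. A separating tree $T$ is $\equiv$-admissible if $\mathcal{A}_\equiv$ contains all mandatory arcs of $T$ and none of the forbidden (up or down) arcs of $T$. *)

(* Defs.v *)
From HB Require Import structures.
From mathcomp Require Import all_boot all_order all_fingroup all_algebra.

Set Implicit Arguments.
Unset Strict Implicit.
Unset Printing Implicit Defensive.

Import Order.TTheory GRing.Theory Num.Theory.

(* The set [n] = {1, ..., n} is represented by 'I_n = {0, ..., n - 1}: every
   integer is shifted by one, which preserves all the order relations used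
   below.  The permutation s : 'S_n has one-line notation s 0, ..., s (n - 1). *)

Section WeakOrder.
Variable n : nat.
Implicit Types (s t : 'S_n) (e : rel 'S_n).

Definition inversions s : {set 'I_n * 'I_n} :=
  [set (s pq.1, s pq.2) | pq in [set pq : 'I_n * 'I_n |
                                   (pq.1 < pq.2) && (s pq.2 < s pq.1)]]%SET.

Definition weak_le s t : bool := inversions s \subset inversions t.

Definition is_meet s t m : Prop :=
  [/\ weak_le m s, weak_le m t
    & forall r, weak_le r s -> weak_le r t -> weak_le r m].

Definition is_join s t m : Prop :=
  [/\ weak_le s m, weak_le t m
    & forall r, weak_le s r -> weak_le t r -> weak_le m r].

Definition lattice_congruence e : Prop :=
  [/\ equivalence_rel e,
      forall s s' t t' m m', e s s' -> e t t' ->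
        is_meet s t m -> is_meet s' t' m' -> e m m'
    & forall s s' t t' m m', e s s' -> e t t' ->
        is_join s t m -> is_join s' t' m' -> e m m'].

Definition class_min e s : bool := [forall t, e s t ==> weak_le s t].

End WeakOrder.

Section Arcs.
Variable n : nat.
Implicit Types (i j : 'I_n) (s : 'S_n) (e : rel 'S_n).

Definition between i j : {set 'I_n} := [set k : 'I_n | i < k < j]%SET.

(* Raw quadruples (i, j, A, B); the arcs are those satisfying is_arc. *)
Definition quad : Type := ('I_n * 'I_n * {set 'I_n} * {set 'I_n})%type.
Implicit Type a : quad.

Definition is_arc a : bool :=
  let: (i, j, A, B) := a in
  [&& i < j, A :|: B == between i j & [disjoint A & B]].

Definition up_arc i j : quad := (i, j, between i j, set0).
Definition down_arc i j : quad := (i, j, set0, between i j).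

Definition subarc a a' : bool :=
  let: (i, j, A, B) := a in
  let: (i', j', A', B') := a' in
  [&& i' <= i, i < j, j <= j', A \subset A' & B \subset B'].

Definition one_line s : seq 'I_n := [seq s p | p <- enum 'I_n].

(* The one-line notation of the permutation sigma_alpha; enum lists the
   elements of a subset of 'I_n in increasing order. *)
Definition arc_word a : seq 'I_n :=
  let: (i, j, A, B) := a in
  [seq k : 'I_n <- enum 'I_n | k < i] ++ enum A ++ [:: j; i] ++ enum B ++
  [seq k : 'I_n <- enum 'I_n | j < k].

Lemma arc_word_perm a :
  is_arc a -> exists! s : 'S_n, one_line s = arc_word a.
Proof.
case: a => [[[i j] A] B] /and3P[ij /eqP AB dAB].
have mAB k : (k \in A) || (k \in B) = (i < k < j).
  by rewrite -in_setU AB inE.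
have nAB k : k \in A -> k \in B -> False.
  by move=> kA kB; move/pred0P: dAB => /(_ k); rewrite /= kA kB.
have flt (P : pred 'I_n) k : (k \in [seq x <- enum 'I_n | P x]) = P k.
  by rewrite mem_filter (mem_enum 'I_n) andbT.
have Hperm : perm_eq (arc_word (i, j, A, B)) (enum 'I_n).
  apply: uniq_perm (enum_uniq _) _; last first.
    move=> k; rewrite !mem_cat !flt (mem_enum A) (mem_enum B) (mem_enum 'I_n).
    rewrite !inE.
    case: (ltngtP k i) => [//|ik|/val_inj ->]; last by rewrite eqxx !orbT.
    case: (ltngtP j k) => [|kj|/val_inj ->]; rewrite ?eqxx ?orbT //.
    have := mAB k; rewrite ik kj /=.
    by case/orP => ->; rewrite ?orbT.
  have fu (P : pred 'I_n) : uniq [seq x <- enum 'I_n | P x].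
    by apply: filter_uniq; apply: enum_uniq.
  rewrite !cat_uniq !fu !enum_uniq andbT !andTb.
  have nji : j != i by rewrite -val_eqE /= gtn_eqF.
  apply/and5P; split.
  - apply/hasPn => k; rewrite flt !mem_cat flt (mem_enum A) (mem_enum B) !inE.
    rewrite -leqNgt => H; have := mAB k; move: H.
    case: (k \in A) => [_ /esym/andP[/ltnW]|] //.
    case: (k \in B) => [_ /esym/andP[/ltnW]|] //; rewrite ?orbF ?orFb.
    case/orP => [/orP[]/eqP-> _|/(ltn_trans ij)/ltnW] //; exact: ltnW.
  - apply/hasPn => k; rewrite !mem_cat flt (mem_enum A) (mem_enum B) !inE.
    apply: contraL => kA; have := mAB k; rewrite kA /= => /esym/andP[ik kj].
    rewrite !negb_or; apply/and3P; split.
    + apply/andP; split; first by apply: contraL kj => /eqP ->; rewrite ltnn.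
      by apply: contraL ik => /eqP ->; rewrite ltnn.
    + by apply/negP => /(nAB k kA).
    + by rewrite -leqNgt ltnW.
  - by rewrite /= inE nji.
  - apply/hasPn => k; rewrite !mem_cat flt (mem_enum B) !inE.
    apply: contraL => /orP[] /eqP ->; rewrite negb_or -leqNgt.
      by rewrite leqnn andbT; have := mAB j; rewrite ltnn andbF => /norP[].
    by rewrite (ltnW ij) andbT; have := mAB i; rewrite ltnn /= => /norP[].
  - apply/hasPn => k; rewrite flt (mem_enum B) => jk; apply/negP => kB.
    by have := mAB k; rewrite kB orbT (ltnNge k j) (ltnW jk) andbF.
have szw : size (arc_word (i, j, A, B)) = n.
  by rewrite (perm_size Hperm) size_enum_ord.
have uw : uniq (arc_word (i, j, A, B)).
  by rewrite (perm_uniq Hperm) enum_uniq.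
pose f (k : 'I_n) := nth i (arc_word (i, j, A, B)) k.
have injf : injective f.
  move=> k l /eqP; rewrite /f nth_uniq ?szw // => /eqP; exact: val_inj.
exists (perm injf); split.
  apply: (@eq_from_nth _ i) => [|k].
    by rewrite size_map size_enum_ord szw.
  rewrite size_map size_enum_ord => kn.
  by rewrite (nth_map i) ?size_enum_ord // permE /f nth_enum_ord.
move=> t tw; apply/permP => k; rewrite permE /f -tw.
by rewrite (nth_map i) ?size_enum_ord // nth_ord_enum.
Qed.

(* The set of arcs associated with e; the permutation s below is sigma_a, which
   exists and is unique by arc_word_perm. *)
Definition arcs_of e : {set quad} :=
  [set a | is_arc a &&
     [exists s : 'S_n, (one_line s == arc_word a) && class_min e s]]%SET.

Definition essential e : Prop :=
  forall i j : 'I_n, j = i.+1 :> nat -> (i, j, set0, set0) \in arcs_of e.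

Definition simple_congruence e : Prop :=
  forall a, is_arc a -> a \notin arcs_of e ->
    (forall b, is_arc b -> b \notin arcs_of e -> subarc b a -> b = a) ->
  exists i j, a = up_arc i j \/ a = down_arc i j.

End Arcs.

Section SeparatingTrees.
Variable n : nat.

(* A directed graph is given by its set of edges: (x, y) \in T is x -> y. *)
Implicit Types (T : {set 'I_n * 'I_n}) (x y j k : 'I_n).

Definition edge T : rel 'I_n := fun x y => (x, y) \in T.

Definition adjacent T : rel 'I_n := fun x y => edge T x y || edge T y x.

Definition directed_tree T : Prop :=
  [/\ forall x y, edge T x y -> ~~ edge T y x,
      forall x y, connect (adjacent T) x y
    & forall c : seq 'I_n, 2 < size c -> ~ ucycle (adjacent T) c].

Definition parents T j : {set 'I_n} := [set k | edge T j k]%SET.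
Definition children T j : {set 'I_n} := [set k | edge T k j]%SET.

(* The connected component of k in T minus the node j, for k != j. *)
Definition component T j k : {set 'I_n} :=
  [set x | connect (fun x y => [&& x != j, y != j & adjacent T x y]) k x]%SET.

Definition ancestor_subtrees T j : {set {set 'I_n}} :=
  [set component T j k | k in parents T j]%SET.
Definition descendant_subtrees T j : {set {set 'I_n}} :=
  [set component T j k | k in children T j]%SET.

Definition separated_by j (S : {set {set 'I_n}}) : Prop :=
  exists L R : {set 'I_n},
    [/\ S = [set L; R]%SET, forall x, x \in L -> x < j
      & forall x, x \in R -> j < x].

Definition separating_tree T : Prop :=
  directed_tree T /\
  forall j,
    [/\ #|parents T j| <= 2, #|children T j| <= 2,
        #|parents T j| = 2 -> separated_by j (ancestor_subtrees T j)
      & #|children T j| = 2 -> separated_by j (descendant_subtrees T j)].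

Definition mandatory_arc T (a : quad n) : Prop :=
  exists i k : 'I_n,
    [/\ i < k, adjacent T i k
      & a = (i, k,
             [set j in between i k |
                connect (edge T) j i || connect (edge T) j k]%SET,
             [set j in between i k |
                connect (edge T) i j || connect (edge T) k j]%SET)].

Definition is_max (S : {set 'I_n}) x : Prop :=
  x \in S /\ forall y, y \in S -> y <= x.
Definition is_min (S : {set 'I_n}) x : Prop :=
  x \in S /\ forall y, y \in S -> x <= y.

Definition set_lt (L R : {set 'I_n}) : Prop :=
  forall x y, x \in L -> y \in R -> x < y.

Definition forbidden_up_arc T (a : quad n) : Prop :=
  exists j (L R : {set 'I_n}) l r,
    [/\ L \in ancestor_subtrees T j, R \in ancestor_subtrees T j, set_lt L R
      & [/\ is_max L l, is_min R r & a = up_arc l r]].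

Definition forbidden_down_arc T (a : quad n) : Prop :=
  exists j (L R : {set 'I_n}) l r,
    [/\ L \in descendant_subtrees T j, R \in descendant_subtrees T j,
        set_lt L R
      & [/\ is_max L l, is_min R r & a = down_arc l r]].

Definition admissible (e : rel 'S_n) T : Prop :=
  [/\ separating_tree T,
      forall a, mandatory_arc T a -> a \in arcs_of e,
      forall a, forbidden_up_arc T a -> a \notin arcs_of e
    & forall a, forbidden_down_arc T a -> a \notin arcs_of e].

End SeparatingTrees.

From mathcomp Require Import boolp classical_sets functions cardinality reals.

Local Open Scope classical_set_scope.
Local Open Scope ring_scope.

Definition admissible_trees (n : nat) (e : rel 'S_n) :
    set {set 'I_n * 'I_n} :=
  [set T | admissible e T].

Section Geometry.
Variables (R : realType) (n : nat).
Local Notation vec := 'rV[R]_n.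
Implicit Types (x y c : vec) (K F P : set vec).

Definition dot x y : R := \sum_i x 0 i * y 0 i.

Definition perm_cone (s : 'S_n) : set vec :=
  [set x | forall p q : 'I_n, (p <= q)%N -> x 0 (s p) <= x 0 (s q)].

Definition class_cone (e : rel 'S_n) (s : 'S_n) : set vec :=
  \bigcup_(t in [set t | e s t]) perm_cone t.

(* Faces of a cone, cut out by supporting hyperplanes through the origin;
   c = 0 gives K itself. *)
Definition cone_face K F : Prop :=
  exists c, (forall x, K x -> dot c x <= 0) /\ F = K `&` [set x | dot c x = 0].

Definition quotient_fan (e : rel 'S_n) : set (set vec) :=
  [set F | exists s, cone_face (class_cone e s) F].

Definition maximal_cones (Fan : set (set vec)) : set (set vec) :=
  [set K | Fan K /\ forall K', Fan K' -> K `<=` K' -> K' = K].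

Definition convex_hull (k : nat) (V : 'I_k -> vec) : set vec :=
  [set x | exists w : 'I_k -> R,
     [/\ forall i, 0 <= w i, \sum_i w i = 1 & x = \sum_i w i *: V i]].

Definition polytope P : Prop :=
  exists (k : nat) (V : 'I_k -> vec), P = convex_hull V.

(* The nonempty faces of P: sets of maximizers of a linear functional on P. *)
Definition polytope_face P F : Prop :=
  F !=set0 /\
  exists c, F = [set x | P x /\ forall y, P y -> dot c y <= dot c x].

Definition vertices P : set vec := [set v | polytope_face P [set v]].

(* The (outer) normal cone of the face F of P. *)
Definition normal_cone P F : set vec :=
  [set c | forall x y, F x -> P y -> dot c y <= dot c x].

Definition normal_fan P : set (set vec) :=
  [set K | exists F, polytope_face P F /\ K = normal_cone P F].

Definition quotientope (e : rel 'S_n) P : Prop :=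
  polytope P /\ normal_fan P = quotient_fan e.

End Geometry.

(* Main.v *)
Require Import Defs.
From HB Require Import structures.
From mathcomp Require Import all_boot all_order all_fingroup all_algebra.
From mathcomp Require Import boolp classical_sets functions cardinality reals.
From mathcomp Require Import zify.

(** Congruence classes and admissible trees determine each other through linear
    extensions: the linear extensions of an admissible tree form one class
    ([extends_class]), a tree is determined by them ([extends_inj]), and every
    permutation is a linear extension of some admissible tree
    ([compatible_tree_exists]).  Classes are in turn the maximal cones of the
    quotient fan, because a point with distinct coordinates lies in the cone of a
    single permutation ([maximal_conesE]), and the maximal cones of the normal fan
    of a polytope are the normal cones of its vertices ([vertex_maximal],
    [normal_cone_generic]).

    The congruence enters through its arcs.  Exchanging two consecutive values
    [i < j] of a word stays in the class exactly when the arc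
    [(i, j, A, B)], where [A] collects the values of [ ]i, j[ ] placed before and
    [B] those placed after, is missing from the arcs of the congruence
    ([cong_swapped], [arcs_ofE]).  Missing arcs are closed under prolongation
    ([contracted_hexagon]), and in a simple congruence each of them contains a
    missing up arc or down arc ([contracted_wall]).  So the congruence amounts to
    two families of walls: [ ]b, c[ ] is a wall for a word when all its values come
    before the exchanged pair and the up arc [u(b, c)] is missing, or all come
    after and [d(b, c)] is missing.  A tree is admissible when a wall stands
    between the two parents, and between the two children, of each node, and no
    edge crosses a wall ([admissibleE]).

    In such a tree, the walk between two incomparable nodes has a first turn,
    whose node has a value between theirs and carries a wall made of values that
    are all below the turn, or all above it ([turn_down], [gap_below]).  Hence two
    consecutive values of a linear extension are joined by an edge exactly when
    their exchange leaves the class.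

    Existence is proved by inserting the values in increasing order.  The values
    placed before the new value [v] and those placed after it form walls that
    hide from [v] the values too far to the left.  The last visible value placed
    before [v] and the first visible value placed after [v] are joined by an edge
    of the tree built so far ([attach_edge]); [v] subdivides this edge, or becomes
    a leaf if one of its two ends does not exist. *)

Set Implicit Arguments.
Unset Strict Implicit.
Unset Printing Implicit Defensive.

(* [lia] restricted to the inequalities in the context; any other goal is first
   replaced by [False]. *)
Ltac ineq :=
  intros; cbv beta in *;
  lazymatch goal with
  | |- is_true (leq _ _) => idtac
  | |- is_true (andb _ _) => idtac
  | |- @eq nat _ _ => idtac
  | |- @eq bool _ _ => idtac
  | |- ~ _ => idtac
  | |- is_true (negb _) => idtac
  | |- _ => exfalso
  end;
  repeat match goal with
  | H : ?P |- _ =>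
    lazymatch type of P with
    | Prop =>
      lazymatch P with
      | is_true (leq _ _) => fail
      | is_true (andb (leq _ _) _) => fail
      | is_true (negb (@eq_op _ _ _)) => fail
      | is_true (negb (leq _ _)) => fail
      | @eq nat _ _ => fail
      | _ => clear H
      end
    end
  end; lia.

(** * The weak order through relative positions of values *)

Section Positions.
Variable n : nat.
Implicit Types (s t r m : 'S_n) (a b x y z k : 'I_n).

Definition before s : rel 'I_n := fun x y => ((s^-1)%g x < (s^-1)%g y)%N.

Lemma before_irr s : irreflexive (before s).
Proof. by move=> x; rewrite /before ltnn. Qed.

Lemma before_trans s : transitive (before s).
Proof. by move=> y x z; apply: ltn_trans. Qed.

Lemma before_total s x y : x != y -> before s x y || before s y x.
Proof. by rewrite /before -neq_ltn val_eqE (inj_eq perm_inj). Qed.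

Lemma before_or s x y : x != y -> before s x y \/ before s y x.
Proof. by move/(before_total s)/orP. Qed.

Lemma before_notC s x y : before s x y -> before s y x -> False.
Proof. by rewrite /before; lia. Qed.

Lemma beforeNC s x y : x != y -> before s y x = ~~ before s x y.
Proof.
move=> xy; case: (before_or s xy) => h; rewrite h.
  by apply/negP; apply: before_notC h.
by apply/esym/negP; apply: before_notC h.
Qed.

Lemma before_inj s t : before s =2 before t -> s = t.
Proof.
move=> h; apply: invg_inj; apply/permP => x; apply: val_inj.
have pos (u : 'S_n) y : ((u^-1)%g y : nat) = #|[set z | before u z y]|.
  have -> : [set z | before u z y]%SET = u @: [set p : 'I_n | p < (u^-1)%g y]%SET.
    apply/setP => z; rewrite inE; apply/idP/imsetP => [h'|[p]].
      by exists ((u^-1)%g z); rewrite ?inE ?permKV.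
    by rewrite inE /before => hp ->; rewrite permK.
  rewrite card_imset; last exact: perm_inj.
  have wi : injective (widen_ord (ltnW (ltn_ord ((u^-1)%g y)))).
    by move=> p q [] /val_inj.
  rewrite -[LHS]card_ord -(card_imset _ wi).
  apply: eq_card => p; rewrite inE; apply/imsetP/idP => [[q _ ->] /=|hp].
    exact: ltn_ord.
  by exists (Ordinal hp) => //; apply: val_inj.
by rewrite /= !pos; apply: eq_card => z; rewrite !inE h.
Qed.

Lemma perm_of_key (key : 'I_n -> nat) : injective key ->
  {s : 'S_n | forall x y, before s x y = (key x < key y)}.
Proof.
move=> ik; pose rk x := #|[set z | key z < key x]|.
have rkn x : rk x < n.
  rewrite -[in ltnRHS](card_ord n) -cardsT; apply: proper_card.
  apply/properP; split; first exact: finset.subsetT.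
  by exists x; rewrite ?inE // ltnn.
have rk_lt x y : key x < key y -> rk x < rk y.
  move=> h; apply: proper_card; apply/properP; split.
    by apply/fintype.subsetP => z; rewrite !inE => h'; apply: ltn_trans h.
  by exists x; rewrite !inE ?h // ltnn.
have irk : injective (fun x => Ordinal (rkn x)).
  move=> x y [e]; apply: ik; case: (ltngtP (key x) (key y)) => // /rk_lt; rewrite e ltnn //.
exists (perm irk)^-1%g => x y; rewrite /before invgK !permE /=.
case: (ltngtP (key x) (key y)) => [/rk_lt //|/rk_lt h|/ik ->]; last by rewrite ltnn.
by apply/negbTE; rewrite -leqNgt ltnW.
Qed.

Lemma inversionsE s a b : ((a, b) \in inversions s) = (b < a) && before s a b.
Proof.
apply/imsetP/andP => [[[p q]]|[ba h]].
  by rewrite inE /= => /andP[pq qp] [-> ->]; rewrite /before !permK.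
by exists ((s^-1)%g a, (s^-1)%g b); rewrite ?inE /= !permKV // ba andbT.
Qed.

Lemma weak_leP s t :
  reflect (forall a b, b < a -> before s a b -> before t a b) (weak_le s t).
Proof.
apply: (iffP fintype.subsetP) => [h a b ba sab|h [a b]].
  by have := h (a, b); rewrite !inversionsE ba sab => /(_ isT).
by rewrite !inversionsE => /andP[ba /(h _ _ ba) ->]; rewrite ba.
Qed.

Lemma weak_le_refl s : weak_le s s.
Proof. exact: fintype.subxx. Qed.

Lemma weak_le_anti s t : weak_le s t -> weak_le t s -> s = t.
Proof.
move=> /weak_leP h1 /weak_leP h2; apply: before_inj => x y.
have [->|xy] := eqVneq x y; first by rewrite !before_irr.
have yx : y != x by rewrite eq_sym.
have [lt|lt] : y < x \/ x < y by move: xy; rewrite -val_eqE /=; lia.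
  by apply/idP/idP => h; auto.
by rewrite !(beforeNC _ yx); congr negb; apply/idP/idP => h; auto.
Qed.

(** That [x] and [y] are consecutive is implicit: a value between them would make
    [before t] cyclic. *)
Definition swapped s t x y : Prop :=
  [/\ x != y, before s x y & forall a b, before t a b =
    if (a == x) && (b == y) then false
    else if (a == y) && (b == x) then true else before s a b].

Lemma swapped_xy s t x y : swapped s t x y -> before t x y = false.
Proof. by case=> xy _ ->; rewrite !eqxx. Qed.

Lemma swapped_yx s t x y : swapped s t x y -> before t y x.
Proof. by case=> xy _ ->; rewrite !eqxx eq_sym (negbTE xy). Qed.

Lemma swapped_other s t x y a b : swapped s t x y ->
  ~~ ((a == x) && (b == y)) -> ~~ ((a == y) && (b == x)) ->
  before t a b = before s a b.
Proof. by case=> _ _ -> /negbTE-> /negbTE->. Qed.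

Lemma swapped_sym s t x y : swapped s t x y -> swapped t s y x.
Proof.
move=> h; have [xy sxy e] := h; split; [by rewrite eq_sym|exact: swapped_yx h|].
move=> a b; rewrite e.
have [/andP[/eqP-> /eqP->]|_] := boolP ((a == y) && (b == x)).
  by apply/negP; apply: before_notC.
by case: andP => // -[/eqP-> /eqP->].
Qed.

Lemma swapped_le s t x y : x < y -> swapped s t x y -> weak_le s t.
Proof.
move=> xy st; apply/weak_leP => a b ba h; rewrite (swapped_other st) //.
  by apply/negP => /andP[/eqP ax /eqP by_]; subst; ineq.
apply/negP => /andP[/eqP ay /eqP bx]; subst.
by have := swapped_xy (swapped_sym st); rewrite h.
Qed.

Lemma swapped_consecutive s t x y k : swapped s t x y ->
  before s x k -> before s k y -> False.
Proof.
move=> h xk ky.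
have kx : k != x by apply: contraTneq xk => ->; rewrite before_irr.
have ky' : k != y by apply: contraTneq ky => ->; rewrite before_irr.
have txk : before t x k.
  by rewrite (swapped_other h) // ?(negbTE ky') ?(negbTE kx) ?andbF.
have tky : before t k y.
  by rewrite (swapped_other h) // ?(negbTE ky') ?(negbTE kx) ?andbF.
exact: before_notC (before_trans txk tky) (swapped_yx h).
Qed.

Lemma swapped_side s t x y k : swapped s t x y -> k != x -> k != y ->
  before s k x = before s k y.
Proof.
move=> h kx ky; have [_ sxy _] := h.
have yk : y != k by rewrite eq_sym.
have xk : x != k by rewrite eq_sym.
apply/idP/idP => hk; first exact: before_trans hk sxy.
rewrite (beforeNC _ xk); apply/negP => xk'; exact: swapped_consecutive h xk' hk.
Qed.

Lemma swap_exists s x y : before s x y ->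
  (forall k, before s x k -> ~~ before s k y) -> exists t, swapped s t x y.
Proof.
move=> sxy no; exists (s * tperm x y)%g.
have xy : x != y by apply: contraTneq sxy => ->; rewrite before_irr.
have e a b : before (s * tperm x y)%g a b = before s (tperm x y a) (tperm x y b).
  by rewrite /before !invMg !permM tpermV.
have side k : k != x -> k != y -> before s k x = before s k y.
  move=> kx ky; apply/idP/idP => hk; first exact: before_trans hk sxy.
  rewrite beforeNC 1?eq_sym //; apply/negP => xk.
  by have := no _ xk; rewrite hk.
have side' k : k != x -> k != y -> before s x k = before s y k.
  by move=> kx ky; rewrite !(beforeNC s (x := k)) // side.
split=> // a b; rewrite e.
case: tpermP => [->|->|/eqP ax /eqP ay]; case: tpermP => [->|->|/eqP bx /eqP by_];
  rewrite ?eqxx ?(negbTE xy) ?[y == x]eq_sym ?(negbTE xy) ?before_irr //=.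
- by apply/negP; apply: before_notC sxy.
- by rewrite (negbTE by_) /= side'.
- by rewrite (negbTE bx) /= -side'.
- by rewrite (negbTE ax) (negbTE ay) /= side.
- by rewrite (negbTE ax) (negbTE ay) /= -side.
- by rewrite (negbTE ax) (negbTE ay).
Qed.

End Positions.

(** * Meets in the weak order *)

Section Meets.
Variable n : nat.
Implicit Types (s t r m : 'S_n) (a b c x y z k : 'I_n).

(** The noninversions of the meet are the transitive closure of those of [s] and
    [t].  This closure is the noninversion set of a permutation because a step
    from [a] to [c] over an intermediate value [b] can be replaced by one of the
    steps from [a] to [b] and from [b] to [c]. *)
Lemma meet_exists s t : exists m, is_meet s t m.
Proof.
pose N a b := (a < b) && (before s a b || before t a b).
pose C := connect N.
have Ncut a b c : a < b -> b < c -> N a c -> N a b \/ N b c.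
  move=> ab bc /andP[_].
  have ba : b != a by rewrite -val_eqE /= gtn_eqF.
  case/orP => h.
    case: (before_or s ba) => h'; last by left; rewrite /N ab h'.
    by right; rewrite /N bc (before_trans h' h).
  case: (before_or t ba) => h'; last by left; rewrite /N ab h' orbT.
  by right; rewrite /N bc (before_trans h' h) orbT.
have Clt a b : C a b -> a != b -> a < b.
  case/connectP => p; elim: p a => [|u p IH] a /=; first by move=> _ ->; rewrite eqxx.
  case/andP=> /andP[au _] pu e _; have [<- //|ub] := eqVneq u b.
  exact: ltn_trans au (IH _ pu e ub).
have Ccut a b c : a < b -> b < c -> C a c -> C a b \/ C b c.
  move=> ab bc /connectP[p]; elim: p a ab => [|u p IH] a ab /=.
    by move=> _ e; subst a; ineq.
  case/andP=> au pu e; case: (ltngtP (u : nat) (b : nat)) => ub.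
  - case: (IH u ub pu e) => h; last by right.
    by left; apply: connect_trans (connect1 au) h.
  - case: (Ncut _ _ _ ab ub au) => h; first by left; apply: connect1.
    by right; apply: connect_trans (connect1 h) _; apply/connectP; exists p.
  - by left; rewrite -(val_inj ub); apply: connect1.
pose L a b := if a < b then C a b else (b < a) && ~~ C b a.
have Lirr a : L a a = false by rewrite /L ltnn.
have Ltot a b : a != b -> L a b = ~~ L b a.
  rewrite -val_eqE /= /L => ab; case: (ltngtP a b) ab => //= _ _.
  by rewrite negbK.
have Ltr : transitive L.
  move=> b a c; rewrite /L.
  have Ctr u v w : C u v -> C v w -> C u w := @connect_trans _ _ _ _ _.
  case: (ltngtP a b) => //= ab; case: (ltngtP b c) => //= bc; case: (ltngtP a c) => //= ac;
    try by [ineq | apply: Ctr].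
  - by move=> h /negP h'; case: (Ccut _ _ _ ac bc h).
  - by move=> h /negP h'; apply/negP => h''; apply: h'; apply: Ctr h'' h.
  - by move=> h /negP h'; move/val_inj: ac => e; subst c.
  - by move=> /negP h h'; case: (Ccut _ _ _ ab ac h').
  - by move=> /negP h h'; apply/negP => h''; apply: h; apply: Ctr h' h''.
  - by move=> /negP h h'; move/val_inj: ac => e; subst c.
  - by move=> /negP h /negP h'; apply/negP => h''; case: (Ccut _ _ _ bc ab h'').
have [m hm] : {m : 'S_n | forall x y, before m x y = L x y}.
  pose key x := #|[set z | L z x]|.
  have kl x y : L x y -> key x < key y.
    move=> h; apply: proper_card; apply/properP; split.
      by apply/fintype.subsetP => z; rewrite !inE => h'; apply: Ltr h' h.
    by exists x; rewrite !inE // Lirr.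
  have kle x y : L x y = (key x < key y).
    apply/idP/idP => [/kl //|h]; have [e|xy] := eqVneq x y.
      by rewrite e ltnn in h.
    rewrite Ltot //; apply/negP => /kl; lia.
  have ki : injective key.
    move=> x y e; apply/eqP/negPn/negP => xy.
    by have := Ltot _ _ xy; rewrite !kle e ltnn.
  have [m hm] := perm_of_key ki; exists m => x y; by rewrite hm kle.
have Nle u : (forall a b, a < b -> before u a b -> C a b) -> weak_le m u.
  move=> h; apply/weak_leP => a b ba; rewrite hm /L ltnNge (ltnW ba) /= ba /= => nC.
  have ab : b != a by rewrite -val_eqE /= ltn_eqF.
  by rewrite (beforeNC _ ab); apply: contra nC; apply: h.
exists m; split.
- by apply: Nle => a b ab h; apply: connect1; rewrite /N ab h.
- by apply: Nle => a b ab h; apply: connect1; rewrite /N ab h orbT.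
move=> r /weak_leP rs /weak_leP rt; apply/weak_leP => a b ba rab.
rewrite hm /L ltnNge (ltnW ba) /= ba /=; apply/negP => /connectP[p].
have ne : b != a by rewrite -val_eqE /= ltn_eqF.
suff key u : path N u p -> u = last u p \/ before r u (last u p).
  move=> /key h e; rewrite -e in h; case: h => h; first by rewrite h eqxx in ne.
  exact: before_notC rab h.
elim: p u => [|w p IH] u /=; first by left.
case/andP=> /andP[uw h] /IH hw; right.
have ruw : before r u w.
  have wu : w != u by rewrite -val_eqE /= gtn_eqF.
  rewrite (beforeNC _ wu); apply/negP => rwu.
  by case/orP: h; apply: before_notC; [apply: rs|apply: rt].
by case: hw => [<- //|]; apply: before_trans.
Qed.

End Meets.

(** * Contracted arcs of a lattice congruence *)

Section Words.
Variable n : nat.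
Implicit Types (s t r m : 'S_n) (a b c i j x y z k : 'I_n) (A B : {set 'I_n}).

(** Blocks of the word of an arc, in the order smaller than [i], [A], [i] and [j],
    [ ]i, j[ ] minus [A], larger than [j]; within a block the values increase. *)
Definition arc_group i j A (ci cj : nat) k : nat :=
  if k < i then 0 else if j < k then 5 else
  if k == i then ci else if k == j then cj else if k \in A then 1 else 4.

Definition arc_key i j A (ci cj : nat) k : nat := arc_group i j A ci cj k * n + k.

Lemma lex_key (g : 'I_n -> nat) a b :
  (g a * n + a < g b * n + b) = (g a < g b) || (g a == g b) && (a < b).
Proof.
have an := ltn_ord a; have bn := ltn_ord b.
case: (ltngtP (g a) (g b)) => h /=; last by rewrite h ltn_add2l.
  by have := leq_mul2r n (g a).+1 (g b); rewrite h orbT mulSn; lia.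
by have := leq_mul2r n (g b).+1 (g a); rewrite h orbT mulSn; lia.
Qed.

Lemma lex_key_inj (g : 'I_n -> nat) : injective (fun a => g a * n + a).
Proof.
move=> a b e; have := lex_key g a b; have := lex_key g b a.
rewrite e ltnn; case: (ltngtP (g a) (g b)) => //= _; case: (ltngtP a b) => // h _ _.
exact: val_inj.
Qed.

(** The permutation of the arc [(i, j, A, _)] and the permutation it covers. *)
Definition arc_upper i j A : 'S_n := sval (perm_of_key (@lex_key_inj (arc_group i j A 3 2))).
Definition arc_lower i j A : 'S_n := sval (perm_of_key (@lex_key_inj (arc_group i j A 2 3))).

Lemma before_arc_upper i j A a b : before (arc_upper i j A) a b =
  (arc_key i j A 3 2 a < arc_key i j A 3 2 b).
Proof. by rewrite /arc_upper; case: (perm_of_key _). Qed.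

Lemma before_arc_lower i j A a b : before (arc_lower i j A) a b =
  (arc_key i j A 2 3 a < arc_key i j A 2 3 b).
Proof. by rewrite /arc_lower; case: (perm_of_key _). Qed.

Lemma eq_arc_group i j A A' ci cj : (forall k, i < k < j -> (k \in A) = (k \in A')) ->
  arc_group i j A ci cj =1 arc_group i j A' ci cj.
Proof.
move=> h k; rewrite /arc_group; case: (ltnP k i) => // ik; case: (ltnP j k) => // kj.
case: eqVneq => // ki; case: eqVneq => // kj'; rewrite h //.
by move: ki kj'; rewrite -!val_eqE /=; ineq.
Qed.

Lemma eq_arc_upper i j A A' : (forall k, i < k < j -> (k \in A) = (k \in A')) ->
  arc_upper i j A = arc_upper i j A'.
Proof.
move=> h; apply: before_inj => a b; rewrite !before_arc_upper /arc_key.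
by rewrite !(eq_arc_group _ _ h).
Qed.

Lemma eq_arc_lower i j A A' : (forall k, i < k < j -> (k \in A) = (k \in A')) ->
  arc_lower i j A = arc_lower i j A'.
Proof.
move=> h; apply: before_inj => a b; rewrite !before_arc_lower /arc_key.
by rewrite !(eq_arc_group _ _ h).
Qed.

Lemma arc_swapped i j A : i < j -> swapped (arc_lower i j A) (arc_upper i j A) i j.
Proof.
move=> ij; have ne : i != j by rewrite -val_eqE /= ltn_eqF.
have gi ci cj : arc_group i j A ci cj i = ci.
  by rewrite /arc_group ltnn eqxx [j < i]ltnNge (ltnW ij).
have gj ci cj : arc_group i j A ci cj j = cj.
  by rewrite /arc_group ltnn eqxx [j < i]ltnNge (ltnW ij) eq_sym (negbTE ne).
split=> //.
  by rewrite before_arc_lower /arc_key lex_key gi gj.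
move=> a b; rewrite before_arc_lower before_arc_upper /arc_key !lex_key.
have spec (k : 'I_n) : [\/ k = i, k = j | [/\ k != i, k != j,
    arc_group i j A 3 2 k = arc_group i j A 2 3 k &
    arc_group i j A 2 3 k <= 1 \/ 4 <= arc_group i j A 2 3 k]].
  have [->|ki] := eqVneq k i; first by constructor 1.
  have [->|kj] := eqVneq k j; first by constructor 2.
  constructor 3; split=> //; rewrite /arc_group (negbTE ki) (negbTE kj) //.
  by do 3?[case: ifP => _]; by [left|right].
have ne' : j != i by rewrite eq_sym.
case: (spec a) => [->|->|[ai aj ea ha]]; case: (spec b) => [->|->|[bi bj eb hb]];
  rewrite ?gi ?gj ?ea ?eb ?eqxx ?(negbTE ne) ?(negbTE ne') ?(negbTE ai)
    ?(negbTE aj) ?(negbTE bi) ?(negbTE bj) ?andbF ?ltnn //=;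
  by [case: ha; ineq | case: hb; ineq].
Qed.

(** All inversions of the permutation of an arc lie in [[i, j]] and are forced by
    the places of [j], [i], [A] and the rest of [ ]i, j[ ]. *)
Lemma arc_upper_le i j A t : i < j -> before t j i ->
  (forall k, i < k < j -> if k \in A then before t k j && before t k i
                          else before t j k && before t i k) ->
  weak_le (arc_upper i j A) t.
Proof.
move=> ij tji h; apply/weak_leP => a b ba.
rewrite before_arc_upper /arc_key lex_key [a < b]ltnNge (ltnW ba) andbF orbF /arc_group.
have ne : i != j by rewrite -val_eqE /= ltn_eqF.
case: (ltnP a i) => [ai|ia]; first by rewrite (ltn_trans ba ai).
case: (ltnP j a) => [ja|aj].
  by case: ifP => // _; case: ifP => // _; case: ifP => // _; case: ifP => // _; case: ifP.
have {ia} ia : a != i -> i < a by rewrite -val_eqE /=; ineq.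
case: (ltnP b i) => [//|ib]; case: (ltnP j b) => [jb|jb]; first by ineq.
have {ia} ia : i < a by ineq.
have -> : (a == i) = false by rewrite -val_eqE /= gtn_eqF.
have -> : (b == j) = false by rewrite -val_eqE /=; ineq.
have [bi|bi] := eqVneq b i; have [aj'|aj'] := eqVneq a j.
- by rewrite bi aj'.
- have iaj : i < a < j by move: aj'; rewrite -val_eqE /=; ineq.
  by have := h _ iaj; case: ifP => // _ /andP[_]; rewrite bi.
- have ibj : i < b < j by move: bi; rewrite -val_eqE /=; ineq.
  by have := h _ ibj; case: ifP => // _ /andP[]; rewrite aj'.
have iaj : i < a < j by move: aj'; rewrite -val_eqE /=; ineq.
have ibj : i < b < j by move: bi; rewrite -val_eqE /=; ineq.
have := h _ iaj; have := h _ ibj; case: ifP => _; case: ifP => //= _ /andP[tjb _] /andP[taj _] _.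
exact: before_trans taj tjb.
Qed.

Lemma arc_lower_le i j A s t : i < j -> swapped s t i j ->
  weak_le (arc_upper i j A) t -> weak_le (arc_lower i j A) s.
Proof.
move=> ij st /weak_leP h; have st' := arc_swapped A ij.
apply/weak_leP => a b ba hl.
have [/andP[/eqP ai /eqP bj]|n1] := boolP ((a == i) && (b == j)); first by subst; ineq.
have [/andP[/eqP aj /eqP bi]|n2] := boolP ((a == j) && (b == i)).
  subst; have := swapped_xy (swapped_sym st'); by rewrite hl.
rewrite -(swapped_other st) //; apply: h => //.
by rewrite (swapped_other st').
Qed.

(** The permutation of an arc is join-irreducible. *)
Lemma arc_lower_max i j A r : i < j -> weak_le r (arc_upper i j A) ->
  r != arc_upper i j A -> weak_le r (arc_lower i j A).
Proof.
move=> ij ru ne; have /weak_leP h := ru.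
have sw := arc_swapped A ij.
have [rji|nrji] := boolP (before r j i); last first.
  apply/weak_leP => a b ba rab; rewrite -(swapped_other sw); first exact: h.
    by apply/negP => /andP[/eqP ai /eqP bj]; subst; ineq.
  by apply/negP => /andP[/eqP ai /eqP bj]; subst; rewrite rab in nrji.
case/eqP: ne; apply: weak_le_anti ru _; apply: arc_upper_le => // k ikj.
have kj : k != j by rewrite -val_eqE /=; ineq.
have ki : k != i by rewrite -val_eqE /=; ineq.
have gk : arc_group i j A 3 2 k = if k \in A then 1 else 4.
  have [h1 h2] := andP ikj.
  by rewrite /arc_group (negbTE ki) (negbTE kj) [k < i]ltnNge (ltnW h1) [j < k]ltnNge (ltnW h2).
have gi : arc_group i j A 3 2 i = 3.
  by rewrite /arc_group ltnn eqxx [j < i]ltnNge (ltnW ij).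
have gj : arc_group i j A 3 2 j = 2.
  rewrite /arc_group ltnn eqxx [j < i]ltnNge (ltnW ij).
  by case: eqVneq => // e; subst; ineq.
case: ifP => kA.
  have rkj : before r k j.
    rewrite (beforeNC r (x := j)) 1?eq_sym //; apply/negP => rjk.
    have kltj : k < j by ineq.
    by have := h _ _ kltj rjk; rewrite before_arc_upper /arc_key lex_key gj gk kA.
  by rewrite rkj; apply: before_trans rkj rji.
have rik : before r i k.
  rewrite (beforeNC r) //; apply/negP => rki.
  have iltk : i < k by ineq.
  by have := h _ _ iltk rki; rewrite before_arc_upper /arc_key lex_key gi gk kA.
by rewrite rik andbT; apply: before_trans rji rik.
Qed.

End Words.

Section ArcWord.
Variable n : nat.
Implicit Types (i j a b k : 'I_n) (A B : {set 'I_n}).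

Lemma one_line_sorted (s : 'S_n) : pairwise (before s) (one_line s).
Proof.
rewrite /one_line pairwise_map; apply: (@sub_pairwise _ (relpre val ltn)).
  by move=> p q; rewrite /= /before !permK.
by rewrite -pairwise_map val_enum_ord -sorted_pairwise ?iota_ltn_sorted //; apply: ltn_trans.
Qed.

Lemma mem_one_line (s : 'S_n) : one_line s =i predT.
Proof.
move=> k; rewrite inE; apply/mapP; exists ((s^-1)%g k); last by rewrite permKV.
by rewrite mem_enum.
Qed.

Lemma filter_sorted (s : 'S_n) (P : pred 'I_n) :
  {in P &, forall a b, a < b -> before s a b} ->
  pairwise (before s) [seq k <- enum 'I_n | P k].
Proof.
move=> h; have e : pairwise (relpre val ltn) [seq k <- enum 'I_n | P k].
  rewrite pairwise_filter // -pairwise_map val_enum_ord.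
  by rewrite -sorted_pairwise ?iota_ltn_sorted //; apply: ltn_trans.
apply: (sub_in_pairwise (P := P)) e => //.
by rewrite all_filter; apply/allP => x _; apply/implyP.
Qed.

(** Both words are sorted for the order of the values in the permutation. *)
Lemma one_line_arc_upper i j A B : is_arc (i, j, A, B) ->
  one_line (arc_upper i j A) = arc_word (i, j, A, B).
Proof.
case/and3P=> ij /eqP AB dAB; set s := arc_upper i j A.
have mAB k : (k \in A) || (k \in B) = (i < k < j) by rewrite -finset.in_setU AB inE.
have ne : i != j by rewrite -val_eqE /= ltn_eqF.
have ne' : j != i by rewrite eq_sym.
pose g := arc_group i j A 3 2.
have bE a b : before s a b = (g a < g b) || (g a == g b) && (a < b).
  by rewrite before_arc_upper /arc_key lex_key.
have gi : g i = 3 by rewrite /g /arc_group ltnn eqxx [j < i]ltnNge (ltnW ij).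
have gj : g j = 2.
  by rewrite /g /arc_group ltnn eqxx [j < i]ltnNge (ltnW ij) (negbTE ne').
have g0 k : k < i -> g k = 0 by rewrite /g /arc_group => ->.
have g5 k : j < k -> g k = 5.
  by move=> jk; rewrite /g /arc_group jk ltnNge (ltnW (ltn_trans ij jk)).
have gm k : i < k < j -> g k = if k \in A then 1 else 4.
  case/andP=> ik kj; rewrite /g /arc_group ltnNge (ltnW ik) /= ltnNge (ltnW kj) /=.
  by rewrite -!val_eqE /= gtn_eqF // ltn_eqF.
have gA k : k \in A -> g k = 1.
  by move=> kA; rewrite gm ?kA // -mAB kA.
have gB k : k \in B -> g k = 4.
  move=> kB; rewrite gm -?mAB ?kB ?orbT //; case: ifP => // kA.
  by move/pred0P: dAB => /(_ k); rewrite /= kA kB.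
have enumE (C : {set 'I_n}) : enum C = [seq k <- enum 'I_n | k \in C].
  by rewrite !enumT.
have tr : transitive (before s) by apply: before_trans.
apply: (irr_sorted_eq tr (before_irr s)).
- by rewrite sorted_pairwise // one_line_sorted.
- rewrite sorted_pairwise // /arc_word !pairwise_cat /=.
  have grp (P : pred 'I_n) c : (forall k, P k -> g k = c) ->
      pairwise (before s) [seq k <- enum 'I_n | P k].
    move=> h; apply: filter_sorted => a b pa pb ab.
    by rewrite bE (h a) // (h b) // eqxx ab orbT.
  rewrite !enumE (grp _ 0 g0) (grp _ 1 gA) (grp _ 4 gB) (grp _ 5 g5) /=.
  have rel (P Q : pred 'I_n) (c d : nat) : (forall k, P k -> g k = c) ->
      (forall k, Q k -> g k = d) -> c < d -> forall a b, P a -> Q b -> before s a b.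
    by move=> hP hQ cd a b pa qb; rewrite bE (hP a) // (hQ b) // cd.
  rewrite !allrel_catr !allrel_consr !allrel_catr /=.
  rewrite !bE gi gj /=.
  have all1 (P : pred 'I_n) x c d : (forall k, P k -> g k = c) -> g x = d -> c < d ->
      all (before s ^~ x) [seq k <- enum 'I_n | P k].
    move=> hP hx cd; apply/allP => k; rewrite mem_filter => /andP[pk _].
    by rewrite bE (hP k) // hx cd.
  have all2 (P : pred 'I_n) x c d : (forall k, P k -> g k = c) -> g x = d -> d < c ->
      all (before s x) [seq k <- enum 'I_n | P k].
    move=> hP hx cd; apply/allP => k; rewrite mem_filter => /andP[pk _].
    by rewrite bE (hP k) // hx cd.
  have allr (P Q : pred 'I_n) (c d : nat) : (forall k, P k -> g k = c) ->
      (forall k, Q k -> g k = d) -> c < d ->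
      allrel (before s) [seq k <- enum 'I_n | P k] [seq k <- enum 'I_n | Q k].
    move=> hP hQ cd; apply/allrelP => a b; rewrite !mem_filter => /andP[pa _] /andP[qb _].
    exact: rel hP hQ cd a b pa qb.
  rewrite (allr _ _ 0 1 g0 gA) // (allr _ _ 0 4 g0 gB) // (allr _ _ 0 5 g0 g5) //.
  rewrite (allr _ _ 1 4 gA gB) // (allr _ _ 1 5 gA g5) // (allr _ _ 4 5 gB g5) //.
  rewrite (all1 _ j 0 2 g0) // (all1 _ i 0 3 g0) // (all1 _ j 1 2 gA) // (all1 _ i 1 3 gA) //.
  rewrite !allrel_consl !allrel0l.
  by rewrite (all2 _ j 4 2 gB) // (all2 _ j 5 2 g5) // (all2 _ i 4 3 gB) // (all2 _ i 5 3 g5).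
have flt (P : pred 'I_n) k : (k \in [seq x <- enum 'I_n | P x]) = P k.
  by rewrite mem_filter (mem_enum 'I_n) andbT.
move=> k; rewrite mem_one_line !mem_cat !flt (mem_enum A) (mem_enum B) !inE.
apply/esym.
case: (ltngtP k i) => [//|ik|/val_inj ->]; last by rewrite eqxx !orbT.
case: (ltngtP j k) => [|kj|/val_inj ->]; rewrite ?eqxx ?orbT //.
by have := mAB k; rewrite ik kj /= => /orP[] ->; rewrite ?orbT.
Qed.

Lemma one_line_inj : injective (@one_line n).
Proof.
move=> s t e; apply/permP => p.
have nthE (u : 'S_n) : nth p (one_line u) p = u p.
  by rewrite (nth_map p) ?size_enum_ord // nth_ord_enum.
by rewrite -!nthE e.
Qed.

End ArcWord.

Section SwappedKey.
Variable n : nat.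

Lemma swapped_of_key (s s' : 'S_n) (f f' : 'I_n -> nat) (u v : 'I_n) :
  (forall a b, before s a b = (f a < f b)) ->
  (forall a b, before s' a b = (f' a < f' b)) -> injective f ->
  f v = (f u).+1 -> f' u = f v -> f' v = f u ->
  (forall k, k != u -> k != v -> f' k = f k) -> swapped s s' u v.
Proof.
move=> hs hs' fi fv fu' fv' fk.
have uv : u != v by apply/eqP => uv; move: fv; rewrite uv; lia.
have vu : v != u by rewrite eq_sym.
split=> //; first by rewrite hs fv.
have ne k w : k != w -> f k != f w by rewrite (inj_eq fi).
have spec k : [\/ k = u, k = v | [/\ k != u, k != v, f' k = f k, f k != f u & f k != f v]].
  have [->|ku] := eqVneq k u; first by constructor 1.
  have [->|kv] := eqVneq k v; first by constructor 2.
  by constructor 3; split=> //; [apply: fk | apply: ne | apply: ne].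
move=> a b; rewrite hs hs'; clear hs hs' fi fk ne.
case: (spec a) => [->|->|[au av -> nau nav]]; case: (spec b) => [->|->|[bu bv -> nbu nbv]];
  rewrite ?eqxx ?(negbTE uv) ?(negbTE vu) ?(negbTE au) ?(negbTE av) ?(negbTE bu)
    ?(negbTE bv) ?andbF /= ?fu' ?fv' ?ltnn //; lia.
Qed.

End SwappedKey.

Section Congruence.
Variables (n : nat) (e : rel 'S_n).
Hypothesis he : lattice_congruence e.
Implicit Types (s t r m : 'S_n) (a b c i j x y z k : 'I_n) (A B : {set 'I_n}).

Lemma cong_refl s : e s s.
Proof. by case: he => h _ _; case: (h s s s). Qed.

Lemma cong_sym s t : e s t = e t s.
Proof.
case: he => h _ _; have tr u v : e u v -> e v u.
  by move=> uv; case: (h u v u) => _ /(_ uv) <-; apply: cong_refl.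
by apply/idP/idP; apply: tr.
Qed.

Lemma cong_trans s t r : e s t -> e t r -> e s r.
Proof. by move=> st; case: he => h _ _; case: (h s t r) => _ /(_ st) ->. Qed.

Lemma join_le s t : weak_le s t -> is_join s t t.
Proof. by move=> st; split=> //; apply: weak_le_refl. Qed.

Lemma meet_le s t : weak_le s t -> is_meet s t s.
Proof. by move=> st; split=> //; apply: weak_le_refl. Qed.

Lemma is_meetC s t m : is_meet s t m -> is_meet t s m.
Proof. by case=> h1 h2 h3; split=> // r h h'; apply: h3. Qed.

Lemma is_joinC s t m : is_join s t m -> is_join t s m.
Proof. by case=> h1 h2 h3; split=> // r h h'; apply: h3. Qed.

Lemma cong_meet s t r m m' : e s t -> is_meet s r m -> is_meet t r m' -> e m m'.
Proof. by move=> st h h'; case: he => _ H _; apply: H st (cong_refl r) h h'. Qed.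

Lemma cong_join s t r m m' : e s t -> is_join s r m -> is_join t r m' -> e m m'.
Proof. by move=> st h h'; case: he => _ _ H; apply: H st (cong_refl r) h h'. Qed.

Lemma cong_convex m r s : weak_le m r -> weak_le r s -> e m s -> e m r.
Proof.
move=> mr rs ms; apply: (cong_trans ms); rewrite cong_sym.
by apply: (cong_join (r := r) ms); [apply: join_le | apply: is_joinC; apply: join_le].
Qed.

(** The arc [(i, j, A, _)] is missing from the arcs of [e], see [arcs_ofE]. *)
Definition contracted i j A := e (arc_lower i j A) (arc_upper i j A).

(** Covers with the same arc are contracted together: [t] is the join of [s] and
    the permutation of the arc, whose meet with [s] is the cover below it. *)
Lemma cong_swapped s t i j A : i < j -> swapped s t i j ->
  (forall k, i < k < j -> (k \in A) = before s k i) -> e s t = contracted i j A.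
Proof.
move=> ij st hA; rewrite /contracted.
have sw := arc_swapped A ij.
set u := arc_upper i j A; set l := arc_lower i j A.
have ne : i != j by case: st.
have ut : weak_le u t.
  apply: arc_upper_le => //; first exact: swapped_yx st.
  move=> k ikj.
  have ki : k != i by rewrite -val_eqE /=; lia.
  have kj : k != j by rewrite -val_eqE /=; lia.
  have tk : before t k i = before t k j.
    by apply/esym/(swapped_side (swapped_sym st)).
  have tki : before t k i = (k \in A).
    by rewrite hA // (swapped_other st) // ?(negbTE ki) ?(negbTE kj) ?andbF.
  by rewrite !(beforeNC t (x := k)) // -tk tki; case: (k \in A).
have ls : weak_le l s by apply: arc_lower_le st ut.
have lu : weak_le l u := swapped_le ij sw.
have s_t : weak_le s t := swapped_le ij st.
have ujti : before u j i := swapped_yx sw.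
have Jt : is_join u s t.
  split=> // r /weak_leP ur /weak_leP sr; apply/weak_leP => a b ba h.
  have [/andP[/eqP-> /eqP->]|n2] := boolP ((a == j) && (b == i)).
    by apply: ur.
  apply: sr => //; rewrite -(swapped_other st) //.
  by apply/negP => /andP[/eqP ai /eqP bj]; subst; ineq.
have Ml : is_meet s u l.
  split=> // r /weak_leP rs ru; apply: arc_lower_max => //.
  apply/eqP => ru'; have := rs j i ij; rewrite ru' => /(_ ujti).
  by rewrite (swapped_xy (swapped_sym st)).
apply/idP/idP => h.
  exact: (cong_meet h Ml (is_meetC (meet_le ut))).
apply: (cong_join h (r := s)); last exact: Jt.
exact: join_le.
Qed.

Lemma contracted_eq i j A A' : (forall k, i < k < j -> (k \in A) = (k \in A')) ->
  contracted i j A = contracted i j A'.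
Proof. by move=> h; rewrite /contracted (eq_arc_lower h) (eq_arc_upper h). Qed.

(** Everything strictly below the permutation of an arc is below the permutation
    it covers, so, classes being convex, a class can only go down from it through
    this cover. *)
Lemma class_min_arc_upper i j A : i < j ->
  class_min e (arc_upper i j A) = ~~ contracted i j A.
Proof.
move=> ij; rewrite /contracted; set u := arc_upper i j A; set l := arc_lower i j A.
have sw : swapped l u i j := arc_swapped A ij.
apply/idP/idP => [/forallP h|h].
  apply/negP => lu; have := h l; rewrite cong_sym lu /= => /weak_leP ul.
  by have := ul _ _ ij (swapped_yx sw); rewrite (swapped_xy (swapped_sym sw)).
apply/forallP => t; apply/implyP => ut.
have [m hm] := meet_exists u t; have [mu mt _] := hm.
have em : e u m.
  apply: (cong_meet (s := u) (t := t) (r := u)); [by []| |exact: is_meetC].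
  exact/meet_le/weak_le_refl.
have [<- //|mne] := eqVneq m u.
have ml := arc_lower_max ij mu mne.
case/negP: h.
have lu : weak_le l u := swapped_le ij sw.
rewrite cong_sym in em.
apply: (cong_trans (t := m)); last by [].
by rewrite cong_sym; apply: cong_convex em.
Qed.

Lemma arcs_ofE i j A B : is_arc (i, j, A, B) ->
  ((i, j, A, B) \in arcs_of e) = ~~ contracted i j A.
Proof.
move=> arc; have ij : i < j by case/and3P: arc.
rewrite inE arc andTb -class_min_arc_upper //.
apply/existsP/idP => [[s /andP[/eqP sw hs]]|h].
  have -> : arc_upper i j A = s; last by [].
  by apply: one_line_inj; rewrite sw (one_line_arc_upper arc).
by exists (arc_upper i j A); rewrite h andbT (one_line_arc_upper arc).
Qed.

(** Key of a word where [x], [y], [z] come after [A] and before the other values,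
    at the places [cx], [cy], [cz] among [0], [1], [2]: the six vertices of a
    hexagon of the weak order. *)
Definition hex_key x y z A (cx cy cz : nat) k : nat :=
  if k == x then n + cx else if k == y then n + cy else if k == z then n + cz
  else if k \in A then k : nat else 3 + n + k.

Section Hexagon.
Variables (x y z : 'I_n) (A : {set 'I_n}).
Hypotheses (xy : x < y) (yz : y < z).

Let nexy : (x == y) = false. Proof. by rewrite -val_eqE /= ltn_eqF. Qed.
Let neyz : (y == z) = false. Proof. by rewrite -val_eqE /= ltn_eqF. Qed.
Let nexz : (x == z) = false.
Proof. by rewrite -val_eqE /= ltn_eqF // (ltn_trans xy). Qed.
Let neyx : (y == x) = false. Proof. by rewrite eq_sym. Qed.
Let nezy : (z == y) = false. Proof. by rewrite eq_sym. Qed.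
Let nezx : (z == x) = false. Proof. by rewrite eq_sym. Qed.

Inductive hex_spec (k : 'I_n) : Prop :=
| HexX of k = x | HexY of k = y | HexZ of k = z
| HexO of k != x & k != y & k != z.

Lemma hexP k : hex_spec k.
Proof.
case: (eqVneq k x) => [|kx]; first by constructor 1.
case: (eqVneq k y) => [|ky]; first by constructor 2.
by case: (eqVneq k z) => [|kz]; [constructor 3|constructor 4].
Qed.

Notation key cx cy cz := (hex_key x y z A cx cy cz).

Lemma hex_x cx cy cz : key cx cy cz x = n + cx.
Proof. by rewrite /hex_key eqxx. Qed.
Lemma hex_y cx cy cz : key cx cy cz y = n + cy.
Proof. by rewrite /hex_key neyx eqxx. Qed.
Lemma hex_z cx cy cz : key cx cy cz z = n + cz.
Proof. by rewrite /hex_key nezx nezy eqxx. Qed.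
Lemma hex_o cx cy cz k : k != x -> k != y -> k != z ->
  key cx cy cz k = if k \in A then k : nat else 3 + n + k.
Proof. by rewrite /hex_key => /negbTE-> /negbTE-> /negbTE->. Qed.

Lemma hex_other_range k : let v := if k \in A then k : nat else 3 + n + k in
  v < n \/ n + 3 <= v.
Proof.
case: ifP => _ /=; first by left; apply: ltn_ord.
by right; rewrite addnC -addnA leq_add2l leq_addr.
Qed.

Definition good_corner (cx cy cz : nat) :=
  [&& cx < 3, cy < 3, cz < 3, cx != cy, cy != cz & cx != cz].

Lemma hex_inj cx cy cz : good_corner cx cy cz -> injective (key cx cy cz).
Proof.
case/and5P=> c1 c2 c3 c4 /andP[c5 c6] a b.
case: (hexP a) => [->|->|->|a1 a2 a3]; case: (hexP b) => [->|->|->|b1 b2 b3];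
  rewrite ?hex_x ?hex_y ?hex_z ?(hex_o _ _ _ a1 a2 a3) ?(hex_o _ _ _ b1 b2 b3) //;
  try (by move=> h; exfalso; move/addnI: h; apply/eqP; rewrite // eq_sym);
  try (by move=> h; case: (hex_other_range a); move: h; case: ifP => _; ineq);
  try (by move=> h; case: (hex_other_range b); move: h; case: ifP => _; ineq).
have := ltn_ord a; have := ltn_ord b.
by do 2!case: ifP => _; move=> an bn h; apply: val_inj => /=; ineq.
Qed.

Definition corner s cx cy cz :=
  good_corner cx cy cz /\
  forall a b, before s a b = (key cx cy cz a < key cx cy cz b).

Lemma corner_le s s' cx cy cz dx dy dz :
  corner s cx cy cz -> corner s' dx dy dz ->
  (cy < cx -> dy < dx) -> (cz < cx -> dz < dx) -> (cz < cy -> dz < dy) ->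
  weak_le s s'.
Proof.
case=> g hs [g' hs'] h1 h2 h3; apply/weak_leP => a b ba; rewrite hs hs'.
move: g g' => /and5P[c1 c2 c3 c4 /andP[c5 c6]] /and5P[d1 d2 d3 d4 /andP[d5 d6]].
clear hs hs' c4 c5 c6 d4 d5 d6.
case: (hexP a) => [ea|ea|ea|a1 a2 a3]; case: (hexP b) => [eb|eb|eb|b1 b2 b3];
  rewrite ?ea ?eb ?hex_x ?hex_y ?hex_z ?(hex_o _ _ _ a1 a2 a3) ?(hex_o _ _ _ b1 b2 b3)
    ?ltn_add2l ?ltnn //;
  try (by subst; ineq);
  try (by case: (hex_other_range a); case: ifP => _; ineq);
  by case: (hex_other_range b); case: ifP => _; ineq.
Qed.

Lemma corner_other s s' cx cy cz dx dy dz a b :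
  corner s cx cy cz -> corner s' dx dy dz ->
  (a != x /\ a != y /\ a != z) \/ (b != x /\ b != y /\ b != z) ->
  before s a b = before s' a b.
Proof.
case=> g hs [g' hs'] ab; rewrite hs hs'.
move: g g' => /and5P[c1 c2 c3 _ _] /and5P[d1 d2 d3 _ _].
clear hs hs'; case: (hexP a) ab => [ea|ea|ea|a1 a2 a3]; case: (hexP b) => [eb|eb|eb|b1 b2 b3];
  rewrite ?ea ?eb ?hex_x ?hex_y ?hex_z ?(hex_o _ _ _ a1 a2 a3) ?(hex_o _ _ _ b1 b2 b3)
    ?eqxx; move=> ab;
  try (by exfalso; case: ab => -[? []]);
  try (by case: (hex_other_range a); case: ifP => _; ineq);
  by case: (hex_other_range b); case: ifP => _; ineq.
Qed.

Lemma corner_swapped s s' cx cy cz dx dy dz u v :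
  corner s cx cy cz -> corner s' dx dy dz ->
  key cx cy cz v = (key cx cy cz u).+1 -> key dx dy dz u = key cx cy cz v ->
  key dx dy dz v = key cx cy cz u ->
  (forall k, k != u -> k != v -> key dx dy dz k = key cx cy cz k) ->
  swapped s s' u v.
Proof.
case=> g hs [_ hs']; apply: swapped_of_key hs hs' _; exact: hex_inj.
Qed.

Lemma corner_exists cx cy cz : good_corner cx cy cz -> exists s, corner s cx cy cz.
Proof. by move=> g; have [s hs] := perm_of_key (hex_inj g); exists s. Qed.

(** The inversion [(z, x)] follows from [(z, y)] and [(y, x)]. *)
Lemma hex_join s t u :
  corner s 1 0 2 -> corner t 0 2 1 -> corner u 2 1 0 -> is_join s t u.
Proof.
move=> hs ht hu; split; [exact: corner_le hs hu _ _ _|exact: corner_le ht hu _ _ _|].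
move=> r /weak_leP sr /weak_leP tr; apply/weak_leP => a b ba uab.
have ryx : before r y x by apply: sr => //; case: hs => _ ->; rewrite hex_x hex_y ltn_add2l.
have rzy : before r z y by apply: tr => //; case: ht => _ ->; rewrite hex_z hex_y ltn_add2l.
case: (hexP a) => [ea|ea|ea|a1 a2 a3]; last first.
  by apply: sr => //; rewrite (corner_other hs hu) //; left.
all: case: (hexP b) => [eb|eb|eb|b1 b2 b3]; first [ by subst; ineq | by subst |
  by apply: sr => //; rewrite (corner_other hs hu) //; right | idtac].
by subst; apply: before_trans rzy ryx.
Qed.

(** Without [(z, y)] and [(y, x)] there is no inversion [(z, x)]. *)
Lemma hex_meet s t u :
  corner s 1 2 0 -> corner t 2 0 1 -> corner u 0 1 2 -> is_meet s t u.
Proof.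
move=> hs ht hu; split; [exact: corner_le hu hs _ _ _|exact: corner_le hu ht _ _ _|].
move=> r /weak_leP rs /weak_leP rt; apply/weak_leP => a b ba rab.
have ryx : ~ before r y x.
  by move/(rs _ _ xy); case: hs => _ ->; rewrite hex_x hex_y ltn_add2l.
have rzy : ~ before r z y.
  by move/(rt _ _ yz); case: ht => _ ->; rewrite hex_z hex_y ltn_add2l.
case: (hexP a) => [ea|ea|ea|a1 a2 a3]; last first.
  by rewrite -(corner_other hs hu); [apply: rs | left].
all: case: (hexP b) => [eb|eb|eb|b1 b2 b3]; first [ by subst; ineq | by subst |
  by rewrite -(corner_other hs hu); [apply: rs | right] | idtac].
subst; exfalso; case: (before_or r (negbT nezy)) => // h.
by apply: ryx; apply: before_trans h rab.
Qed.

Lemma corner_side s cx cy cz k : corner s cx cy cz -> k != x -> k != y -> k != z ->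
  [/\ before s k x = (k \in A), before s k y = (k \in A) & before s k z = (k \in A)].
Proof.
case=> /and5P[c1 c2 c3 _ _] hs kx ky kz.
rewrite !hs hex_x hex_y hex_z hex_o //; have := ltn_ord k.
by case: ifP => _ kn; split; ineq.
Qed.

(** Contractions spread along a hexagon: joining, or meeting, the two ends of a
    contracted edge with the vertex beyond its upper, or lower, end contracts one
    of the two middle edges, whose arc prolongs the first one. *)
Lemma contracted_hexagon :
  contracted x y A || contracted y z A -> contracted x z A.
Proof.
have [p hp] : exists s, corner s 0 1 2 by apply: corner_exists.
have [q hq] : exists s, corner s 1 0 2 by apply: corner_exists.
have [r hr] : exists s, corner s 0 2 1 by apply: corner_exists.
have [s hs] : exists s, corner s 1 2 0 by apply: corner_exists.
have [t ht] : exists s, corner s 2 0 1 by apply: corner_exists.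
have [u hu] : exists s, corner s 2 1 0 by apply: corner_exists.
have le := corner_le.
have same cx cy cz dx dy dz v w : forall k, k != v -> k != w ->
    (v == x) || (w == x) || (cx == dx) -> (v == y) || (w == y) || (cy == dy) ->
    (v == z) || (w == z) || (cz == dz) ->
    key dx dy dz k = key cx cy cz k.
  move=> k kv kw hx hy hz; case: (hexP k) => [e1|e1|e1|k1 k2 k3]; last by rewrite !hex_o.
  - subst k; rewrite !hex_x; move: hx; rewrite ![_ == x]eq_sym (negbTE kv) (negbTE kw) /=.
    by move/eqP->.
  - subst k; rewrite !hex_y; move: hy; rewrite ![_ == y]eq_sym (negbTE kv) (negbTE kw) /=.
    by move/eqP->.
  - subst k; rewrite !hex_z; move: hz; rewrite ![_ == z]eq_sym (negbTE kv) (negbTE kw) /=.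
    by move/eqP->.
have pq : swapped p q x y.
  apply: (corner_swapped hp hq); rewrite ?hex_x ?hex_y ?hex_z; try ineq.
  by move=> k kx ky; apply: same kx ky _ _ _; rewrite ?eqxx ?orbT.
have pr : swapped p r y z.
  apply: (corner_swapped hp hr); rewrite ?hex_x ?hex_y ?hex_z; try ineq.
  by move=> k kx ky; apply: same kx ky _ _ _; rewrite ?eqxx ?orbT.
have qt : swapped q t x z.
  apply: (corner_swapped hq ht); rewrite ?hex_x ?hex_y ?hex_z; try ineq.
  by move=> k kx ky; apply: same kx ky _ _ _; rewrite ?eqxx ?orbT.
have rs : swapped r s x z.
  apply: (corner_swapped hr hs); rewrite ?hex_x ?hex_y ?hex_z; try ineq.
  by move=> k kx ky; apply: same kx ky _ _ _; rewrite ?eqxx ?orbT.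
have su : swapped s u x y.
  apply: (corner_swapped hs hu); rewrite ?hex_x ?hex_y ?hex_z; try ineq.
  by move=> k kx ky; apply: same kx ky _ _ _; rewrite ?eqxx ?orbT.
have tu : swapped t u y z.
  apply: (corner_swapped ht hu); rewrite ?hex_x ?hex_y ?hex_z; try ineq.
  by move=> k kx ky; apply: same kx ky _ _ _; rewrite ?eqxx ?orbT.
have xz : x < z by apply: ltn_trans yz.
have ltne (a b : 'I_n) : a < b -> (a != b) * (b != a).
  by move=> ab; rewrite -!val_eqE /= ltn_eqF // gtn_eqF.
have inxy k : x < k < y -> [/\ k != x, k != y & k != z].
  case/andP=> xk ky; have kz := ltn_trans ky yz.
  by rewrite (ltne _ _ xk) (ltne _ _ ky) (ltne _ _ kz).
have inyz k : y < k < z -> [/\ k != x, k != y & k != z].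
  case/andP=> yk kz; have xk := ltn_trans xy yk.
  by rewrite (ltne _ _ xk) (ltne _ _ yk) (ltne _ _ kz).
have epq : e p q = contracted x y A.
  by apply: cong_swapped => // k /inxy[k1 k2 k3]; case: (corner_side hp k1 k2 k3).
have esu : e s u = contracted x y A.
  by apply: cong_swapped => // k /inxy[k1 k2 k3]; case: (corner_side hs k1 k2 k3).
have epr : e p r = contracted y z A.
  by apply: cong_swapped => // k /inyz[k1 k2 k3]; case: (corner_side hp k1 k2 k3).
have etu : e t u = contracted y z A.
  by apply: cong_swapped => // k /inyz[k1 k2 k3]; case: (corner_side ht k1 k2 k3).
have inxz k : x < k < z -> k = y \/ [/\ k != x, k != y & k != z].
  case/andP=> xk kz; rewrite (ltne _ _ xk) (ltne _ _ kz).
  by have [->|ky] := eqVneq k y; [left|right].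
have [yA|yA] := boolP (y \in A).
  have eqt : e q t = contracted x z A.
    apply: cong_swapped => // k /inxz[->|[k1 k2 k3]]; last by case: (corner_side hq k1 k2 k3).
    by rewrite yA; case: hq => _ ->; rewrite hex_x hex_y ltn_add2l.
  rewrite -eqt -esu -epr => /orP[h|h].
    have ept : e p t.
      apply: (cong_meet h (r := t)); first exact: hex_meet.
      by apply/is_meetC/meet_le; apply: le ht hu _ _ _.
    apply: (cong_trans _ ept); rewrite cong_sym.
    by apply: (cong_convex _ _ ept); [apply: le hp hq _ _ _ | apply: le hq ht _ _ _].
  have equ : e q u.
    apply: (cong_join h (r := q)); first by apply: join_le; apply: le hp hq _ _ _.
    by apply: is_joinC; apply: hex_join.
  by apply: (cong_convex _ _ equ); [apply: le hq ht _ _ _ | apply: le ht hu _ _ _].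
have ers : e r s = contracted x z A.
  apply: cong_swapped => // k /inxz[->|[k1 k2 k3]]; last by case: (corner_side hr k1 k2 k3).
  by rewrite (negbTE yA); case: hr => _ ->; rewrite hex_x hex_y ltn_add2l.
rewrite -ers -epq -etu => /orP[h|h].
  have eru : e r u.
    apply: (cong_join h (r := r)); first by apply: join_le; apply: le hp hr _ _ _.
    exact: hex_join.
  by apply: (cong_convex _ _ eru); [apply: le hr hs _ _ _ | apply: le hs hu _ _ _].
have eps : e p s.
  apply: (cong_meet h (r := s)); first by apply: is_meetC; apply: hex_meet.
  by apply/is_meetC/meet_le; apply: le hs hu _ _ _.
apply: (cong_trans _ eps); rewrite cong_sym.
by apply: (cong_convex _ _ eps); [apply: le hp hr _ _ _ | apply: le hr hs _ _ _].
Qed.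

End Hexagon.

Lemma contracted_mono i j i' j' A : i' <= i -> i < j -> j <= j' ->
  contracted i j A -> contracted i' j' A.
Proof.
move=> ii ij jj h.
have h1 : contracted i j' A.
  move: jj; rewrite leq_eqVlt => /orP[/eqP/val_inj <- //|jj].
  by apply: (contracted_hexagon ij jj); rewrite h.
move: ii; rewrite leq_eqVlt => /orP[/eqP/val_inj -> //|ii].
by apply: (contracted_hexagon ii (leq_trans ij jj)); rewrite h1 orbT.
Qed.

Definition up_kept (l r : 'I_n) : bool := up_arc l r \in arcs_of e.
Definition down_kept (l r : 'I_n) : bool := down_arc l r \in arcs_of e.

Lemma up_keptE (l r : 'I_n) : l < r -> up_kept l r = ~~ contracted l r [set: 'I_n]%SET.
Proof.
move=> lr; rewrite /up_kept /up_arc arcs_ofE; last first.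
  by rewrite /is_arc lr finset.setU0 eqxx -setI_eq0 finset.setI0 eqxx.
by congr negb; apply: contracted_eq => k lkr; rewrite !inE.
Qed.

Lemma down_keptE (l r : 'I_n) : l < r -> down_kept l r = ~~ contracted l r finset.set0.
Proof.
move=> lr; rewrite /down_kept /down_arc arcs_ofE //.
by rewrite /is_arc lr finset.set0U eqxx -setI_eq0 finset.set0I eqxx.
Qed.

Lemma up_kept_mono (l r l' r' : 'I_n) : l' <= l -> l < r -> r <= r' ->
  up_kept l' r' -> up_kept l r.
Proof.
move=> ll lr rr; rewrite !up_keptE //; last by apply: leq_ltn_trans ll (leq_trans lr rr).
by apply: contra; apply: contracted_mono.
Qed.

Lemma down_kept_mono (l r l' r' : 'I_n) : l' <= l -> l < r -> r <= r' ->
  down_kept l' r' -> down_kept l r.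
Proof.
move=> ll lr rr; rewrite !down_keptE //; last by apply: leq_ltn_trans ll (leq_trans lr rr).
by apply: contra; apply: contracted_mono.
Qed.

Lemma wall_contracts i j A b c : i <= b -> b < c -> c <= j ->
  ((forall k, b < k < c -> k \in A) /\ ~~ up_kept b c) \/
  ((forall k, b < k < c -> k \notin A) /\ ~~ down_kept b c) -> contracted i j A.
Proof.
move=> ib bc cj h; apply: (contracted_mono ib bc cj).
case: h => -[h]; rewrite ?up_keptE ?down_keptE // negbK => hc.
  by rewrite (@contracted_eq _ _ _ [set: 'I_n]) // => k /h ->; rewrite inE.
by rewrite (@contracted_eq _ _ _ finset.set0) // => k /h /negbTE ->; rewrite inE.
Qed.

(** A minimal contracted subarc is an up arc or a down arc by simplicity. *)
Lemma contracted_wall (hs : simple_congruence e) i j A : i < j ->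
  contracted i j A -> exists b c, [/\ i <= b, b < c, c <= j &
  ((forall k, b < k < c -> k \in A) /\ ~~ up_kept b c) \/
  ((forall k, b < k < c -> k \notin A) /\ ~~ down_kept b c)].
Proof.
move=> ij cij.
pose a0 : quad n := (i, j, A :&: between i j, between i j :\: A)%SET.
have arc0 : is_arc a0.
  apply/and3P; split=> //.
    by rewrite finset.setIC finset.setID eqxx.
  rewrite -setI_eq0; apply/eqP/setP => k; rewrite !inE.
  by case: (k \in A); rewrite ?andbF.
have nk0 : a0 \notin arcs_of e.
  rewrite arcs_ofE // negbK (@contracted_eq _ _ _ A) // => k ikj.
  by rewrite !inE ikj andbT.
pose P (a : quad n) := [&& is_arc a, a \notin arcs_of e & subarc a a0].
pose len (a : quad n) := let: (i, j, _, _) := a in (j - i)%N.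
have P0 : P a0 by rewrite /P arc0 nk0 /= !leqnn ij !fintype.subxx.
case: (arg_minnP len P0) => -[[[b c] A'] B'] /and3P[arc nk sub] min.
case: (hs _ arc nk) => [a' arc' nk' sub'|l [r hlr]].
  have {}sub' : subarc a' (b, c, A', B') by [].
  have Pa' : P a'.
    rewrite /P arc' nk' /=; move: a' sub' {arc' nk'} => [[[b' c'] A''] B''] /and5P[h1 h2 h3 h4 h5].
    move: sub => /and5P[g1 g2 g3 g4 g5]; apply/and5P; split=> //.
    - exact: leq_trans g1 h1.
    - exact: leq_trans h3 g3.
    - exact: fintype.subset_trans h4 g4.
    - exact: fintype.subset_trans h5 g5.
  have := min _ Pa'; move: a' arc' sub' {nk' Pa' min} => [[[b' c'] A''] B''].
  move=> /and3P[bc' /eqP AB' _] /and5P[h1 h2 h3 h4 h5] /= hlen.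
  move: arc => /and3P[bc /eqP AB dAB].
  have eb : b' = b by apply: val_inj => /=; ineq.
  have ec : c' = c by apply: val_inj => /=; ineq.
  subst b' c'; rewrite -AB' in AB.
  have key (X Y X' Y' : {set 'I_n}) : X \subset X' -> Y \subset Y' ->
      [disjoint X' & Y'] -> X' :|: Y' = X :|: Y -> X = X'.
    move=> XX YY d h; apply/eqP; rewrite finset.eqEsubset XX; apply/fintype.subsetP => k kX.
    have : k \in X :|: Y by rewrite -h inE kX.
    rewrite inE => /orP[//|/(fintype.subsetP YY) kY].
    by move/pred0P: d => /(_ k); rewrite /= kX kY.
  congr (_, _, _, _); first exact: key h4 h5 dAB AB.
  by apply: (key _ A'' _ A') => //; [rewrite disjoint_sym | rewrite finset.setUC AB finset.setUC].
exists b, c; move: sub => /and5P[g1 g2 g3 g4 g5]; split=> //.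
case: hlr => h; [left|right]; move: h g4 g5 nk; rewrite /up_arc /down_arc.
  move=> [-> -> -> ->] g4 _ nk; split=> // k lkr.
  by have := fintype.subsetP g4 k; rewrite !inE lkr => /(_ isT)/andP[].
move=> [-> -> -> ->] _ g5 nk; split=> // k lkr.
by have := fintype.subsetP g5 k; rewrite !inE lkr => /(_ isT)/andP[].
Qed.

(** In a word where [x] and [y] are consecutive, the arc of this pair contains a
    missing up arc or down arc, [U] and [D] being the kept ones. *)
Definition crosses (U D : rel 'I_n) s x y : Prop :=
  exists b c, [/\ minn x y <= b, b < c, c <= maxn x y &
  (forall k, b < k < c -> before s k x /\ before s k y) /\ ~~ U b c \/
  (forall k, b < k < c -> before s x k /\ before s y k) /\ ~~ D b c].

Lemma crosses_swapped U D s t x y :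
  swapped s t x y -> crosses U D s x y -> crosses U D t y x.
Proof.
move=> sw [b [c [h1 h2 h3 h4]]]; exists b, c; rewrite minnC maxnC; split=> //.
have o k : b < k < c -> (before t k x = before s k x) * (before t k y = before s k y)
    * (before t x k = before s x k) * (before t y k = before s y k).
  move=> bkc.
  have kx : k != x.
    apply/eqP => e1; subst k; case: h4 => -[h4 _].
      by case: (h4 x bkc); rewrite before_irr.
    by case: (h4 x bkc); rewrite before_irr.
  have ky : k != y.
    apply/eqP => e1; subst k; case: h4 => -[h4 _].
      by case: (h4 y bkc); rewrite before_irr.
    by case: (h4 y bkc); rewrite before_irr.
  by rewrite !(swapped_other sw) // ?(negbTE kx) ?(negbTE ky) ?andbF.
by case: h4 => -[h4 h5]; [left|right]; split=> // k bkc; have [] := h4 _ bkc; rewrite !o.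
Qed.

Lemma cong_crosses (hs : simple_congruence e) s t x y : swapped s t x y ->
  e s t <-> crosses up_kept down_kept s x y.
Proof.
have main s1 t1 x1 y1 : x1 < y1 -> swapped s1 t1 x1 y1 ->
    e s1 t1 <-> crosses up_kept down_kept s1 x1 y1.
  move=> xy sw; pose A := [set k | before s1 k x1]%SET.
  have mn : minn x1 y1 = x1 by apply/minn_idPl/ltnW.
  have mx : maxn x1 y1 = y1 by apply/maxn_idPr/ltnW.
  have ecA : e s1 t1 = contracted x1 y1 A.
    by apply: cong_swapped => // k _; rewrite inE.
  have side k : x1 < k < y1 -> before s1 k x1 = before s1 k y1.
    by move=> h; apply: (swapped_side sw); rewrite -val_eqE /=; ineq.
  have sideC k : x1 < k < y1 -> before s1 x1 k = ~~ before s1 k x1 /\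
      before s1 y1 k = ~~ before s1 k x1.
    move=> h; have kx : k != x1 by rewrite -val_eqE /=; ineq.
    have ky : k != y1 by rewrite -val_eqE /=; ineq.
    by rewrite {2}side // (beforeNC s1 kx) (beforeNC s1 ky).
  rewrite ecA; split.
    move=> /(contracted_wall hs xy)[b [c [h1 h2 h3 h4]]]; exists b, c.
    rewrite mn mx; split=> //; case: h4 => -[h4 h5]; [left|right]; split=> // k bkc.
      by have := h4 _ bkc; rewrite inE -side ?h4 //; ineq.
    have [|-> ->] := sideC k; first by ineq.
    by have := h4 _ bkc; rewrite inE.
  case=> b [c []]; rewrite mn mx => h1 h2 h3 h4; apply: (wall_contracts h1 h2 h3).
  case: h4 => -[h4 h5]; [left|right]; split=> // k bkc; rewrite inE.
    by case: (h4 _ bkc).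
  by apply/negP; apply: before_notC; case: (h4 _ bkc).
move=> sw; have [xy|yx] : x < y \/ y < x.
- by case: sw; rewrite -val_eqE /=; lia.
- exact: main.
have sw' := swapped_sym sw; rewrite cong_sym (main _ _ _ _ yx sw').
by split; apply: crosses_swapped.
Qed.

End Congruence.
(** * Directed trees: components, comparability, turns *)

Definition opp n (T : {set 'I_n * 'I_n}) : {set 'I_n * 'I_n} :=
  [set xy | (xy.2, xy.1) \in T]%SET.

Definition below n (T : {set 'I_n * 'I_n}) : rel 'I_n := connect (edge T).

Definition avoiding n (T : {set 'I_n * 'I_n}) (m : 'I_n) : rel 'I_n :=
  fun x y => [&& x != m, y != m & adjacent T x y].

Definition antisym n (T : {set 'I_n * 'I_n}) : Prop :=
  forall x y, edge T x y -> ~~ edge T y x.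

Definition acyclic n (T : {set 'I_n * 'I_n}) : Prop :=
  antisym T /\
  forall m k k', adjacent T m k -> adjacent T m k' ->
    k' \in component T m k -> k' = k.

Section Trees.
Variable n : nat.
Implicit Types (T : {set 'I_n * 'I_n}) (x y z m k w p q : 'I_n).

Lemma edge_opp T x y : edge (opp T) x y = edge T y x.
Proof. by rewrite /edge /opp inE. Qed.

Lemma oppK T : opp (opp T) = T.
Proof. by apply/setP => -[x y]; rewrite !inE. Qed.

Lemma adjacent_opp T x y : adjacent (opp T) x y = adjacent T x y.
Proof. by rewrite /adjacent !edge_opp orbC. Qed.

Lemma adjacentC T x y : adjacent T x y = adjacent T y x.
Proof. by rewrite /adjacent orbC. Qed.

Lemma component_opp T m k : component (opp T) m k = component T m k.
Proof.
apply/setP => x; rewrite !inE; apply: eq_connect => a b.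
by rewrite adjacent_opp.
Qed.

Lemma below_opp T x y : below (opp T) x y = below T y x.
Proof.
rewrite /below connect_rev; apply: eq_connect => a b /=.
exact: edge_opp.
Qed.

Lemma edge_adj T x y : edge T x y -> adjacent T x y.
Proof. by rewrite /adjacent => ->. Qed.

Lemma edge_adjC T x y : edge T x y -> adjacent T y x.
Proof. by rewrite /adjacent => ->; rewrite orbT. Qed.

Lemma antisym_opp T : antisym T -> antisym (opp T).
Proof. by move=> h x y; rewrite !edge_opp; apply: h. Qed.

Lemma acyclic_opp T : acyclic T -> acyclic (opp T).
Proof.
move=> [h1 h2]; split; first exact: antisym_opp.
by move=> m k k'; rewrite !adjacent_opp component_opp; apply: h2.
Qed.

Lemma below_refl T x : below T x x.
Proof. exact: connect0. Qed.

Lemma edge_below T x y : edge T x y -> below T x y.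
Proof. exact: connect1. Qed.

Lemma below_trans T y x z : below T x y -> below T y z -> below T x z.
Proof. exact: connect_trans. Qed.

Lemma avoidingC T m x y : avoiding T m x y = avoiding T m y x.
Proof. by rewrite /avoiding adjacentC; case: (x != m); case: (y != m). Qed.

Lemma avoid_sym T m : connect_sym (avoiding T m).
Proof. by apply: sym_connect_sym => x y; apply: avoidingC. Qed.

Lemma componentE T m k x : (x \in component T m k) = connect (avoiding T m) k x.
Proof. by rewrite inE. Qed.

Lemma component_refl T m k : k \in component T m k.
Proof. by rewrite componentE connect0. Qed.

Lemma componentC T m k x : (x \in component T m k) = (k \in component T m x).
Proof. by rewrite !componentE avoid_sym. Qed.

Lemma component_trans T m x k y :
  x \in component T m k -> y \in component T m x -> y \in component T m k.
Proof. by rewrite !componentE; apply: connect_trans. Qed.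

Lemma component_step T m k x y : x \in component T m k -> adjacent T x y ->
  x != m -> y != m -> y \in component T m k.
Proof.
rewrite !componentE => h a xm ym; apply: connect_trans h (connect1 _).
by rewrite /avoiding xm ym.
Qed.

Lemma component_eq T m k k' x :
  x \in component T m k -> x \in component T m k' -> k' \in component T m k.
Proof. by move=> h h'; apply: component_trans h _; rewrite componentC. Qed.

Lemma component_neq T m k x : k != m -> x \in component T m k -> x != m.
Proof.
rewrite componentE => km /connectP[p]; elim: p k km => [|z p IH] k km /=.
  by move=> _ ->.
by case/andP=> /and3P[_ zm _] pz xl; apply: IH pz xl.
Qed.

Lemma adj_neq T x y : antisym T -> adjacent T x y -> x != y.
Proof.
move=> h; apply: contraTneq => ->; rewrite /adjacent orbb.
by apply/negP => e; move: (h _ _ e); rewrite e.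
Qed.

(** Cut a path from [m] to [x] at its last visit to [m]. *)
Lemma component_cover T m x : connect (adjacent T) m x -> x != m ->
  exists2 w, adjacent T m w & x \in component T m w.
Proof.
case/connectP => p; elim/last_ind: p x => [|p z IH] x /=.
  by move=> _ -> /eqP.
rewrite rcons_path last_rcons => /andP[pp a] -> zm.
have [e|e] := eqVneq (last m p) m; first by rewrite e in a; exists z; rewrite ?component_refl.
have [w mw lw] := IH _ pp erefl e.
by exists w => //; apply: component_step a _ _.
Qed.

Section Acyclic.
Variable T : {set 'I_n * 'I_n}.
Hypothesis acT : acyclic T.

Lemma component_disj m k k' x : adjacent T m k -> adjacent T m k' ->
  x \in component T m k -> x \in component T m k' -> k' = k.
Proof. by case: acT => _ h a a' c c'; apply: h (component_eq c c'). Qed.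

Lemma edge_neq x y : edge T x y -> x != y.
Proof. by case: acT => h _ /edge_adj; apply: adj_neq. Qed.

Lemma edge_notC x y : edge T x y -> edge T y x -> False.
Proof. by case: acT => h _ /h/negP. Qed.

Lemma component_self m k : adjacent T m k -> m \notin component T m k.
Proof.
move=> a; apply/negP => h.
have km : k != m by rewrite eq_sym; apply: adj_neq a; case: acT.
by have := component_neq km h; rewrite eqxx.
Qed.

(** An upward walk from [p] cannot visit [m], as its step into [m] would close a
    cycle with the edge from [m] to [p]. *)
Lemma below_component m p x : edge T m p -> below T p x -> x \in component T m p.
Proof.
move=> mp /connectP[s]; elim/last_ind: s x => [|s z IH] x /=.
  by move=> _ ->; rewrite component_refl.
rewrite rcons_path last_rcons => /andP[ps e] ->.
have c := IH _ ps erefl.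
have lm : last p s != m by apply: component_neq c; rewrite eq_sym; apply: edge_neq.
apply: (component_step c (edge_adj e) lm).
apply/eqP => zm; subst z.
case: acT => _ h.
have lp : last p s = p by apply: (h m _ _ _ _ c); [apply: edge_adj | apply: edge_adjC].
by rewrite lp in e; apply: edge_notC e mp.
Qed.

Lemma edge_below_no m p : edge T m p -> below T p m -> False.
Proof.
move=> mp h; have := below_component mp h.
by apply/negP/component_self/edge_adj.
Qed.

Lemma below_step x y : below T x y -> x != y -> exists2 w, edge T x w & below T w y.
Proof.
case/connectP => -[|w p] /=; first by move=> _ -> /eqP.
by case/andP=> e pp -> _; exists w => //; apply/connectP; exists p.
Qed.

Lemma below_anti x y : below T x y -> below T y x -> x = y.
Proof.
move=> xy yx; apply/eqP/negPn/negP => ne.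
have [w e wy] := below_step xy ne.
by apply: edge_below_no e (below_trans wy yx).
Qed.

Lemma edge_no_between x y z : edge T x y -> below T x z -> below T z y ->
  z = x \/ z = y.
Proof.
move=> e xz zy; have [->|zx] := eqVneq z x; first by left.
right; have [w xw wz] : exists2 w, edge T x w & below T w z.
  by apply: below_step xz _; rewrite eq_sym.
have wy : w = y.
  apply: (component_disj (edge_adj e) (edge_adj xw) (component_refl _ _ _)).
  exact: (below_component xw (below_trans wz zy)).
by rewrite wy in wz; apply: below_anti.
Qed.

(** A walk that leaves [x] through [w] reaches [y] only by coming back to [x], as
    it would close a cycle otherwise. *)
Lemma component_sub x y w : adjacent T x y -> adjacent T x w -> w != y ->
  forall z, z \in component T x w -> z \in component T y x.
Proof.
move=> xy xw wy z; rewrite componentE => /connectP[p].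
have w_in : w \in component T y x.
  apply: component_step (component_refl _ _ _) xw _ wy.
  by apply: adj_neq xy; case: acT.
elim/last_ind: p z => [|p u IH] z /=; first by move=> _ ->.
rewrite rcons_path last_rcons => /andP[pp /and3P[lx ux a]] ->.
have cl : last w p \in component T x w by rewrite componentE; apply/connectP; exists p.
have h := IH _ pp erefl.
have ly : last w p != y.
  by apply: component_neq h; apply: adj_neq xy; case: acT.
apply: (component_step h a ly); apply/eqP => uy; subst u.
case/eqP: wy; apply: (component_disj xy xw (component_refl _ _ _)).
by apply: component_step cl a lx ux.
Qed.

Lemma component_sides x y k : adjacent T x y -> connect (adjacent T) x k ->
  k != x -> k \in component T x y \/ k \in component T y x.
Proof.
move=> xy xk kx; have [w xw kw] := component_cover xk kx.
have [e|wy] := eqVneq w y; first by left; rewrite -e.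
by right; apply: component_sub kw.
Qed.

(** Walk from [m] to [k], the first step going down: as long as the walk goes
    down, its nodes are below [m]; where it first turns upwards it meets a node
    [v] with two parents, one on the side of [m] and one on the side of [k]. *)
Lemma turn_down m w k : edge T w m -> k \in component T m w ->
  below T k m \/
  exists v q q', [/\ [/\ v != m, below T v m & q != q'],
    edge T v q, edge T v q', m \in component T v q & k \in component T v q'].
Proof.
move=> wm; rewrite componentE => /connectP[p0 /shortenP[p pp up _] ->].
have {pp up} : path (adjacent T) w p /\ uniq (m :: w :: p).
  split; first by apply: sub_path pp => a b /and3P[].
  rewrite cons_uniq up andbT inE negb_or (eq_sym m) edge_neq //=.
  elim: p w wm pp {up} => //= z p IH w wm /andP[/and3P[_ zm _] pz].
  have : m \notin z :: p.
    elim: p z zm pz {IH} => [|y p IH] z zm /=; first by rewrite inE eq_sym zm.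
    case/andP => /and3P[_ ym _] py; rewrite inE negb_or eq_sym zm /=.
    exact: IH ym py.
  by [].
elim: p m w wm => [|v p IH] m w wm [] /=; first by left; apply: edge_below.
case/andP=> wv pv /and4P[]; rewrite !inE !negb_or => /and3P[mw mv mp] /andP[wv' wp] vp up.
have [vw|nvw] := boolP (edge T v w).
  have [|kw|[u [q [q' [[uw buw qq] uq uq' wq kq]]]]] := IH _ _ vw.
  - by split=> //; rewrite /= inE negb_or wv' wp vp.
  - by left; apply: below_trans kw (edge_below wm).
  right; exists u, q, q'; split=> //; first split=> //.
    + apply/eqP => um; subst u.
      by apply: (edge_below_no wm); apply: buw.
    + exact: below_trans buw (edge_below wm).
  apply: component_step wq (edge_adj wm) _ _; first by rewrite eq_sym.
  apply/eqP => um; subst u; exact: (edge_below_no wm).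
right; exists w, m, v; split=> //.
- by split=> //; [rewrite eq_sym | apply: edge_below].
- by move: wv; rewrite /adjacent (negbTE nvw) orbF.
- exact: component_refl.
rewrite componentE; apply/connectP; exists p => //.
elim: p v pv wp {IH mv mp vp up nvw wv} wv' => //= z p IH v /andP[vz pz].
rewrite inE negb_or => /andP[wz wp] wv; rewrite (IH z) // andbT /avoiding vz.
by rewrite eq_sym wv eq_sym wz.
Qed.

End Acyclic.

Lemma turn_up T (acT : acyclic T) m w k : edge T m w -> k \in component T m w ->
  below T m k \/
  exists v q q', [/\ [/\ v != m, below T m v & q != q'],
    edge T q v, edge T q' v, m \in component T v q & k \in component T v q'].
Proof.
move=> mw kw; have := @turn_down (opp T) (acyclic_opp acT) m w k.
rewrite edge_opp component_opp => /(_ mw kw).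
case=> [|[v [q [q' [[vm bv qq] vq vq' c c']]]]]; first by rewrite below_opp; left.
right; exists v, q, q'; rewrite below_opp in bv.
by rewrite !edge_opp in vq vq'; rewrite !component_opp in c c'.
Qed.

End Trees.

(** * Trees compatible with two families of walls *)

Section Compatible.
Variable n : nat.
Implicit Types (T : {set 'I_n * 'I_n}) (U D : rel 'I_n).

(** A wall [ ]l, r[ ] of a node [m] with [p] on its left and [p'] on its right. *)
Definition separates T (m p p' l r : 'I_n) : Prop :=
  [/\ l < m, m < r, {in component T m p, forall z : 'I_n, z <= l}
    & {in component T m p', forall z : 'I_n, r <= z}].

Definition walled U T m p p' : Prop :=
  exists l r : 'I_n, ~~ U l r /\ separates T m p p' l r.

Definition valleys_walled U T : Prop :=
  forall m p p', edge T m p -> edge T m p' -> p != p' ->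
    walled U T m p p' \/ walled U T m p' p.

(** The mandatory arc of the edge from [x] to [y] contains no missing up arc: its
    first set consists of the nodes below [y]. *)
Definition edges_clear U T : Prop :=
  forall x y b c : 'I_n, edge T x y -> minn x y <= b -> b < c ->
    c <= maxn x y -> (forall k : 'I_n, b < k < c -> below T k y) -> U b c.

(** The conditions on down arcs are those on up arcs in the opposite tree, so
    that each statement on valleys has a dual on peaks. *)
Definition compatible U D T : Prop :=
  [/\ acyclic T, valleys_walled U T /\ edges_clear U T
    & valleys_walled D (opp T) /\ edges_clear D (opp T)].

Lemma compatible_opp U D T : compatible U D T -> compatible D U (opp T).
Proof. by case=> h1 h2 h3; split; rewrite ?oppK //; apply: acyclic_opp. Qed.

Lemma opp_separates T m p p' l r :
  separates (opp T) m p p' l r <-> separates T m p p' l r.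
Proof. by rewrite /separates !component_opp. Qed.

Section Facts.
Variables (U D : rel 'I_n) (T : {set 'I_n * 'I_n}).
Hypothesis gT : compatible U D T.

Let acT : acyclic T. Proof. by case: gT. Qed.
Let vaT : valleys_walled U T. Proof. by case: gT => _ []. Qed.

Lemma adj_connect (x y z : 'I_n) :
  adjacent T x y -> connect (adjacent T) x z -> connect (adjacent T) y z.
Proof. by rewrite adjacentC => a; apply: connect_trans (connect1 a). Qed.

(** Of three subtrees that are pairwise separated by [m], one would have to be
    both on the left and on the right of [m]. *)
Lemma valley_third m p p' l r w : edge T m p -> edge T m p' -> p != p' ->
  separates T m p p' l r -> edge T m w -> w = p \/ w = p'.
Proof.
move=> mp mp' pp' [lm mr hl hr] mw.
have [->|wp] := eqVneq w p; first by left.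
have [->|wp'] := eqVneq w p'; first by right.
have pl := hl _ (component_refl T m p).
have pr := hr _ (component_refl T m p').
case: (vaT mw mp wp) => -[l1 [r1 [_ [lm1 mr1 h1 h2]]]];
case: (vaT mw mp' wp') => -[l2 [r2 [_ [lm2 mr2 h3 h4]]]].
- by have := h2 _ (component_refl T m p); ineq.
- by have := h2 _ (component_refl T m p); ineq.
- have := h3 _ (component_refl T m w); have := h2 _ (component_refl T m w).
  by ineq.
- by have := h3 _ (component_refl T m p'); ineq.
Qed.

(** A node in the gap between the two ancestor subtrees of [m] hangs below [m]:
    were it beyond a turn of the walk from [m], it would be separated from [m]
    and from both subtrees by the wall at that turn. *)
Lemma gap_below (m p p' l r k : 'I_n) : edge T m p -> edge T m p' -> p != p' ->
  separates T m p p' l r -> l < k < r -> connect (adjacent T) m k ->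
  below T k m.
Proof.
move=> mp mp' pp' sep lkr mk.
have [lm mr hl hr] := sep.
have [->|km] := eqVneq k m; first exact: below_refl.
have [w aw kw] := component_cover mk km.
have [mw|nmw] := boolP (edge T m w).
  case: (valley_third mp mp' pp' sep mw) => e; subst w.
    by have := hl _ kw; ineq.
  by have := hr _ kw; ineq.
have wm : edge T w m by move: aw; rewrite /adjacent (negbTE nmw).
case: (turn_down acT wm kw) => [//|[v [q [q' [[vm bv qq] vq vq' mq kq]]]]].
have hp (u : 'I_n) : edge T m u -> u \in component T v q.
  move=> mu; apply: component_step mq (edge_adj mu) _ _; first by rewrite eq_sym.
  by apply/eqP => e; subst u; apply: (edge_below_no acT mu).
have pq := hp _ mp; have p'q := hp _ mp'.
have := hl _ (component_refl T m p); have := hr _ (component_refl T m p').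
case: (vaT vq vq' qq) => -[l' [r' [_ [lv vr h1 h2]]]].
  by have := h1 _ p'q; have := h2 _ kq; ineq.
by have := h2 _ pq; have := h1 _ kq; ineq.
Qed.

Lemma valley_split m p p' (x y k : 'I_n) : edge T m p -> edge T m p' -> p != p' ->
  x \in component T m p -> y \in component T m p -> k \in component T m p' ->
  minn x y < k < maxn x y -> False.
Proof.
move=> mp mp' pp' hx hy hk.
case: (vaT mp mp' pp') => -[l [r [_ [lm mr h1 h2]]]].
  by have := h1 _ hx; have := h1 _ hy; have := h2 _ hk; ineq.
by have := h2 _ hx; have := h2 _ hy; have := h1 _ hk; ineq.
Qed.

End Facts.

Lemma peak_split U D T (gT : compatible U D T) m p p' (x y k : 'I_n) :
  edge T p m -> edge T p' m -> p != p' ->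
  x \in component T m p -> y \in component T m p -> k \in component T m p' ->
  minn x y < k < maxn x y -> False.
Proof.
move=> mp mp' pp' hx hy hk.
apply: (valley_split (compatible_opp gT) (m := m) (p := p) (p' := p'));
  by rewrite ?edge_opp ?component_opp.
Qed.

(** Along a walk from the edge to [k], the first turn has [k] on one side and
    both ends of the edge on the other, which a value strictly between them does
    not allow; so the walk is monotone. *)
Lemma edge_comparable U D T (gT : compatible U D T) (x y k : 'I_n) :
  edge T x y -> minn x y < k < maxn x y -> connect (adjacent T) x k ->
  below T k y \/ below T x k.
Proof.
have acT : acyclic T by case: gT.
move=> xy xky xk.
have axy := edge_adj xy; have ayx := edge_adjC xy.
have kx : k != x by rewrite -val_eqE /=; lia.
have ky : k != y by rewrite -val_eqE /=; lia.
have yk := adj_connect axy xk.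
(* at a turn [v] other than [e], both ends [e] and [o] of the edge are on the
   same side: if [v] were [o], then [k] would also be on the side of [e] *)
have same (e o v q : 'I_n) : adjacent T e o -> k \in component T o e ->
    forall q', q != q' -> adjacent T v q -> adjacent T v q' ->
    v != e -> e \in component T v q -> k \in component T v q' ->
    o \in component T v q.
  move=> eo ko q' qq vq vq' ve eq kq.
  apply: (component_step eq eo); first by rewrite eq_sym.
  apply/eqP => ov; subst o.
  have ve' : adjacent T v e by rewrite adjacentC.
  have e1 : e = q.
    by have := component_disj acT vq ve' eq (component_refl _ _ _).
  have e2 : e = q'.
    by have := component_disj acT vq' ve' kq ko.
  by move/eqP: qq; apply; rewrite -e1.
have go (e o : 'I_n) : adjacent T e o -> k \in component T o e -> k != e ->
    connect (adjacent T) e k -> minn e o < k < maxn e o ->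
    below T k e \/ below T e k.
  move=> eo ko ke ek eko.
  have [w aw kw] := component_cover ek ke.
  have [ew|new] := boolP (edge T e w).
    case: (turn_up acT ew kw) => [|[v [q [q' [[ve bv qq] vq vq' mq kq]]]]]; first by right.
    exfalso; apply: (peak_split gT vq vq' qq mq _ kq eko).
    exact: same eo ko _ qq (edge_adjC vq) (edge_adjC vq') ve mq kq.
  have we : edge T w e by move: aw; rewrite /adjacent (negbTE new).
  case: (turn_down acT we kw) => [|[v [q [q' [[ve bv qq] vq vq' mq kq]]]]]; first by left.
  exfalso; apply: (valley_split gT vq vq' qq mq _ kq eko).
  exact: same eo ko _ qq (edge_adj vq) (edge_adj vq') ve mq kq.
case: (component_sides acT axy xk kx) => h.
  case: (go y x ayx h ky yk); first by rewrite minnC maxnC.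
    by left.
  by right; apply: below_trans (edge_below xy) _.
case: (go x y axy h kx xk xky); last by right.
by left; apply: below_trans _ (edge_below xy).
Qed.

End Compatible.

(** * Inserting the values one by one *)

(** The tree [T] obtained after inserting the values smaller than [v]; [bf] is the
    order in which the word lists the values. *)
Record stage n (U D bf : rel 'I_n) (v : 'I_n) (T : {set 'I_n * 'I_n}) : Prop :=
  Stage {
    stage_compatible : compatible U D T;
    stage_support : forall x y, edge T x y -> x < v /\ y < v;
    stage_connected : forall x y : 'I_n, x < v -> y < v -> connect (adjacent T) x y;
    stage_extension : forall x y, edge T x y -> bf x y;
    stage_irr : irreflexive bf;
    stage_trans : transitive bf;
    stage_total : forall x y, x != y -> bf x y || bf y x;
    stage_monoU : forall l r l' r' : 'I_n, l' <= l -> l < r -> r <= r' ->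
      U l' r' -> U l r;
    stage_monoD : forall l r l' r' : 'I_n, l' <= l -> l < r -> r <= r' ->
      D l' r' -> D l r;
    stage_essU : forall l r : 'I_n, r = l.+1 :> nat -> U l r;
    stage_essD : forall l r : 'I_n, r = l.+1 :> nat -> D l r }.

Definition converse n (bf : rel 'I_n) : rel 'I_n := fun x y => bf y x.

Lemma stage_opp n (U D bf : rel 'I_n) v T :
  stage U D bf v T -> stage D U (converse bf) v (opp T).
Proof.
move=> st; split; rewrite /converse.
- exact: compatible_opp (stage_compatible st).
- by move=> x y; rewrite edge_opp => h; split; case: (stage_support st h).
- move=> x y xv yv; rewrite (eq_connect (@adjacent_opp n T)).
  exact: (stage_connected st).
- by move=> x y; rewrite edge_opp; apply: (stage_extension st).
- exact: (stage_irr st).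
- by move=> y x z h1 h2; apply: (stage_trans st) h2 h1.
- by move=> x y h; rewrite orbC; apply: (stage_total st).
- exact: (stage_monoD st).
- exact: (stage_monoU st).
- exact: (stage_essD st).
- exact: (stage_essU st).
Qed.

(** The arc from [z] to [v] made of the values before [v] and the values after [v]
    crosses no wall. *)
Definition visible n (U D bf : rel 'I_n) (v z : 'I_n) : Prop :=
  z < v /\ forall b c : 'I_n, z <= b -> b < c -> c <= v ->
    ((forall k : 'I_n, b < k < c -> bf k v) -> U b c) /\
    ((forall k : 'I_n, b < k < c -> bf v k) -> D b c).

Definition last_before n (U D bf : rel 'I_n) (v z : 'I_n) : Prop :=
  [/\ visible U D bf v z, bf z v
    & forall z', visible U D bf v z' -> bf z' v -> z' = z \/ bf z' z].

Definition first_after n (U D bf : rel 'I_n) (v z : 'I_n) : Prop :=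
  last_before D U (converse bf) v z.

(** The new value [v] subdivides the edge from the last visible value placed
    before it to the first visible value placed after it; if one of them does not
    exist, [v] is a leaf attached to the other. *)
Definition insertion n (U D bf : rel 'I_n) (v : 'I_n) (T : {set 'I_n * 'I_n}) :
    {set 'I_n * 'I_n} :=
  [set ab | `[< [\/ edge T ab.1 ab.2 /\
                     ~ (last_before U D bf v ab.1 /\ first_after U D bf v ab.2),
                   last_before U D bf v ab.1 /\ ab.2 = v
                 | ab.1 = v /\ first_after U D bf v ab.2] >] ]%SET.

Section Insertion.
Variable n : nat.
Implicit Types (T : {set 'I_n * 'I_n}) (U D bf : rel 'I_n) (v x y z m p q b c k l r : 'I_n).

Lemma visible_opp U D bf v z :
  visible D U (converse bf) v z <-> visible U D bf v z.
Proof.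
by split=> -[zv h]; split=> // b c zb bc cv; case: (h b c zb bc cv).
Qed.

Lemma insertion_edge U D bf v T x y :
  edge (insertion U D bf v T) x y <->
  [\/ edge T x y /\ ~ (last_before U D bf v x /\ first_after U D bf v y),
      last_before U D bf v x /\ y = v | x = v /\ first_after U D bf v y].
Proof. by rewrite /edge /insertion inE /=; split=> [/asboolP|h]; last apply/asboolP. Qed.

Lemma insertion_opp U D bf v T :
  insertion D U (converse bf) v (opp T) = opp (insertion U D bf v T).
Proof.
apply/setP => -[x y].
have -> : ((x, y) \in opp (insertion U D bf v T)) = edge (insertion U D bf v T) y x.
  by rewrite inE.
rewrite -[LHS]/(edge _ x y); apply/idP/idP => /insertion_edge h; apply/insertion_edge.
  rewrite edge_opp in h; case: h => [[h1 h2]|[h1 h2]|[h1 h2]].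
  - by constructor 1; split=> // -[a b]; apply: h2.
  - by constructor 3.
  - by constructor 2.
rewrite edge_opp; case: h => [[h1 h2]|[h1 h2]|[h1 h2]].
- by constructor 1; split=> // -[a b]; apply: h2.
- by constructor 3.
- by constructor 2.
Qed.

Section Stage.
Variables (U D bf : rel 'I_n) (v : 'I_n) (T : {set 'I_n * 'I_n}).
Hypothesis st : stage U D bf v T.
Local Notation vis := (visible U D bf v).
Local Notation lastb := (last_before U D bf v).
Local Notation firsta := (first_after U D bf v).

Let gT : compatible U D T := stage_compatible st.
Let acT : acyclic T. Proof. by case: gT. Qed.

Lemma bf_notC x y : bf x y -> bf y x -> False.
Proof.
move=> h1 h2; have := stage_trans st h1 h2; by rewrite (stage_irr st).
Qed.

Lemma bf_neq x y : bf x y -> x <> y.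
Proof. by move=> h e; rewrite e (stage_irr st) in h. Qed.

Lemma bf_or x y : x != y -> bf x y \/ bf y x.
Proof. by move/(stage_total st)/orP. Qed.

Lemma below_bf x y : below T x y -> x = y \/ bf x y.
Proof.
case/connectP => s; elim: s x => [|z s IH] x /=; first by left.
case/andP=> e ps ey; right; have xz := stage_extension st e.
by case: (IH _ ps ey) => [<- //|]; apply: (stage_trans st xz).
Qed.

Lemma vis_lt z : vis z -> z < v. Proof. by case. Qed.

Lemma vis_up z z' : vis z -> z <= z' -> z' < v -> vis z'.
Proof.
case=> _ h zz' z'v; split=> // b c zb; apply: h; exact: leq_trans zb.
Qed.

Lemma vis_clearU z b c : vis z -> z <= b -> b < c -> c <= v ->
  (forall k : 'I_n, b < k < c -> bf k v) -> U b c.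
Proof. by case=> _ h *; apply h. Qed.

Lemma vis_clearD z b c : vis z -> z <= b -> b < c -> c <= v ->
  (forall k : 'I_n, b < k < c -> bf v k) -> D b c.
Proof. by case=> _ h *; apply h. Qed.

Lemma vis_pred z : v = z.+1 :> nat -> vis z.
Proof.
move=> vz; split=> [|b c zb bc cv]; first by rewrite vz.
have e : c = b.+1 :> nat by ineq.
by split=> _; [apply: (stage_essU st) | apply: (stage_essD st)].
Qed.

(** A wall hiding the largest invisible value [b] starts at [b], for it would hide
    a visible value if it started further to the right. *)
Lemma invisible_wall z : z < v -> ~ vis z -> exists b c : 'I_n,
  [/\ z <= b, b < c, c <= v, ~ vis b & (forall z', vis z' -> b < z') /\
   (forall k : 'I_n, b < k -> k < v -> vis k)] /\
  ((forall k : 'I_n, b < k < c -> bf k v) /\ ~~ U b c \/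
   (forall k : 'I_n, b < k < c -> bf v k) /\ ~~ D b c).
Proof.
move=> zv nz.
pose P := fun b : 'I_n => (b < v) && ~~ `[< vis b >].
have Pz : P z by rewrite /P zv; apply/asboolPn.
case: (arg_maxnP (fun b : 'I_n => b : nat) Pz) => b /andP[bv /asboolPn nb] mb.
have zb : z <= b by apply: mb.
have vb z' : vis z' -> b < z'.
  move=> h; rewrite ltnNge; apply/negP => z'b; exact/nb/(vis_up h).
have bk (k : 'I_n) : b < k -> k < v -> vis k.
  move=> h kv; apply/asboolP/negPn/negP => nk.
  by have : P k -> k <= b := mb k; rewrite /P kv nk => /(_ isT); lia.
have [b' [c [bb' bc cv w]]] : exists b' c : 'I_n, [/\ b <= b', b' < c, c <= v &
    ((forall k : 'I_n, b' < k < c -> bf k v) /\ ~~ U b' c \/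
     (forall k : 'I_n, b' < k < c -> bf v k) /\ ~~ D b' c)].
  apply: contrapT => no; apply: nb; split=> // b' c bb' bc cv.
  split=> h; apply/negPn/negP => nU; apply: no; exists b', c; split=> //.
    by left.
  by right.
have e : b' = b.
  apply/val_inj/eqP; rewrite eqn_leq bb' andbT leqNgt; apply/negP => lt.
  have vb' : vis b' by apply: bk => //; exact: leq_trans cv.
  case: w => -[h]; apply/negP; rewrite negbK.
    exact: (vis_clearU vb' (leqnn _) bc cv h).
  exact: (vis_clearD vb' (leqnn _) bc cv h).
by subst b'; exists b, c.
Qed.

(** The gap of a valley placed before [v] is placed before [v], so its wall
    hides from [v] whatever lies to its left. *)
Lemma valley_hides m p p' l r z : edge T m p -> edge T m p' -> p != p' ->
  ~~ U l r -> separates T m p p' l r -> bf m v -> z \in component T m p ->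
  vis z -> False.
Proof.
move=> mp mp' pp' nU sep mv zp vz.
have [lm mr hl hr] := sep.
have [_ p'v] := stage_support st mp'.
have rp' := hr _ (component_refl T m p').
have [mlt _] := stage_support st mp.
move/negP: nU; apply; apply: (vis_clearU vz (hl _ zp)); [ineq|ineq|].
move=> k lkr.
have mk : connect (adjacent T) m k by apply: (stage_connected st) => //; ineq.
have := gap_below gT mp mp' pp' sep lkr mk.
by case/below_bf => [-> //|km]; apply: (stage_trans st) mv.
Qed.

Lemma first_after_bf y z : firsta y -> vis z -> bf v z -> z = y \/ bf y z.
Proof.
by case=> _ _ h vz zv; apply: h => //; apply/visible_opp.
Qed.

Lemma first_after_vis y : firsta y -> vis y /\ bf v y.
Proof. by case=> /visible_opp. Qed.

End Stage.

Lemma peak_hides U D bf v T m p p' l r z : stage U D bf v T ->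
  edge T p m -> edge T p' m -> p != p' ->
  ~~ D l r -> separates T m p p' l r -> bf v m -> z \in component T m p ->
  visible U D bf v z -> False.
Proof.
move=> st mp mp' pp' nD sep mv zp vz.
apply: (valley_hides (stage_opp st) (m := m) (p := p) (p' := p') (l := l) (r := r) (z := z));
  rewrite ?edge_opp ?component_opp //.
  by apply/opp_separates.
by apply/visible_opp.
Qed.

Section Stage2.
Variables (U D bf : rel 'I_n) (v : 'I_n) (T : {set 'I_n * 'I_n}).
Hypothesis st : stage U D bf v T.
Local Notation vis := (visible U D bf v).
Local Notation lastb := (last_before U D bf v).
Local Notation firsta := (first_after U D bf v).

Let gT : compatible U D T := stage_compatible st.
Let acT : acyclic T. Proof. by case: gT. Qed.
Let vaT : valleys_walled U T. Proof. by case: gT => _ []. Qed.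
Let peT : valleys_walled D (opp T). Proof. by case: gT => _ _ []. Qed.

Lemma peak_walled m p p' : edge T p m -> edge T p' m -> p != p' ->
  walled D T m p p' \/ walled D T m p' p.
Proof.
have := @peT m p p'; rewrite !edge_opp => h h1 h2 h3.
by case: (h h1 h2 h3) => -[l [r [nD /opp_separates s]]]; [left|right]; exists l, r.
Qed.

(** A valley [m] placed after [v] cannot have [y] in its left subtree: [m] would
    be visible, so placed after [y], and the walk from [m] up to the left
    subtree would turn at a peak placed after [v] and hiding [y]. *)
Lemma valley_first m p p' l r y : edge T m p -> edge T m p' -> p != p' ->
  ~~ U l r -> separates T m p p' l r -> bf v m -> y \in component T m p ->
  firsta y -> False.
Proof.
move=> mp mp' pp' nU [lm mr hl hr] vm yp fy.
have [vy yv] := first_after_vis fy.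
have mlt : m < v by case: (stage_support st mp).
have yl := hl _ yp.
have ym : y < m by ineq.
have vism : vis m by apply: (vis_up vy) => //; ineq.
have bym : bf y m.
  by case: (first_after_bf fy vism vm) => // e; subst y; ineq.
case: (turn_up acT mp yp) => [|[m' [q [q' [[m'm bm qq] mq mq' cm cy]]]]].
  case/(below_bf st) => [e|h]; first by subst y; ineq.
  exact: (bf_notC st h).
have vm' : bf v m'.
  case: (below_bf st bm) => [e|h]; first by rewrite e eqxx in m'm.
  exact: (stage_trans st vm h).
case: (peak_walled mq mq' qq) => -[l' [r' [nD sep]]].
  by case: sep => lm' mr' h1 h2; have := h1 _ cm; have := h2 _ cy; ineq.
rewrite eq_sym in qq.
exact: (peak_hides st mq' mq qq nD sep vm' cy vy).
Qed.

(** The last visible value placed before [v] and the first visible one placed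
    after [v] are joined by an edge, which the insertion subdivides: a turn of
    the walk between them would hide one of them, and a third node on a monotone
    walk would be invisible, so left of a wall that one of the end edges of the
    walk would cross. *)
Lemma attach_edge x y : lastb x -> firsta y -> edge T x y.
Proof.
move=> lx fy; have [vx bxv xmax] := lx; have [vy bvy] := first_after_vis fy.
have xlt := vis_lt vx; have ylt := vis_lt vy.
have bxy := stage_trans st bxv bvy.
have xy : x != y by apply/eqP; apply: (bf_neq st).
have cxy : connect (adjacent T) x y by apply: (stage_connected st).
have hidden m : bf x m -> bf m y -> ~ vis m.
  move=> xm my vm.
  have mv : m != v by apply/eqP => e; subst m; have := vis_lt vm; ineq.
  case: (bf_or st mv) => h.
    case: (xmax _ vm h) => [e|h']; first by subst m; apply: (bf_neq st xm).
    exact: (bf_notC st xm).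
  case: (first_after_bf fy vm h) => [e|h']; first by subst m; apply: (bf_neq st my).
  exact: (bf_notC st my).
have [w aw yw] : exists2 w, adjacent T x w & y \in component T x w.
  by apply: component_cover cxy _; rewrite eq_sym.
have [xw|nxw] := boolP (edge T x w); last first.
  have wx : edge T w x by move: aw; rewrite /adjacent (negbTE nxw).
  case: (turn_down acT wx yw) => [|[m [q [q' [[mx bm qq] mq mq' cx cy]]]]].
    case/(below_bf st) => [e|h]; first by rewrite e eqxx in xy.
    by case: (bf_notC st h bxy).
  have bmv : bf m v.
    case: (below_bf st bm) => [->//|h]; exact: (stage_trans st h).
  case: (vaT mq mq' qq) => -[l [r [nU sep]]].
    by case: (valley_hides st mq mq' qq nU sep bmv cx vx).
  rewrite eq_sym in qq.
  by case: (valley_hides st mq' mq qq nU sep bmv cy vy).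
case: (turn_up acT xw yw) => [bxy'|[m [q [q' [[mx bm qq] mq mq' cx cy]]]]]; last first.
  have bxm : bf x m.
    by case: (below_bf st bm) => // e; rewrite e eqxx in mx.
  have mlt : m < v by case: (stage_support st mq).
  have visx : vis m.
    case: (peak_walled mq mq' qq) => -[l [r [_ [lm mr h1 h2]]]].
      by apply: (vis_up vx) => //; have := h1 _ cx; ineq.
    by apply: (vis_up vy) => //; have := h1 _ cy; ineq.
  have bvm : bf v m.
    have mv : m != v by apply/eqP => e; subst m; ineq.
    case: (bf_or st mv) => // bmv.
    case: (xmax _ visx bmv) => [e|h]; first by rewrite e eqxx in mx.
    by case: (bf_notC st h).
  case: (peak_walled mq mq' qq) => -[l [r [nD sep]]].
    by case: (peak_hides st mq mq' qq nD sep bvm cx vx).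
  rewrite eq_sym in qq.
  by case: (peak_hides st mq' mq qq nD sep bvm cy vy).
have {w aw yw xw} [w xw bwy] := below_step bxy' xy.
have [z zy bxz] : exists2 z, edge T z y & below T x z.
  have yx : below (opp T) y x by rewrite below_opp.
  have [|z] := below_step yx; first by rewrite eq_sym.
  by rewrite edge_opp below_opp; exists z.
have [wy|wy] := eqVneq w y; first by rewrite wy in xw.
have zx : z != x.
  apply/eqP => e; subst z; case: (edge_no_between acT zy (edge_below xw) bwy) => e.
    by have := edge_neq acT xw; rewrite e eqxx.
  by rewrite e eqxx in wy.
have bxw := stage_extension st xw; have bzy := stage_extension st zy.
have bwy' : bf w y by case: (below_bf st bwy) => // e; rewrite e eqxx in wy.
have bxz' : bf x z by case: (below_bf st bxz) => // e; rewrite e eqxx in zx.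
have hw := hidden _ bxw bwy'; have hz := hidden _ bxz' bzy.
have wlt : w < v by case: (stage_support st xw).
have [b [c [[wb bc cv nb [vb bk]] wall]]] := invisible_wall wlt hw.
have zb : z <= b.
  rewrite leqNgt; apply/negP => h; apply: hz; apply: bk => //.
  by case: (stage_support st zy).
have bx := vb _ vx; have by_ := vb _ vy.
exfalso; case: wall => -[wall] /negP; apply.
  have cy : c <= y.
    rewrite leqNgt; apply/negP => h; apply: (bf_notC st bvy); apply: wall; ineq.
  case: gT => _ [_ clear] _; apply: (clear _ _ _ _ zy) => //; [ineq|ineq|].
  move=> k kbc; have kv := wall _ kbc.
  have kz : connect (adjacent T) z k by apply: (stage_connected st); ineq.
  case: (edge_comparable gT zy _ kz) => //; first by ineq.
  case/(below_bf st) => [e|zk]; first by subst k; ineq.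
  have vk : vis k by apply: bk; ineq.
  have xk := stage_trans st bxz' zk.
  case: (xmax _ vk kv) => [e|h]; first by subst k; case: (bf_neq st xk).
  by case: (bf_notC st h).
have cx : c <= x.
  rewrite leqNgt; apply/negP => h; apply: (bf_notC st bxv); apply: wall; ineq.
case: gT => _ _ [_ clear]; apply: (clear w x); rewrite ?edge_opp //; [ineq|ineq|].
move=> k kbc; rewrite below_opp; have kv := wall _ kbc.
have kx : connect (adjacent T) x k by apply: (stage_connected st); ineq.
case: (edge_comparable gT xw _ kx) => //; first by ineq.
case/(below_bf st) => [e|kw]; first by subst k; ineq.
have vk : vis k by apply: bk; ineq.
have ky := stage_trans st kw bwy'.
case: (first_after_bf fy vk kv) => [e|h]; first by subst k; case: (bf_neq st ky).
by case: (bf_notC st h).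
Qed.

End Stage2.
End Insertion.

Section InsertionStage.
Variable n : nat.
Implicit Types (T : {set 'I_n * 'I_n}) (U D bf : rel 'I_n) (v x y z m p q b c k l r : 'I_n).

Section Stage.
Variables (U D bf : rel 'I_n) (v : 'I_n) (T : {set 'I_n * 'I_n}).
Hypothesis st : stage U D bf v T.
Local Notation vis := (visible U D bf v).
Local Notation lastb := (last_before U D bf v).
Local Notation firsta := (first_after U D bf v).
Local Notation T' := (insertion U D bf v T).
Let attach a := lastb a \/ firsta a.

Let gT : compatible U D T := stage_compatible st.
Let acT : acyclic T. Proof. by case: gT. Qed.
Let vaT : valleys_walled U T. Proof. by case: gT => _ []. Qed.

Lemma last_before_lt a : lastb a -> a < v. Proof. by case=> -[]. Qed.
Lemma first_after_lt a : firsta a -> a < v. Proof. by case=> -[]. Qed.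

Lemma attach_lt a : attach a -> a < v.
Proof. by case; [apply: last_before_lt | apply: first_after_lt]. Qed.

Lemma attach_vis a : attach a -> vis a.
Proof. by case=> [[]|[/visible_opp]]. Qed.

Lemma lt_neq (a b : 'I_n) : a < b -> a != b.
Proof. by rewrite -val_eqE /= => h; rewrite ltn_eqF. Qed.

Lemma last_before_uniq a b : lastb a -> lastb b -> a = b.
Proof.
case=> va ba ha [vb bb hb].
case: (ha _ vb bb) => // ab; case: (hb _ va ba) => // ba'.
by case: (bf_notC st ab ba').
Qed.

Lemma first_after_uniq a b : firsta a -> firsta b -> a = b.
Proof.
move=> fa fb; have [va ba] := first_after_vis fa.
have [vb bb] := first_after_vis fb.
case: (first_after_bf fa vb bb) => // ab; case: (first_after_bf fb va ba) => // ba'.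
by case: (bf_notC st ab ba').
Qed.

Lemma first_after_exists z : vis z -> bf v z -> exists y, firsta y.
Proof.
move=> vz bvz.
pose P := fun y : 'I_n => `[< vis y /\ bf v y >].
have Pz : P z by apply/asboolP.
pose f y := #|[pred u | bf u y]|.
case: (arg_minnP f Pz) => y /asboolP[vy by_] my.
exists y; split=> //; first exact/visible_opp.
move=> u /visible_opp vu bu.
have [->|uy] := eqVneq u y; first by left.
case: (bf_or st uy) => [uy'|]; last by right.
have : f u < f y.
  apply: proper_card; apply/properP; split.
    by apply/fintype.subsetP => t; rewrite !inE => tu; apply: (stage_trans st tu).
  by exists u; rewrite !inE ?uy' // (stage_irr st).
by rewrite ltnNge my //; apply/asboolP.
Qed.

Lemma last_first a : lastb a -> firsta a -> False.
Proof. by case=> _ av _ /first_after_vis[_ va]; apply: (bf_notC st av va). Qed.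

Lemma insertion_old a b : edge T' a b -> a != v -> b != v ->
  edge T a b /\ ~ (lastb a /\ firsta b).
Proof.
by case/insertion_edge => [//|[_ ->]|[-> _]]; rewrite eqxx.
Qed.

Lemma insertion_to a : edge T' a v -> lastb a.
Proof.
case/insertion_edge => [[h _]|[]//|[_]].
  by case: (stage_support st h); rewrite ltnn.
by move/first_after_lt; rewrite ltnn.
Qed.

Lemma insertion_from a : edge T' v a -> firsta a.
Proof.
case/insertion_edge => [[h _]|[]//|[]//].
  by case: (stage_support st h); rewrite ltnn.
by move/last_before_lt; rewrite ltnn.
Qed.

Lemma insertion_adj_old a b : adjacent T' a b -> a != v -> b != v ->
  adjacent T a b.
Proof.
case/orP => h av bv; case: (insertion_old h) => // e _.
  exact: edge_adj.
exact: edge_adjC.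
Qed.

Lemma insertion_adj_new a : adjacent T' a v -> attach a.
Proof. by case/orP => [/insertion_to|/insertion_from]; [left|right]. Qed.

Lemma attach_adj a b : attach a -> attach b -> a != b -> adjacent T a b.
Proof.
case=> ha [] hb ab.
- by case/eqP: ab; apply: last_before_uniq.
- exact/edge_adj/(attach_edge st).
- exact/edge_adjC/(attach_edge st).
- by case/eqP: ab; apply: first_after_uniq.
Qed.

Lemma attach_not_adj a b : attach a -> attach b -> adjacent T' a b -> False.
Proof.
have e_no a' b' : attach a' -> attach b' -> edge T' a' b' -> False.
  move=> ha hb h.
  have [] := insertion_old h (lt_neq (attach_lt ha)) (lt_neq (attach_lt hb)).
  move=> e nab; case: ha hb => ha [] hb.
  - by have := edge_neq acT e; rewrite (last_before_uniq ha hb) eqxx.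
  - exact: nab.
  - exact: (edge_notC acT e (attach_edge st hb ha)).
  - by have := edge_neq acT e; rewrite (first_after_uniq ha hb) eqxx.
by move=> ha hb /orP[]; apply: e_no.
Qed.

Lemma insertion_antisym : antisym T'.
Proof.
move=> a b h; apply/negP => h'.
have [av|av] := eqVneq a v.
  subst a; exact: last_first (insertion_to h') (insertion_from h).
have [bv|bv] := eqVneq b v.
  subst b; exact: last_first (insertion_to h) (insertion_from h').
have [e _] := insertion_old h av bv; have [e' _] := insertion_old h' bv av.
exact: edge_notC e e'.
Qed.

(** Erasing [v] from a walk in the new tree gives a walk in the old one. *)
Lemma insertion_component m k z : m != v -> k != v -> z \in component T' m k ->
  (z != v -> z \in component T m k) /\
  (z = v -> exists a, [/\ attach a, a != m & a \in component T m k]).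
Proof.
move=> mv kv; rewrite componentE => /connectP[s]; elim/last_ind: s z => [|s u IH] z /=.
  by move=> _ ->; split=> [_|e]; [apply: component_refl|rewrite e eqxx in kv].
rewrite rcons_path last_rcons => /andP[ps /and3P[lm um a]] ->.
have [h1 h2] := IH _ ps erefl; move: (last k s) lm a h1 h2 => w wm a h1 h2.
have [wv|wv] := eqVneq w v.
  have [a' [ha am ca]] := h2 wv; subst w.
  split=> [uv|uv]; last first.
    by subst u; have := adj_neq insertion_antisym a; rewrite eqxx.
  have hu : attach u by apply: insertion_adj_new; rewrite adjacentC.
  have [<- //|au] := eqVneq a' u.
  exact: (component_step ca (attach_adj ha hu au) am um).
split=> uv; first exact: (component_step (h1 wv) (insertion_adj_old a wv uv) wm um).
by subst u; exists w; split; [apply: insertion_adj_new | | apply: h1].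
Qed.

Lemma insertion_component_old m k z : m != v -> k != v -> z != v ->
  z \in component T' m k -> z \in component T m k.
Proof. by move=> mv kv zv /(insertion_component mv kv)[h _]; apply: h. Qed.

Lemma insertion_component_new m k : m != v -> k != v ->
  v \in component T' m k -> exists a, [/\ attach a, a != m & a \in component T m k].
Proof. by move=> mv kv /(insertion_component mv kv)[_]; apply. Qed.

Lemma insertion_component_via m z : m != v -> z != v ->
  z \in component T' m v -> exists a, [/\ attach a, a != m & z \in component T m a].
Proof.
move=> mv zv; rewrite componentC => /(insertion_component_new mv zv)[a [ha am ca]].
by exists a; rewrite componentC.
Qed.

(** The sides of the old edge from [x] to [y] are linked only through [v]. *)
Lemma insertion_cut x y : lastb x -> firsta y -> y \in component T' v x -> False.
Proof.
move=> lx fy.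
have xy := attach_edge st lx fy.
have ax : attach x by left.
have ay : attach y by right.
have xv := lt_neq (attach_lt ax); have yv := lt_neq (attach_lt ay).
suff h z : z \in component T' v x -> z != v -> z \in component T y x.
  move=> /h /(_ yv) c.
  by have := component_self acT (edge_adjC xy); rewrite c.
rewrite componentE => /connectP[s]; elim/last_ind: s z => [|s u IH] z /=.
  by move=> _ -> _; apply: component_refl.
rewrite rcons_path last_rcons => /andP[ps /and3P[lv uv a]] -> _.
have c := IH _ ps erefl lv.
have a' := insertion_adj_old a lv uv.
have ly : last x s != y.
  exact: component_neq (edge_neq acT xy) c.
apply: (component_step c a' ly); apply/eqP => uy.
move: a a' c; rewrite uy => a a' c.
have e : last x s = x.
  case: acT => _ h; apply: (h y) c; first exact: edge_adjC.
  by rewrite adjacentC.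
by rewrite e in a; apply: (attach_not_adj ax ay).
Qed.

Lemma insertion_acyclic : acyclic T'.
Proof.
split; first exact: insertion_antisym.
case: acT => _ hac.
move=> m k k' mk mk' ck.
have adjn := adj_neq insertion_antisym.
have [mv|mv] := eqVneq m v.
  subst m; have hk : attach k by apply: insertion_adj_new; rewrite adjacentC.
  have hk' : attach k' by apply: insertion_adj_new; rewrite adjacentC.
  case: hk hk' => ha [] hb.
  - exact: last_before_uniq.
  - by case: (insertion_cut ha hb ck).
  - by case: (insertion_cut hb ha); rewrite componentC.
  - exact: first_after_uniq.
have go k1 k2 : k1 != v -> k2 = v -> adjacent T' m k1 -> adjacent T' m k2 ->
    k2 \in component T' m k1 -> False.
  move=> kv e a1 a2; subst k2 => /(insertion_component_new mv kv)[a [ha am ca]].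
  have hm : attach m by apply: insertion_adj_new.
  have am' : adjacent T m a by apply: attach_adj; rewrite // eq_sym.
  have e : a = k1 by apply: (hac m) ca => //; apply: insertion_adj_old.
  by subst k1; apply: (attach_not_adj hm ha).
have [kv|kv] := eqVneq k v; have [kv'|kv'] := eqVneq k' v.
- by rewrite kv kv'.
- by case: (go k' k) => //; rewrite componentC.
- by case: (go k k').
apply: (hac m); [exact: insertion_adj_old|exact: insertion_adj_old|].
exact: insertion_component_old.
Qed.

Lemma insertion_below a b : a != v -> below T' a b ->
  (b != v -> below T a b) /\ (b = v -> exists2 x, lastb x & below T a x).
Proof.
move=> av /connectP[s]; elim/last_ind: s b => [|s u IH] b /=.
  by move=> _ ->; split=> [_|e]; [apply: below_refl|rewrite e eqxx in av].
rewrite rcons_path last_rcons => /andP[ps e] ->.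
have [h1 h2] := IH _ ps erefl; move: (last a s) e h1 h2 => w e h1 h2.
have [wv|wv] := eqVneq w v.
  have [x lx bx] := h2 wv; subst w.
  have fu := insertion_from e; split=> uv.
    exact: below_trans bx (edge_below (attach_edge st lx fu)).
  by subst u; have := first_after_lt fu; rewrite ltnn.
split=> uv.
  by have [e' _] := insertion_old e wv uv; apply: below_trans (h1 wv) (edge_below e').
by subst u; exists w; [apply: insertion_to | apply: h1].
Qed.

(** For the new edges this is the visibility of their old ends.  The values below
    the edge from [v] to [y] are those below [y], and the visible ones among them
    precede [v] because [y] is the first visible value that does not. *)
Lemma insertion_clear : edges_clear U T'.
Proof.
move=> x y b c e xb bc cy h.
case/insertion_edge: e => [[e _]|[lx yv]|[xv fy]].
- case: gT => _ [_ clear] _; apply: (clear _ _ _ _ e) => // k kbc.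
  have [xv yv] := stage_support st e.
  have kv : k != v by apply: lt_neq; ineq.
  by case: (insertion_below kv (h _ kbc)) => + _; apply; apply: lt_neq.
- subst y; have xv := last_before_lt lx.
  apply: (vis_clearU (attach_vis (or_introl lx))); [ineq|ineq|ineq|].
  move=> k kbc; have kv : k != v by apply: lt_neq; ineq.
  have [_ /(_ erefl)[x' lx' kx]] := insertion_below kv (h _ kbc).
  have [_ x'v _] := lx'.
  by case: (below_bf st kx) => [->//|kx']; apply: (stage_trans st kx').
subst x; have yv := first_after_lt fy.
have [vy _] := first_after_vis fy.
apply: (vis_clearU vy); [ineq|ineq|ineq|].
move=> k kbc; have kv : k != v by apply: lt_neq; ineq.
have [/(_ (lt_neq yv)) ky _] := insertion_below kv (h _ kbc).
have vk : vis k by apply: (vis_up vy); ineq.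
case: (bf_or st kv) => // vk'.
case: (below_bf st ky) => [e|ky']; first by subst k; ineq.
case: (first_after_bf fy vk vk') => [e|h']; first by subst k; ineq.
by case: (bf_notC st ky' h').
Qed.

(** The new node [v] is larger than all others, so it must not fall into a left
    ancestor subtree; one containing [v] contains a visible end of the edge being
    subdivided, which the valley hides. *)
Lemma insertion_not_left m p p' l r a : edge T m p -> edge T m p' -> p != p' ->
  ~~ U l r -> separates T m p p' l r -> attach a -> a \in component T m p -> False.
Proof.
move=> mp mp' pp' nU sep ha ca.
have va := attach_vis ha.
have [lm mr hl hr] := sep.
have mlt : m < v by case: (stage_support st mp).
have al := hl _ ca.
have vm : vis m by apply: (vis_up va) => //; ineq.
case: (bf_or st (lt_neq mlt)) => h.
  exact: (valley_hides st mp mp' pp' nU sep h ca va).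
case: ha => [la|fa]; last exact: (valley_first st mp mp' pp' nU sep h ca fa).
(* [m] is visible and placed after [v], so there is a first such value [y] *)
have [y fy] : exists y, firsta y.
  exact: (first_after_exists vm h).
have e := attach_edge st la fy.
have ym : y != m.
  apply/eqP => ym; subst y.
  have ep : p = a.
    exact: (component_disj acT (edge_adjC e) (edge_adj mp) (component_refl _ _ _) ca).
  by subst p; apply: (edge_notC acT mp).
have am : a != m by apply: lt_neq; ineq.
exact: (valley_first st mp mp' pp' nU sep h (component_step ca (edge_adj e) am ym) fy).
Qed.

(** An old valley keeps its wall by [insertion_not_left].  If [v] is a new parent of
    [m], either it replaces the old parent [y] of [m] and takes over its wall, or
    no visible value comes after [v]; then no node above [m] is visible and the
    wall that hides them separates them from [v]. *)
Lemma insertion_valleys : valleys_walled U T'.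
Proof.
move=> m p p' mp mp' pp'.
have [mv|mv] := eqVneq m v.
  subst m; case/eqP: pp'.
  exact: first_after_uniq (insertion_from mp) (insertion_from mp').
have mlt : m < v.
  case/insertion_edge: mp => [[/(stage_support st)[] //]|[/last_before_lt //]|[e]].
  by rewrite e eqxx in mv.
have old q q' l r : edge T m q -> edge T m q' -> q != q' -> ~~ U l r ->
    separates T m q q' l r -> q != v ->
    {in component T' m q, forall z : 'I_n, z <= l}.
  move=> mq mq' qq nU sep qv z cz.
  have [zv|zv] := eqVneq z v.
    subst z; have [a [ha am ca]] := insertion_component_new mv qv cz.
    by case: (insertion_not_left mq mq' qq nU sep ha ca).
  by case: sep => _ _ h _; apply: h; apply: insertion_component_old.
have olds q q' l r : edge T m q -> edge T m q' -> q != q' -> q != v -> q' != v ->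
    ~~ U l r -> separates T m q q' l r -> separates T' m q q' l r.
  move=> mq mq' qq qv qv' nU sep; have h := old _ _ _ _ mq mq' qq nU sep qv.
  case: sep => lm mr hl hr; split=> // z cz.
  have [zv|zv] := eqVneq z v; last by apply: hr; apply: insertion_component_old.
  have := hr _ (component_refl T m q'); have [_] := stage_support st mq'.
  by rewrite zv; ineq.
have new q : edge T' m q -> q != v -> edge T' m v -> walled U T' m q v.
  move=> mq' qv /insertion_to lm.
  have [mq nmq] := insertion_old mq' mv qv.
  have [_ bmv mmax] := lm.
  have hq a : attach a -> a != m -> a \notin component T m q.
    move=> ha am; apply/negP => ca.
    have hm : attach m by left.
    have e := component_disj acT (edge_adj mq) (attach_adj hm ha _) ca (component_refl _ _ _).
    rewrite e in ha; last by rewrite eq_sym.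
    by apply: (attach_not_adj hm ha); apply: edge_adj.
  have vq : v \notin component T' m q.
    apply/negP => /(insertion_component_new mv qv)[a [ha am ca]].
    by have := hq a ha am; rewrite ca.
  have [[y fy]|nfy] := pselect (exists y, firsta y).
    have my := attach_edge st lm fy.
    have qy : q != y by apply/eqP => e; subst q; apply: nmq.
    have yv := lt_neq (first_after_lt fy).
    case: (vaT mq my qy) => -[l [r [nU sep]]].
      exists l, r; split=> //.
      have hl := old _ _ _ _ mq my qy nU sep qv.
      case: sep => lm' mr _ hr; split=> // z cz.
      have [zv|zv] := eqVneq z v.
        by have := hr _ (component_refl T m y); have := first_after_lt fy; rewrite zv; ineq.
      have [a [ha am ca]] := insertion_component_via mv zv cz.
      apply: hr; case: ha => [la|fa]; last by rewrite (first_after_uniq fy fa).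
      by rewrite (last_before_uniq la lm) eqxx in am.
    rewrite eq_sym in qy.
    by case: (insertion_not_left my mq qy nU sep (or_intror fy) (component_refl _ _ _)).
  (* [v] becomes a leaf: a visible node beyond [m] would make the first turn
     above [m] visible, although [m] is the last visible value *)
  have allb z : vis z -> bf z v.
    move=> vz; case: (bf_or st (lt_neq (vis_lt vz))) => // bvz; case: nfy.
    exact: (first_after_exists vz bvz).
  have vm : vis m by case: lm.
  have above_inv z : z \in component T m q -> ~ vis z.
    move=> cz vz; have zm : z != m.
      by apply: component_neq cz; rewrite eq_sym; apply: (edge_neq acT mq).
    have zbm : bf z m.
      by case: (mmax _ vz (allb _ vz)) => // e; rewrite e eqxx in zm.
    case: (turn_up acT mq cz) => [|[u [w [w' [[um bu ww] uw uw' cm cz']]]]].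
      by case/(below_bf st) => [e|]; [rewrite e eqxx in zm|apply: (bf_notC st)].
    have ult : u < v by case: (stage_support st uw).
    have bmu : bf m u by case: (below_bf st bu) => // e; rewrite e eqxx in um.
    have vu : vis u.
      case: (peak_walled st uw uw' ww) => -[l [r [_ [lm' mr h1 h2]]]].
        by apply: (vis_up vm) => //; have := h1 _ cm; ineq.
      by apply: (vis_up vz) => //; have := h1 _ cz'; ineq.
    case: (mmax _ vu (allb _ vu)) => [e|]; first by rewrite e eqxx in um.
    exact: (bf_notC st).
  have qlt : q < v by case: (stage_support st mq).
  have [b [c [[qb bc cv nb [vb bk]] wall]]] :=
    invisible_wall qlt (above_inv _ (component_refl _ _ _)).
  have nUb : ~~ U b v.
    case: wall => -[wall nw].
      by apply: contra nw; apply: (stage_monoU st).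
    have [e|bc1] := eqVneq (c : nat) b.+1; first by rewrite (stage_essD st e) in nw.
    have bn : b.+1 < n by have := ltn_ord c; ineq.
    have k_in : b < Ordinal bn < c by rewrite /=; move/eqP: bc1; clear -bc; lia.
    have vk : vis (Ordinal bn) by apply: bk; rewrite /= ?ltnSn //; ineq.
    by case: (bf_notC st (allb _ vk) (wall _ k_in)).
  exists b, v; split=> //; split=> //; first exact: vb.
    move=> z cz.
    have [zv|zv] := eqVneq z v; first by case/negP: vq; rewrite zv in cz.
    have cz' := insertion_component_old mv qv zv cz.
    rewrite leqNgt; apply/negP => bz; apply: (above_inv _ cz').
    apply: bk => //; have zm : z != m.
      by apply: component_neq cz'; rewrite eq_sym; apply: (edge_neq acT mq).
    have [w wz] : exists w, adjacent T z w.
      have := cz'; rewrite componentC componentE => /connectP[[|w s]] /=.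
        by move=> _ e; exists m; rewrite -e; apply: edge_adjC.
      by case/andP => /and3P[_ _ a] _ _; exists w.
    by case/orP: wz => /(stage_support st)[].
  move=> z cz; have [-> //|zv] := eqVneq z v.
  have [a [[la|fa] am _]] := insertion_component_via mv zv cz.
    by rewrite (last_before_uniq la lm) eqxx in am.
  by case: nfy; exists a.
have [pv|pv] := eqVneq p v; have [pv'|pv'] := eqVneq p' v.
- by rewrite pv pv' eqxx in pp'.
- by right; subst p; apply: new.
- by left; subst p'; apply: new.
have [e _] := insertion_old mp mv pv; have [e' _] := insertion_old mp' mv pv'.
case: (vaT e e' pp') => -[l [r [nU sep]]]; [left|right]; exists l, r; split=> //.
  exact: olds.
by apply: olds; rewrite // eq_sym.
Qed.

End Stage.

End InsertionStage.

Section Existence.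
Variable n : nat.
Implicit Types (T : {set 'I_n * 'I_n}) (U D bf : rel 'I_n).

Lemma insertion_compatible U D bf v T : stage U D bf v T ->
  compatible U D (insertion U D bf v T).
Proof.
move=> st; split; first exact: insertion_acyclic.
  by split; [apply: insertion_valleys | apply: insertion_clear].
rewrite -insertion_opp; have st' := stage_opp st.
by split; [apply: insertion_valleys | apply: insertion_clear].
Qed.

Lemma insertion_support U D bf v T : stage U D bf v T ->
  forall x y, edge (insertion U D bf v T) x y -> x <= v /\ y <= v.
Proof.
move=> st x y /insertion_edge[[/(stage_support st)[xv yv] _]|[lx ->]|[-> fy]].
- by split; apply: ltnW.
- by split=> //; apply/ltnW/(last_before_lt lx).
- by split=> //; apply/ltnW/(first_after_lt fy).
Qed.

Lemma insertion_extension U D bf v T : stage U D bf v T ->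
  forall x y, edge (insertion U D bf v T) x y -> bf x y.
Proof.
move=> st x y /insertion_edge[[/(stage_extension st) //]|[[_ h _] -> //]|[-> fy]].
by case: (first_after_vis fy).
Qed.

Lemma insertion_connected U D bf v T : stage U D bf v T ->
  forall x y : 'I_n, x <= v -> y <= v ->
    connect (adjacent (insertion U D bf v T)) x y.
Proof.
move=> st; set T' := insertion _ _ _ _ _.
have symT' : connect_sym (adjacent T').
  by apply: sym_connect_sym => a b; apply: adjacentC.
have toT' a b : edge T a b -> connect (adjacent T') a b.
  move=> e; have [[la fb]|no] :=
      pselect (last_before U D bf v a /\ first_after U D bf v b).
    apply: (@connect_trans _ _ v); apply/connect1/edge_adj/insertion_edge.
      by constructor 2.
    by constructor 3.
  by apply/connect1/edge_adj/insertion_edge; constructor 1.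
have old (x y : 'I_n) : x < v -> y < v -> connect (adjacent T') x y.
  move=> xv yv; apply: connect_sub (stage_connected st xv yv) => a b /orP[/toT' //|].
  by rewrite symT'; apply: toT'.
have new (x : 'I_n) : x < v -> connect (adjacent T') x v.
  move=> xv.
  have pn : v.-1 < n by have := ltn_ord v; lia.
  have vp : v = (Ordinal pn).+1 :> nat by rewrite /=; lia.
  have vz := vis_pred st vp.
  have zv : Ordinal pn != v by apply: lt_neq; rewrite [in ltnRHS]vp.
  case: (bf_or st zv) => h.
    have st' := stage_opp st.
    have [|a la] := first_after_exists st' (z := Ordinal pn) _ h.
      exact/visible_opp.
    apply: connect_trans (old x a xv (first_after_lt la)) (connect1 _).
    by apply/edge_adj/insertion_edge; constructor 2.
  have [a fa] := first_after_exists st vz h.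
  apply: connect_trans (old x a xv (first_after_lt fa)) (connect1 _).
  by apply/edge_adjC/insertion_edge; constructor 3.
move=> x y; rewrite leq_eqVlt => /orP[/eqP/val_inj->|xv];
  rewrite leq_eqVlt => /orP[/eqP/val_inj->|yv].
- exact: connect0.
- by rewrite symT'; apply: new.
- exact: new.
- exact: old.
Qed.

Theorem compatible_tree_exists U D bf :
  irreflexive bf -> transitive bf -> (forall x y, x != y -> bf x y || bf y x) ->
  (forall l r l' r' : 'I_n, l' <= l -> l < r -> r <= r' -> U l' r' -> U l r) ->
  (forall l r l' r' : 'I_n, l' <= l -> l < r -> r <= r' -> D l' r' -> D l r) ->
  (forall l r : 'I_n, r = l.+1 :> nat -> U l r) ->
  (forall l r : 'I_n, r = l.+1 :> nat -> D l r) ->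
  exists T, [/\ compatible U D T, forall x y, connect (adjacent T) x y
    & forall x y, edge T x y -> bf x y].
Proof.
move=> birr btr btot mU mD eU eD.
suff: forall m, m <= n -> exists T, [/\ compatible U D T,
    forall x y, edge T x y -> x < m /\ y < m,
    forall x y : 'I_n, x < m -> y < m -> connect (adjacent T) x y
  & forall x y, edge T x y -> bf x y].
  case/(_ n (leqnn n)) => T [h1 h2 h3 h4]; exists T; split=> // x y.
  exact: h3.
elim=> [|m IH] mn.
  exists finset.set0.
  have no x y : edge (finset.set0 : {set 'I_n * 'I_n}) x y -> False.
    by rewrite /edge inE.
  have no' x y : edge (opp (finset.set0 : {set 'I_n * 'I_n})) x y -> False.
    by rewrite edge_opp => /no.
  split=> //; last by move=> x y /no.
    split; first by split=> [x y /no //|x y z /orP[] /no].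
      by split=> [x y z /no //|x y z t /no].
    by split=> [x y z /no' //|x y z t /no'].
  by move=> x y /no.
have [T [h1 h2 h3 h4]] := IH (ltnW mn).
have st : stage U D bf (Ordinal mn) T by split.
exists (insertion U D bf (Ordinal mn) T); split.
- exact: insertion_compatible.
- exact: insertion_support.
- by move=> x y xv yv; apply: (insertion_connected st).
- exact: insertion_extension.
Qed.

End Existence.

(** * Linear extensions of a compatible tree *)

Section Extensions.
Variable n : nat.
Implicit Types (s t r m : 'S_n) (a b c i j x y z k p q : 'I_n)
  (T : {set 'I_n * 'I_n}) (U D : rel 'I_n).

Definition extends T s : Prop := forall x y, edge T x y -> before s x y.

Definition connected T : Prop := forall x y, connect (adjacent T) x y.

Lemma extends_below T s x y : extends T s -> below T x y -> x = y \/ before s x y.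
Proof.
move=> ext /connectP[p]; elim: p x => [|z p IH] x /=; first by left.
case/andP=> e pp ey; right; have xz := ext _ _ e.
by case: (IH _ pp ey) => [<- //|]; apply: before_trans xz.
Qed.

Definition disagreements s t : {set 'I_n * 'I_n} :=
  [set ab | before s ab.1 ab.2 && before t ab.2 ab.1]%SET.

(** Of the pairs on which the words disagree, one that is closest in [s] consists
    of consecutive values of [s]. *)
Lemma swap_towards s t : s != t -> exists x y s',
  [/\ swapped s s' x y, before t y x & #|disagreements s' t| < #|disagreements s t|].
Proof.
move=> ne.
pose P (xy : 'I_n * 'I_n) := before s xy.1 xy.2 && before t xy.2 xy.1.
have [xy0 Pxy0] : exists xy, P xy.
  apply/existsP; apply: contraR ne; rewrite negb_exists => /forallP h.
  apply/eqP/before_inj => x y.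
  have [->|xy] := eqVneq x y; first by rewrite !before_irr.
  have := h (x, y); have := h (y, x); rewrite /P /= !(beforeNC _ xy).
  by case: (before s x y); case: (before t x y).
pose d (xy : 'I_n * 'I_n) := ((s^-1)%g xy.2 - (s^-1)%g xy.1)%N.
case: (arg_minnP d Pxy0) => -[x y] /andP[/= sxy tyx] dmin.
have no k : before s x k -> ~~ before s k y.
  move=> sxk; apply/negP => sky.
  have xk : x != k by apply: contraTneq sxk => ->; rewrite before_irr.
  case: (before_or t xk) => h.
    have Pk : P (k, y) by rewrite /P /= sky (before_trans tyx h).
    by have := dmin _ Pk; move: sxk sky; rewrite /d /before /=; ineq.
  have Pk : P (x, k) by rewrite /P /= sxk h.
  by have := dmin _ Pk; move: sxk sky; rewrite /d /before /=; ineq.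
have [s' sw] := swap_exists sxy no.
exists x, y, s'; split=> //; apply: proper_card; apply/properP; split.
  apply/fintype.subsetP => -[a b]; rewrite !inE /= => /andP[h tba]; rewrite tba andbT.
  have [/andP[/eqP ay /eqP bx]|n2] := boolP ((a == y) && (b == x)).
    by subst; case: (before_notC tyx tba).
  rewrite -(swapped_other sw) //; apply/negP => /andP[/eqP ax /eqP by_]; subst.
  by rewrite (swapped_xy sw) in h.
exists (x, y); rewrite !inE /= ?sxy ?tyx //.
by rewrite (swapped_xy sw).
Qed.

(** The wall of a turn, seen from the two ends of the walk. *)
Lemma valley_gap U D T (m : 'I_n) q q' x y : compatible U D T -> connected T ->
  edge T m q -> edge T m q' -> q != q' ->
  x \in component T m q -> y \in component T m q' ->
  exists b c, [/\ minn x y <= b, b < c, c <= maxn x y, ~~ U b c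
    & forall k, b < k < c -> below T k m].
Proof.
move=> gT cT mq mq' qq xq yq.
case: (gT) => _ [va _] _.
case: (va m q q' mq mq' qq) => -[l [r [nU sep]]]; exists l, r; split=> //;
  case: (sep) => lm mr hl hr; try by ineq.
- by have := hl _ xq; ineq.
- by have := hr _ yq; ineq.
- by move=> k lkr; apply: (gap_below gT mq mq' qq sep lkr).
- by have := hl _ yq; ineq.
- by have := hr _ xq; ineq.
by rewrite eq_sym in qq => k lkr; apply: (gap_below gT mq' mq qq sep lkr).
Qed.

Lemma peak_gap U D T (m : 'I_n) q q' x y : compatible U D T -> connected T ->
  edge T q m -> edge T q' m -> q != q' ->
  x \in component T m q -> y \in component T m q' ->
  exists b c, [/\ minn x y <= b, b < c, c <= maxn x y, ~~ D b c
    & forall k, b < k < c -> below T m k].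
Proof.
move=> gT cT mq mq' qq xq yq.
have cT' : connected (opp T).
  by move=> a b; rewrite (eq_connect (@adjacent_opp n T)); apply: cT.
have := @valley_gap D U (opp T) m q q' x y (compatible_opp gT) cT'.
rewrite !edge_opp !component_opp => /(_ mq mq' qq xq yq)[b [c [h1 h2 h3 h4 h5]]].
by exists b, c; split=> // k /h5; rewrite below_opp.
Qed.

Definition height T k := #|[set z | below T z k]|.

Lemma height_lt T x y : acyclic T -> edge T x y -> height T x < height T y.
Proof.
move=> acT xy; apply: proper_card; apply/properP; split.
  apply/fintype.subsetP => z; rewrite !inE => zx.
  exact: below_trans zx (edge_below xy).
exists y; rewrite !inE ?below_refl //.
by apply/negP => yx; apply: (edge_below_no acT xy yx).
Qed.

Section Class.
Variables (U D : rel 'I_n) (T : {set 'I_n * 'I_n}).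
Hypotheses (gT : compatible U D T) (cT : connected T).

Let acT : acyclic T. Proof. by case: gT. Qed.

Lemma extends_swapped s t x y : extends T s -> swapped s t x y ->
  ~ edge T x y -> extends T t.
Proof.
move=> ext sw nxy a b e; rewrite (swapped_other sw); first exact: ext.
  by apply/negP => /andP[/eqP ax /eqP by_]; subst.
apply/negP => /andP[/eqP ay /eqP bx]; subst.
by case: sw => _ sxy _; apply: before_notC sxy (ext _ _ e).
Qed.

(** A value inside the wall is comparable with the edge, so that its place in the
    word tells in which part of the mandatory arc it is. *)
Lemma edge_not_crosses s x y : extends T s -> edge T x y -> ~ crosses U D s x y.
Proof.
move=> ext xy [b [c [h1 h2 h3 h4]]].
have sxy := ext _ _ xy.
have comp k : b < k < c -> below T k y \/ below T x k.
  by move=> bkc; apply: (edge_comparable gT xy _ (cT _ _)); ineq.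
case: h4 => -[h4 /negP]; apply.
  case: gT => _ [_ clear] _; apply: (clear _ _ _ _ xy) => // k bkc.
  have [kx _] := h4 _ bkc.
  case: (comp _ bkc) => // /(extends_below ext)[e|xk]; last by case: (before_notC kx xk).
  by subst k; rewrite before_irr in kx.
case: gT => _ _ [_ clear].
apply: (clear y x); rewrite ?edge_opp ?[minn y x]minnC ?[maxn y x]maxnC //.
move=> k bkc; rewrite below_opp; have [_ yk] := h4 _ bkc.
case: (comp _ bkc) => // /(extends_below ext)[e|ky]; last by case: (before_notC ky yk).
by subst k; rewrite before_irr in yk.
Qed.

Lemma extends_crosses s t x y : extends T s -> swapped s t x y ->
  crosses U D s x y -> extends T t.
Proof.
by move=> ext sw cr; apply: (extends_swapped ext sw) => xy; apply: edge_not_crosses cr.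
Qed.

(** Consecutive values that are not joined by an edge are separated by the wall
    at the first turn of the walk from one to the other. *)
Lemma swapped_crosses s t x y : extends T s -> swapped s t x y -> extends T t ->
  crosses U D s x y.
Proof.
move=> ext sw ext'.
have [xy sxy _] := sw.
have yx : y != x by rewrite eq_sym.
have nle : ~ below T x y.
  case/(extends_below ext') => [e|]; first by rewrite e eqxx in xy.
  by rewrite (swapped_xy sw).
have nge : ~ below T y x.
  case/(extends_below ext) => [e|h]; first by rewrite e eqxx in xy.
  exact: before_notC sxy h.
have [w aw yw] := component_cover (cT x y) yx.
have far b c k : minn x y <= b -> c <= maxn x y -> b < k < c -> k != x /\ k != y.
  by move=> h1 h2 h3; rewrite -!val_eqE /=; split; ineq.
have [xw|nxw] := boolP (edge T x w).
  case: (turn_up acT xw yw) => [//|[m [q [q' [[mx bm qq] mq mq' cx cy]]]]].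
  have [b [c [h1 h2 h3 nD gap]]] := peak_gap gT cT mq mq' qq cx cy.
  exists b, c; split=> //; right; split=> // k bkc.
  have [kx ky] := far _ _ _ h1 h3 bkc.
  have sxk : before s x k.
    case: (extends_below ext (below_trans bm (gap _ bkc))) => // e.
    by rewrite e eqxx in kx.
  by split=> //; rewrite (beforeNC s ky) -(swapped_side sw kx ky) -(beforeNC s kx).
have wx : edge T w x by move: aw; rewrite /adjacent (negbTE nxw).
case: (turn_down acT wx yw) => [//|[m [q [q' [[mx bm qq] mq mq' cx cy]]]]].
have [b [c [h1 h2 h3 nU gap]]] := valley_gap gT cT mq mq' qq cx cy.
exists b, c; split=> //; left; split=> // k bkc.
have [kx ky] := far _ _ _ h1 h3 bkc.
have skx : before s k x.
  case: (extends_below ext (below_trans (gap _ bkc) bm)) => // e.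
  by rewrite e eqxx in kx.
by split=> //; rewrite -(swapped_side sw kx ky).
Qed.

(** Postpone [i], then [j], then the other nodes above [i].  The tree allows it, as
    no node lies strictly between the ends of an edge, and this makes [i] and [j]
    consecutive. *)
Lemma extends_edge i j : edge T i j ->
  exists s t, [/\ extends T s, swapped s t i j & ~ extends T t].
Proof.
move=> ij.
have ni : j != i by rewrite eq_sym; apply: (edge_neq acT ij).
pose f := height T.
have f_lt x y : edge T x y -> f x < f y by apply: height_lt.
have fn k : f k <= n by rewrite -[leqRHS]card_ord max_card.
pose g k := if k == i then 1 else if k == j then 2 else if below T i k then 3 else 0.
have g_le x y : edge T x y -> g x <= g y.
  move=> xy; rewrite /g.
  have [xi|xi] := eqVneq x i.
    subst x; have [yi|yi] := eqVneq y i; first by [].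
    by case: ifP => // _; rewrite (edge_below xy).
  have [xj|xj] := eqVneq x j.
    subst x; have [yi|yi] := eqVneq y i.
      by subst y; case: (edge_notC acT ij xy).
    have [yj|yj] := eqVneq y j; first by [].
    by rewrite (below_trans (edge_below ij) (edge_below xy)).
  case: ifP => // ix.
  have [yi|yi] := eqVneq y i.
    by subst y; case: (edge_below_no acT xy ix).
  have [yj|yj] := eqVneq y j.
    subst y; case: (edge_no_between acT ij ix (edge_below xy)) => e.
      by rewrite e eqxx in xi.
    by rewrite e eqxx in xj.
  by rewrite (below_trans ix (edge_below xy)).
pose h k := g k * n.+1 + f k.
have [s hs] := perm_of_key (@lex_key_inj n h).
have h_before x y : h x < h y -> before s x y.
  by move=> xy; rewrite hs lex_key xy.
have h_lt x y : g x < g y -> h x < h y.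
  move=> xy; rewrite /h; have := leq_mul2r n.+1 (g x).+1 (g y).
  by rewrite xy orbT mulSn; have := fn x; lia.
have h_le x y : before s x y -> g x <= g y.
  move=> xy; rewrite leqNgt; apply/negP => /h_lt/h_before; exact: before_notC.
have ext : extends T s.
  move=> x y xy; apply: h_before; rewrite /h.
  by have := f_lt _ _ xy; have := leq_mul (g_le _ _ xy) (leqnn n.+1); lia.
have gi : g i = 1 by rewrite /g eqxx.
have gj : g j = 2 by rewrite /g eqxx (negbTE ni).
have sij := ext _ _ ij.
have [t sw] : exists t, swapped s t i j.
  apply: swap_exists => // k ik; apply/negP => kj.
  have := h_le _ _ ik; have := h_le _ _ kj; rewrite gi gj /g.
  have ki : k != i by apply: contraTneq ik => ->; rewrite before_irr.
  have kj' : k != j by apply: contraTneq kj => ->; rewrite before_irr.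
  by rewrite (negbTE ki) (negbTE kj'); case: ifP.
exists s, t; split=> // /(_ _ _ ij); by rewrite (swapped_xy sw).
Qed.

End Class.

(** By [extends_edge], the edges are the pairs whose exchange, in some linear
    extension where they are consecutive, is not a linear extension. *)
Lemma extends_inj U D T T' : compatible U D T -> compatible U D T' ->
  (forall s, extends T s <-> extends T' s) -> T = T'.
Proof.
have sub T1 T2 : compatible U D T1 -> (forall s, extends T1 s <-> extends T2 s) ->
    forall i j, edge T1 i j -> edge T2 i j.
  move=> g1 h i j ij; have [s [t [es sw nt]]] := extends_edge g1 ij.
  apply/negPn/negP => nij; apply: nt; apply/h.
  by apply: (extends_swapped _ sw); [apply/h|apply/negP].
move=> g g' h; apply/setP => -[i j]; apply/idP/idP; first exact: (sub T T').
by apply: (sub T' T) => // s; split=> /h.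
Qed.

(** Two linear extensions are linked by exchanges of consecutive values through
    linear extensions, none of which leaves the class.  Two members of a class
    are linked through their meet by exchanges within the class, none of which
    leaves the linear extensions. *)
Theorem extends_class (e : rel 'S_n) T s t : lattice_congruence e ->
  simple_congruence e -> compatible (up_kept e) (down_kept e) T -> connected T ->
  extends T s -> e s t <-> extends T t.
Proof.
move=> he hs gT cT ext; split; last first.
  elim: (#|disagreements s t|).+1 {-2}s (ltnSn #|disagreements s t|) ext => //.
  move=> N IH u uN ext_u ext_t.
  have [->|ut] := eqVneq u t; first exact: cong_refl.
  have [x [y [u' [sw tyx dlt]]]] := swap_towards ut.
  have ext_u' : extends T u'.
    apply: (extends_swapped ext_u sw) => xy.
    exact: before_notC tyx (ext_t _ _ xy).
  apply: (cong_trans he (t := u')).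
    by apply/(cong_crosses he hs sw); apply: (swapped_crosses gT cT ext_u sw).
  by apply: IH => //; apply: leq_trans dlt _.
have step u v x y : e u v -> swapped u v x y -> extends T u -> extends T v.
  move=> uv sw ext_u; apply: (extends_crosses gT cT ext_u sw).
  by apply/(cong_crosses he hs sw).
move=> st; have [m hm] := meet_exists s t; have [ms mt _] := hm.
have em : e s m.
  apply: (cong_meet he (s := s) (t := t) (r := s)) => //; last exact: is_meetC.
  exact/meet_le/weak_le_refl.
have up u v : weak_le u v -> e u v -> (extends T u <-> extends T v).
  elim: (#|disagreements u v|).+1 {-2}u (ltnSn #|disagreements u v|) => // N IH w wN wv ewv.
  have [->|ne] := eqVneq w v; first by [].
  have [x [y [w' [sw vyx dlt]]]] := swap_towards ne.
  have [xy|yx] : x < y \/ y < x.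
  - by case: sw; rewrite -val_eqE /=; lia.
  - have ww' : weak_le w w' := swapped_le xy sw.
    have w'v : weak_le w' v.
      apply/weak_leP => a b ba h.
      have [/andP[/eqP-> /eqP->] //|n2] := boolP ((a == y) && (b == x)).
      move/weak_leP: wv; apply=> //; rewrite -(swapped_other sw) //.
      by apply/negP => /andP[/eqP ax /eqP by_]; subst; ineq.
    have eww' : e w w' by exact: (cong_convex he ww' w'v ewv).
    have ew'v : e w' v by apply: (cong_trans he _ ewv); rewrite (cong_sym he).
    have ew'w : e w' w by rewrite cong_sym.
    rewrite -(IH w') //; last by apply: leq_trans dlt _.
    by split; apply: step; [exact: eww'|exact: sw|exact: ew'w|exact: swapped_sym sw].
  - case: sw => _ wxy _; move/weak_leP: wv => /(_ _ _ yx wxy) h.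
    by case: (before_notC vyx h).
have ems : e m s by rewrite cong_sym.
have emt : e m t by apply: (cong_trans he ems).
by apply/(up _ _ mt emt)/(up _ _ ms ems).
Qed.

End Extensions.

(** * Admissible trees are the compatible trees *)

Section Admissible.
Variables (n : nat) (e : rel 'S_n).
Hypotheses (he : lattice_congruence e) (hs : simple_congruence e).
Implicit Types (T : {set 'I_n * 'I_n}) (L R S : {set 'I_n}) (b c i j l r m p x y k : 'I_n).
Local Notation U := (up_kept e).
Local Notation D := (down_kept e).

Lemma path_avoiding_notin T m k s : k != m -> path (avoiding T m) k s -> m \notin k :: s.
Proof.
elim: s k => [|z s IH] k km /=; first by rewrite inE eq_sym km.
case/andP=> /and3P[_ zm _] /(IH _ zm); rewrite !inE (eq_sym m k) (negbTE km) //.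
Qed.

(** Two neighbours of [m] linked by a path that avoids [m] close a cycle. *)
Lemma directed_tree_acyclic T : directed_tree T -> acyclic T.
Proof.
case=> anti _ nocyc; split=> // m k k' mk mk' kk'.
apply/eqP/negPn/negP => ne.
have km : k != m by rewrite eq_sym; apply: (adj_neq anti mk).
move: kk'; rewrite componentE => /connectP[s0 /shortenP[s ps us _] ek].
have ms := path_avoiding_notin km ps.
apply: (nocyc (m :: k :: s)).
  by case: s ek {ps us ms} => [|z s] //= ek; rewrite ek eqxx in ne.
apply/andP; split; last by rewrite cons_uniq ms us.
rewrite /= rcons_path mk -ek adjacentC mk' andbT /=.
by apply: sub_path ps => a b /and3P[].
Qed.

Lemma acyclic_no_cycle T : acyclic T ->
  forall s : seq 'I_n, 2 < size s -> ~ ucycle (adjacent T) s.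
Proof.
case=> anti ac [|m [|k [|z s]]] // _ /andP[/= /and3P[mk kz]].
rewrite rcons_path => /andP[pz lm] /and3P[].
rewrite !inE !negb_or => /and3P[mk' mz ms] /andP[kz' ks] /andP[zs us].
have lk : last z s \in component T m k.
  rewrite componentE; apply/connectP; exists (z :: s) => //=.
  rewrite /avoiding kz eq_sym mk' eq_sym mz /=.
  elim: s z pz mz ms {kz kz' ks zs us lm} => //= u s IH z /andP[zu pu] mz.
  rewrite inE negb_or => /andP[mu ms]; rewrite IH // andbT.
  by rewrite eq_sym mz eq_sym mu.
have := ac _ _ _ mk _ lk; rewrite adjacentC => /(_ lm) e1.
by move: (mem_last z s); rewrite e1 inE (negbTE kz') (negbTE ks).
Qed.

Lemma max_exists S x : x \in S -> exists l, is_max S l.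
Proof.
move=> xS; case: (arg_maxnP (fun k : 'I_n => k : nat) xS) => l lS lmax.
by exists l.
Qed.

Lemma min_exists S x : x \in S -> exists l, is_min S l.
Proof.
move=> xS; case: (arg_minnP (fun k : 'I_n => k : nat) xS) => l lS lmin.
by exists l.
Qed.

Lemma subarc_kept a a' : is_arc a -> subarc a a' -> a' \in arcs_of e -> a \in arcs_of e.
Proof.
case: a => [[[i j] A] B]; case: a' => [[[i' j'] A'] B'] arc /and5P[ii ij jj AA BB] h.
have arc' : is_arc (i', j', A', B') by move: h; rewrite inE => /andP[].
move: h; rewrite !arcs_ofE //; apply: contra => h; apply: (contracted_mono he ii ij jj).
move: h; rewrite (@contracted_eq _ _ _ _ A A') // => k ikj.
apply/idP/idP => [|kA']; first exact: (fintype.subsetP AA).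
case/and3P: arc => _ /eqP AB _; case/and3P: arc' => _ _ /pred0P d.
have : k \in A :|: B by rewrite AB inE.
rewrite inE => /orP[//|/(fintype.subsetP BB) kB'].
by have := d k; rewrite /= kA' kB'.
Qed.

(** [W] stands for the kept up arcs, or for the kept down arcs in the opposite
    tree. *)
Lemma valleys_of_separated (W : rel 'I_n) T j : acyclic T -> (#|parents T j| <= 2)%N ->
  (#|parents T j| = 2 -> separated_by j (ancestor_subtrees T j)) ->
  (forall L R l r, L \in ancestor_subtrees T j -> R \in ancestor_subtrees T j ->
     set_lt L R -> is_max L l -> is_min R r -> ~~ W l r) ->
  forall p p', edge T j p -> edge T j p' -> p != p' ->
    walled W T j p p' \/ walled W T j p' p.
Proof.
move=> acT le2 sep forb p p' jp jp' pp'.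
have [L [R [SE hL hR]]] : separated_by j (ancestor_subtrees T j).
  apply: sep; apply/eqP; rewrite eqn_leq le2 /=.
  have : #|[set p; p']| <= #|parents T j|.
    by apply/subset_leq_card/fintype.subsetP => k; rewrite !inE => /orP[]/eqP->.
  by rewrite cards2 pp'.
have memS k : edge T j k -> component T j k \in [set L; R]%SET.
  by move=> jk; rewrite -SE; apply: imset_f; rewrite inE.
have key q q' : edge T j q -> edge T j q' -> component T j q = L ->
    component T j q' = R -> walled W T j q q'.
  move=> jq jq' eL eR.
  have qL : q \in L by rewrite -eL component_refl.
  have qR : q' \in R by rewrite -eR component_refl.
  have [l [lL lmax]] := max_exists qL; have [r [rR rmin]] := min_exists qR.
  exists l, r; split; last first.
    by split; [apply: hL|apply: hR|rewrite eL|rewrite eR].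
  apply: (forb L R l r) => //.
  - by rewrite -eL; apply: imset_f; rewrite inE.
  - by rewrite -eR; apply: imset_f; rewrite inE.
  by move=> x y /hL xj /hR; apply: ltn_trans.
have ne : component T j p != component T j p'.
  apply: contra pp' => /eqP E; apply/eqP.
  apply: (component_disj acT (edge_adj jp') (edge_adj jp) (component_refl _ _ _)).
  by rewrite E component_refl.
have := memS _ jp; have := memS _ jp'; rewrite !inE => /orP[]/eqP e1 /orP[]/eqP e2.
- by rewrite e1 e2 eqxx in ne.
- by right; apply: key.
- by left; apply: key.
- by rewrite e1 e2 eqxx in ne.
Qed.

Lemma separated_of_valleys (W : rel 'I_n) T j : valleys_walled W T ->
  (#|parents T j| <= 2)%N /\
  (#|parents T j| = 2 -> separated_by j (ancestor_subtrees T j)).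
Proof.
move=> va; split.
  rewrite leqNgt; apply/negP => /card_gt2P[p [q [w]]] [[]].
  rewrite !inE => jp jq jw [pq qw wp].
  have third a b c' : edge T j a -> edge T j b -> edge T j c' -> a != b -> b != c' -> c' != a ->
      walled W T j a b -> False.
    move=> ja jb jc ab bc ca [l [r [_ [lj jr hl hr]]]].
    have al := hl _ (component_refl T j a); have rb := hr _ (component_refl T j b).
    case: (va j b c' jb jc bc) => -[l1 [r1 [_ [lj1 jr1 h1 h2]]]].
      by have := h1 _ (component_refl T j b); ineq.
    case: (va j c' a jc ja ca) => -[l2 [r2 [_ [lj2 jr2 h3 h4]]]].
      by have := h4 _ (component_refl T j a); ineq.
    have := h4 _ (component_refl T j c'); have := h1 _ (component_refl T j c'); ineq.
  case: (va j p q jp jq pq) => h; first exact: (third p q w).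
  by apply: (third q p w) => //; rewrite eq_sym.
move/eqP/cards2P => [p [q [pq E]]].
have jp : edge T j p.
  have : p \in parents T j by rewrite E !inE eqxx.
  by rewrite inE.
have jq : edge T j q.
  have : q \in parents T j by rewrite E !inE eqxx orbT.
  by rewrite inE.
have SE : ancestor_subtrees T j = [set component T j p; component T j q]%SET.
  by rewrite /ancestor_subtrees E imsetU1 imset_set1.
case: (va j p q jp jq pq) => -[l [r [_ [lj jr hl hr]]]].
  exists (component T j p), (component T j q); split=> // x.
    by move/hl; ineq.
  by move/hr; ineq.
exists (component T j q), (component T j p); split; first by rewrite finset.setUC.
  by move=> x /hl; ineq.
by move=> x /hr; ineq.
Qed.

Lemma forbidden_of_valleys (W : rel 'I_n) T j L R l r : valleys_walled W T ->
  (forall a b a' b' : 'I_n, a' <= a -> a < b -> b <= b' -> W a' b' -> W a b) ->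
  L \in ancestor_subtrees T j -> R \in ancestor_subtrees T j ->
  set_lt L R -> is_max L l -> is_min R r -> ~~ W l r.
Proof.
move=> va mono /imsetP[p jp eL] /imsetP[q jq eR] lr [lL lmax] [rR rmin].
rewrite !inE in jp jq.
have pL : p \in L by rewrite eL component_refl.
have qR : q \in R by rewrite eR component_refl.
have pq : p != q by apply/eqP => E; have := lr _ _ pL qR; rewrite E ltnn.
case: (va j p q jp jq pq) => -[l1 [r1 [nU [lj jr h1 h2]]]].
  apply: contra nU => h; apply: (mono _ _ _ _ _ _ _ h).
  - by apply: h1; rewrite -eL.
  - by apply: (ltn_trans lj jr).
  - by apply: h2; rewrite -eR.
have : p < q by apply: lr.
have := h1 q (component_refl _ _ _); have := h2 p (component_refl _ _ _); ineq.
Qed.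

Lemma parents_opp T j : parents (opp T) j = children T j.
Proof. by apply/setP => k; rewrite !inE edge_opp. Qed.

Lemma ancestor_opp T j : ancestor_subtrees (opp T) j = descendant_subtrees T j.
Proof.
rewrite /ancestor_subtrees parents_opp /descendant_subtrees.
by apply: eq_imset => k; rewrite component_opp.
Qed.

(** The mandatory arcs are arcs by [edge_comparable], and they belong to the
    congruence once they contain no missing up or down arc by
    [contracted_wall]. *)
Lemma admissibleE T :
  admissible e T <-> compatible U D T /\ connected T.
Proof.
have arcs b c : b < c ->
    is_arc (b, c, between b c, finset.set0) /\ is_arc (b, c, finset.set0, between b c).
  move=> bc; split; apply/and3P; split=> //.
  - by rewrite finset.setU0.
  - by rewrite -setI_eq0 finset.setI0.
  - by rewrite finset.set0U.
  - by rewrite -setI_eq0 finset.set0I.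
split.
  case=> -[dT sep] mand fu fd; have acT := directed_tree_acyclic dT.
  have cT : connected T by case: dT.
  split=> //.
  have mandE x y b c : edge T x y -> minn x y <= b -> b < c -> c <= maxn x y ->
      ((forall k, b < k < c -> below T k y) -> U b c) /\
      ((forall k, b < k < c -> below T x k) -> D b c).
    move=> xy xb bc cy.
    have xy' : x != y by apply: (edge_neq acT).
    have [i [k [ik axy ikE below_i above_i]]] : exists i k, [/\ i < k, adjacent T i k,
        (i = minn x y :> nat) /\ (k = maxn x y :> nat),
        forall z, below T z y -> connect (edge T) z i || connect (edge T) z k
      & forall z, below T x z -> connect (edge T) i z || connect (edge T) k z].
      have [lt|lt] : x < y \/ y < x by move: xy'; rewrite -val_eqE /=; lia.
        exists x, y; split=> //; first exact: edge_adj.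
        - by split; apply/esym; [apply/minn_idPl/ltnW|apply/maxn_idPr/ltnW].
        - by move=> z zy; apply/orP; right.
        by move=> z zx; apply/orP; left.
      exists y, x; split=> //; first exact: edge_adjC.
      - by split; apply/esym; [apply/minn_idPr/ltnW|apply/maxn_idPl/ltnW].
      - by move=> z zy; apply/orP; left.
      by move=> z zx; apply/orP; right.
    case: ikE => iE kE; rewrite -iE in xb; rewrite -kE in cy.
    have {mand} mand := mand _ (ex_intro _ i (ex_intro _ k (And3 ik axy erefl))).
    have [arcu arcd] := arcs b c bc.
    split=> h.
      apply: (subarc_kept arcu _ mand).
      apply/and5P; split=> //; last exact: finset.sub0set.
      apply/fintype.subsetP => z; rewrite !inE => bzc; rewrite below_i ?h // andbT; ineq.
    apply: (subarc_kept arcd _ mand).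
    apply/and5P; split=> //; first exact: finset.sub0set.
    apply/fintype.subsetP => z; rewrite !inE => bzc; rewrite above_i ?h // andbT; ineq.
  split=> //; split.
  - move=> j; case: (sep j) => c1 _ s1 _; apply: valleys_of_separated => // L R l r hL hR lr ml mr.
    by apply: fu; exists j, L, R, l, r.
  - move=> x y b c xy h1 h2 h3 h4; exact: (mandE x y b c xy h1 h2 h3).1.
  - move=> j; case: (sep j) => _ c1 _ s1.
    apply: valleys_of_separated; rewrite ?parents_opp ?ancestor_opp //; first exact: acyclic_opp.
    move=> L R l r hL hR lr ml mr.
    by apply: fd; exists j, L, R, l, r.
  - move=> x y b c; rewrite edge_opp => xy h1 h2 h3 h4.
    apply: (mandE y x b c xy _ h2 _).2; [by rewrite minnC|by rewrite maxnC|].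
    by move=> k /h4; rewrite below_opp.
case=> gT cT; have [acT [va clu] [pe cld]] := gT.
have anti : antisym T by case: acT.
have pe' : valleys_walled D (opp T) by [].
split.
- split; first by split=> //; apply: acyclic_no_cycle.
  move=> j; have [h1 h2] := separated_of_valleys j va.
  have [h3 h4] := separated_of_valleys j pe'.
  by rewrite parents_opp ancestor_opp in h3 h4; split.
- move=> a [i [k [ik aik ->]]].
  have [x [y [xy [ix ky] bel abv]]] : exists x y, [/\ edge T x y,
      (i = minn x y :> nat) /\ (k = maxn x y :> nat),
      forall z, connect (edge T) z i || connect (edge T) z k = below T z y
    & forall z, connect (edge T) i z || connect (edge T) k z = below T x z].
    case/orP: aik => ed.
      exists i, k; split=> //.
      - by split; apply/esym; [apply/minn_idPl/ltnW|apply/maxn_idPr/ltnW].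
      - move=> z; apply/orP/idP => [[h|//]|h]; last by right.
        exact: below_trans h (edge_below ed).
      - move=> z; apply/orP/idP => [[//|h]|h]; last by left.
        exact: below_trans (edge_below ed) h.
    exists k, i; split=> //.
    - by split; apply/esym; [apply/minn_idPr/ltnW|apply/maxn_idPl/ltnW].
    - move=> z; apply/orP/idP => [[//|h]|h]; last by left.
      exact: below_trans h (edge_below ed).
    - move=> z; apply/orP/idP => [[h|//]|h]; last by right.
      exact: below_trans (edge_below ed) h.
  set A := [set j in between i k | _]%SET; set B := [set j in between i k | _]%SET.
  have arc : is_arc (i, k, A, B).
    apply/and3P; split=> //.
      apply/eqP/setP => z; rewrite !inE bel abv -andb_orr.
      have [ikz|//] := boolP (i < z < k).
      have xyz : minn x y < z < maxn x y by rewrite -ix -ky.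
      by case: (edge_comparable gT xy xyz (cT _ _)) => ->; rewrite ?orbT.
    rewrite -setI_eq0; apply/eqP/setP => z; rewrite !inE bel abv.
    apply/negP => /andP[/andP[ikz zy] /andP[_ xz]].
    by case: (edge_no_between acT xy xz zy) => E; subst z; ineq.
  rewrite (arcs_ofE he) //; apply/negP => /(contracted_wall he hs ik)[b [c [h1 h2 h3]]].
  case=> -[h4 /negP]; apply.
    apply: (clu x y) => //; rewrite -?ix -?ky //.
    by move=> z /h4; rewrite !inE bel => /andP[].
  apply: (cld y x); rewrite ?edge_opp // 1?minnC 1?maxnC -?ix -?ky //.
  move=> z bzc; rewrite below_opp; have := h4 _ bzc; rewrite !inE bel.
  have ikz : i < z < k by ineq.
  have xyz : minn x y < z < maxn x y by rewrite -ix -ky.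
  by case: (edge_comparable gT xy xyz (cT _ _)) => // ->; rewrite ikz.
- move=> a [j [L [R [l [r [hL hR lr [ml mr ->]]]]]]].
  apply: (forbidden_of_valleys (W := U) va) hL hR lr ml mr; exact: up_kept_mono.
move=> a [j [L [R [l [r [hL hR lr [ml mr ->]]]]]]].
rewrite -ancestor_opp in hL hR.
apply: (forbidden_of_valleys (W := D) pe') hL hR lr ml mr; exact: down_kept_mono.
Qed.

End Admissible.

(** * Classes and admissible trees *)

Section ClassTrees.
Variables (n : nat) (e : rel 'S_n).
Hypotheses (he : lattice_congruence e) (hs : simple_congruence e)
  (hess : essential e).
Implicit Types (T : {set 'I_n * 'I_n}) (s t : 'S_n).

Lemma admissible_tree_exists s : exists2 T, admissible e T & extends T s.
Proof.
have sh (l r : 'I_n) : r = l.+1 :> nat -> between l r = finset.set0.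
  by move=> lr; apply/setP => k; rewrite !inE; apply/negP; ineq.
have [|||||||T [gT cT ext]] := @compatible_tree_exists n (up_kept e) (down_kept e) (before s).
- exact: before_irr.
- exact: before_trans.
- exact: before_total.
- exact: up_kept_mono.
- exact: down_kept_mono.
- by move=> l r lr; rewrite /up_kept /up_arc sh //; apply: hess.
- by move=> l r lr; rewrite /down_kept /down_arc sh //; apply: hess.
by exists T => //; apply/admissibleE.
Qed.

Lemma admissible_extension T : admissible e T -> exists s, extends T s.
Proof.
move=> /(admissibleE he hs)[[acT _ _] _].
have [s h] := perm_of_key (@lex_key_inj n (height T)).
by exists s => x y xy; rewrite h lex_key height_lt.
Qed.

Lemma admissible_class T s t : admissible e T -> extends T s ->
  e s t <-> extends T t.
Proof. by move=> /(admissibleE he hs)[gT cT]; apply: extends_class. Qed.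

Lemma admissible_inj T T' s : admissible e T -> admissible e T' ->
  extends T s -> extends T' s -> T = T'.
Proof.
move=> aT aT' ext ext'.
have [gT _] := (admissibleE he hs T).1 aT.
have [gT' _] := (admissibleE he hs T').1 aT'.
apply: (extends_inj gT gT') => t.
by rewrite -(admissible_class t aT ext) -(admissible_class t aT' ext').
Qed.

End ClassTrees.

(** * Maximal cones and vertices *)

Section Geometry.
Import GRing.Theory Num.Theory Order.TTheory.
Local Open Scope classical_set_scope.
Local Open Scope ring_scope.
Variables (R : realType) (n : nat).
Local Notation vec := 'rV[R]_n.
Implicit Types (x y c v : vec) (K F P : set vec) (s t : 'S_n).

Lemma dotDr c x y : dot c (x + y) = dot c x + dot c y.
Proof. by rewrite /dot -big_split; apply: eq_bigr => i _; rewrite mxE mulrDr. Qed.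

Lemma dotZr c a x : dot c (a *: x) = a * dot c x.
Proof. by rewrite /dot mulr_sumr; apply: eq_bigr => i _; rewrite mxE mulrCA. Qed.

Lemma dot0l x : dot 0 x = 0.
Proof. by rewrite /dot big1 // => i _; rewrite mxE mul0r. Qed.

Lemma dotBr c x y : dot c (x - y) = dot c x - dot c y.
Proof. by rewrite dotDr -scaleN1r dotZr mulN1r. Qed.

Lemma dot_sumr c k (f : 'I_k -> vec) : dot c (\sum_i f i) = \sum_i dot c (f i).
Proof.
apply: (big_morph (dot c)) => [x y|]; first exact: dotDr.
by rewrite /dot big1 // => i _; rewrite mxE mulr0.
Qed.

(** ** Maximal cones *)

Section Cones.
Variable e : rel 'S_n.
Hypothesis he : lattice_congruence e.

(** A point with distinct coordinates lies in the cone of one permutation only. *)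
Lemma class_cone_sub s t : class_cone e s `<=` @class_cone R n e t -> e s t.
Proof.
move=> st; pose x : vec := \row_k ((s^-1)%g k)%:R.
have [|u tu xu] := st x.
  by exists s; [apply: cong_refl|move=> p q pq; rewrite !mxE !permK ler_nat].
suff -> : s = u by rewrite cong_sym.
apply: before_inj => a b.
have sub a' b' : before u a' b' -> before s a' b'.
  move=> h; have := xu _ _ (ltnW h); rewrite !mxE !permKV ler_nat /before.
  rewrite leq_eqVlt => /orP[/eqP/val_inj/perm_inj E|//].
  by rewrite E before_irr in h.
have [->|ab] := eqVneq a b; first by rewrite !before_irr.
apply/idP/idP; last exact: sub.
by rewrite !(beforeNC _ (x := b)) 1?eq_sym //; apply: contra; apply: sub.
Qed.

Lemma class_cone_eq s t : e s t -> class_cone e s = @class_cone R n e t.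
Proof.
move=> st; apply/seteqP; split=> x [u su xu]; exists u => //.
  by apply: (cong_trans he _ su); rewrite cong_sym.
exact: (cong_trans he st su).
Qed.

Lemma cone_face_refl K : cone_face K K.
Proof.
exists 0; split=> [x _|]; first by rewrite dot0l.
by apply/seteqP; split=> [x Kx|x []//]; split=> //=; rewrite dot0l.
Qed.

(** Every cone of the fan lies in a class cone, and class cones are pairwise
    incomparable by [class_cone_sub]. *)
Lemma maximal_conesE K :
  maximal_cones (@quotient_fan R n e) K <-> exists s, K = class_cone e s.
Proof.
split=> [[[s Ks] Kmax]|[s ->]].
  exists s; symmetry; apply: Kmax; first by exists s; apply: cone_face_refl.
  by case: Ks => c [_ ->] x [].
split; first by exists s; apply: cone_face_refl.
move=> K' [t [c [_ K'E]]] sK'.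
have K't : K' `<=` class_cone e t by rewrite K'E => x [].
have st : e s t by apply: class_cone_sub => x /sK'/K't.
by apply/seteqP; split=> //; rewrite (class_cone_eq st).
Qed.

End Cones.

(** ** Vertices of a polytope *)

Section Vertices.

(** Finitely many vectors are distinguished by some direction in the cone of any
    given permutation: on the moment curve, two different vectors have the same
    value only at the roots of a nonzero polynomial. *)
Lemma generic_direction s k (V : 'I_k -> vec) :
  exists2 c, @perm_cone R n s c & forall i j, dot c (V i) = dot c (V j) -> V i = V j.
Proof.
pose pos (a : 'I_n) : nat := (s^-1)%g a.
pose pol (w : vec) : {poly R} := \sum_a w 0 a *: 'X^(pos a).
have pol0 w : w != 0 -> pol w != 0.
  apply: contraNneq => p0; apply/eqP/rowP => a; rewrite mxE.
  have : (pol w)`_(pos a) = 0 by rewrite p0 coef0.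
  rewrite /pol coef_sum (bigD1 a) //= coefZ coefXn eqxx mulr1 big1 ?addr0 // => b ba.
  rewrite coefZ coefXn [_ == _](_ : _ = false) ?mulr0 //.
  by apply/negP => /eqP/val_inj/perm_inj E; rewrite E eqxx in ba.
pose Q := \prod_(ij : 'I_k * 'I_k | V ij.1 - V ij.2 != 0) pol (V ij.1 - V ij.2).
have Q0 : Q != 0 by apply/prodf_neq0 => ij; apply: pol0.
have [m Qm] : exists m : nat, ~~ root Q m.+1%:R.
  apply/not_existsP => all_roots.
  have := @max_poly_roots _ Q [seq (m.+1)%:R | m <- iota 0 (size Q)] Q0.
  rewrite size_map size_iota ltnn => h; suff: false by []; apply: h.
    apply/allP => _ /mapP[m _ ->]; apply/negPn/negP; exact: all_roots.
  rewrite map_inj_uniq ?iota_uniq // => a b /eqP.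
  by rewrite eqr_nat => /eqP[].
pose c : vec := \row_a (m.+1%:R ^+ pos a).
have dotc w : dot c w = (pol w).[m.+1%:R].
  rewrite /pol horner_sum /dot; apply: eq_bigr => a _.
  by rewrite hornerZ hornerXn mxE mulrC.
exists c.
  by move=> p q pq; rewrite !mxE /pos !permK; apply: ler_weXn2l => //; rewrite ler1n.
move=> i j h; apply/eqP; rewrite -subr_eq0; apply: contraNT Qm => ne.
rewrite /root /Q horner_prod; apply/prodf_eq0; exists (i, j) => //=.
by rewrite -dotc dotBr h subrr.
Qed.

Variable P : set vec.

(** A direction exposing the vertex [v] is maximal at [v] only, so a face to which
    it is normal has no other point. *)
Lemma normal_cone_vertex v F : vertices P v -> polytope_face P F ->
  normal_cone P [set v] `<=` normal_cone P F -> F = [set v].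
Proof.
move=> [_ [c vE]] [[x0 Fx0] [d FE]] sub.
have vP : P v /\ forall y, P y -> dot c y <= dot c v.
  by have : [set v] v by []; rewrite vE.
have cN : normal_cone P F c.
  by apply: sub => x y -> Py; apply: vP.2.
have uniq x : F x -> x = v.
  move=> Fx; have Px : P x by move: Fx; rewrite FE => -[].
  have : [set v] x.
    rewrite vE; split=> // y Py; apply: le_trans (vP.2 _ Py) _; apply: cN => //.
    exact: vP.1.
  by [].
apply/seteqP; split=> [x /uniq ->//|x ->]; by rewrite -(uniq _ Fx0).
Qed.

Lemma vertex_maximal v : vertices P v ->
  maximal_cones (normal_fan P) (normal_cone P [set v]).
Proof.
move=> vP; split; first by exists [set v].
by move=> K' [F [PF ->]] /(normal_cone_vertex vP PF) ->.
Qed.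

(** If a normal cone contains the cone of a permutation, its face is a vertex: a
    generic direction of that cone is maximal at a single point. *)
Lemma normal_cone_generic s F : polytope P -> polytope_face P F ->
  perm_cone s `<=` normal_cone P F -> exists2 v, vertices P v & F = [set v].
Proof.
move=> [k [V PE]] PF sub; have [[x0 Fx0] [d FE]] := PF.
have [c cs cV] := generic_direction s V.
have Px0 : P x0 by move: Fx0; rewrite FE => -[].
have k0 : (0 < k)%N.
  case: k V PE cV => // V PE _; move: Px0; rewrite PE => -[w [_]].
  by rewrite big_ord0 => /eqP; rewrite eq_sym oner_eq0.
case: k k0 V PE cV => // k _ V PE cV.
case: (@arg_maxP _ _ _ ord0 predT (fun i => dot c (V i)) isT) => i _ imax.
have PV j : P (V j).
  rewrite PE; exists (fun l => (l == j)%:R); split.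
  - by move=> l; rewrite ler0n.
  - by rewrite (bigD1 j) //= eqxx big1 ?addr0 // => l /negbTE ->.
  - by rewrite (bigD1 j) //= eqxx scale1r big1 ?addr0 // => l /negbTE ->; rewrite scale0r.
have top x : P x -> dot c x <= dot c (V i) /\ (dot c x = dot c (V i) -> x = V i).
  rewrite PE => -[w [w0 w1 ->]].
  have E : dot c (V i) - dot c (\sum_l w l *: V l) =
      \sum_l w l * (dot c (V i) - dot c (V l)).
    rewrite dot_sumr -[X in X - _]mul1r -w1 mulr_suml -sumrB.
    by apply: eq_bigr => l _; rewrite dotZr mulrBr.
  have pos l : 0 <= w l * (dot c (V i) - dot c (V l)).
    by rewrite mulr_ge0 // subr_ge0; apply: imax.
  split; first by rewrite -subr_ge0 E sumr_ge0.
  move=> h; rewrite h subrr in E; move/esym/eqP: E.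
  rewrite psumr_eq0 // => /allP all0.
  rewrite (eq_bigr (fun l => w l *: V i)); first by rewrite -scaler_suml w1 scale1r.
  move=> l _; have := all0 l (mem_index_enum _); rewrite mulf_eq0 => /orP[/eqP->|].
    by rewrite !scale0r.
  by rewrite subr_eq0 => /eqP/cV ->.
have vP : vertices P (V i).
  split; first by exists (V i).
  exists c; apply/seteqP; split=> [x ->|x [Px xmax]].
    by split=> // y /top[].
  have [h1 h2] := top _ Px; apply: h2; apply/eqP.
  by rewrite eq_le h1 /=; apply: xmax.
exists (V i) => //.
have FV x : F x -> x = V i.
  move=> Fx; have Px : P x by move: Fx; rewrite FE => -[].
  have [h1 h2] := top _ Px; apply: h2; apply/eqP; rewrite eq_le h1 /=.
  by apply: (sub _ cs) => //.
apply/seteqP; split=> [x /FV ->//|x ->]; by rewrite -(FV _ Fx0).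
Qed.

End Vertices.
End Geometry.

Section Main.
Local Open Scope classical_set_scope.

Lemma trees_cones (R : realType) (n : nat) (e : rel 'S_n)
    (he : lattice_congruence e) (hsimple : simple_congruence e)
    (hess : essential e) :
  (admissible_trees e #= maximal_cones (@quotient_fan R n e))%card.
Proof.
pose ext T := xget (1%g : 'S_n) [set s | extends T s].
have extP T : admissible e T -> extends T (ext T).
  move=> /(admissible_extension he hsimple)[s hs]; rewrite /ext.
  exact: (xgetI _ hs).
apply/card_set_bijP; exists (fun T => class_cone e (ext T)); split.
- by move=> T aT; apply/(maximal_conesE he); exists (ext T).
- move=> T T' /set_mem aT /set_mem aT' h.
  have tt' : e (ext T) (ext T') by apply: (class_cone_sub he (R := R)); rewrite h.
  apply: (admissible_inj he hsimple aT aT' (s := ext T')); last exact: extP.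
  exact/(admissible_class he hsimple _ aT (extP _ aT)).
move=> K /(maximal_conesE he)[s ->].
have [T aT ext_s] := admissible_tree_exists he hsimple hess s.
exists T => //; apply: (class_cone_eq R he).
exact/(admissible_class he hsimple _ aT (extP _ aT)).
Qed.

Lemma vertices_cones (R : realType) (n : nat) (e : rel 'S_n)
    (he : lattice_congruence e) (P : set 'rV[R]_n) : quotientope e P ->
  (vertices P #= maximal_cones (@quotient_fan R n e))%card.
Proof.
move=> [polyP fanE]; rewrite -fanE.
apply/card_set_bijP; exists (fun v => normal_cone P [set v]); split.
- by move=> v; apply: vertex_maximal.
- move=> v w /set_mem vP /set_mem wP h.
  have : [set w] = [set v] by apply: (normal_cone_vertex vP wP); rewrite h.
  by move=> E; have : [set v] w by rewrite -E.
move=> K Kmax; have [[F [PF KE]] _] := Kmax.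
have [s Ks] : exists s, K = class_cone e s.
  by apply/(maximal_conesE he); rewrite -fanE.
have [v vP FE] : exists2 v, vertices P v & F = [set v].
  apply: (normal_cone_generic (s := s) polyP PF); rewrite -KE Ks => x xs.
  by exists s => //; apply: cong_refl.
by exists v => //; rewrite KE FE.
Qed.

End Main.

Theorem corollary3p17 (R : realType) (n : nat) (hn : (0 < n)%N)
    (e : rel 'S_n)
    (he : lattice_congruence e) (hsimple : simple_congruence e)
    (hess : essential e) :
  (admissible_trees e #= maximal_cones (@quotient_fan R n e))%card /\
  (forall P : set 'rV[R]_n, quotientope e P ->
     (admissible_trees e #= vertices P)%card).
Proof.
have h := @trees_cones R n e he hsimple hess; split=> // P /(vertices_cones he) h'.
by apply: card_eq_trans h _; rewrite card_eq_sym.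
Qed.
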